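(* Let $L,L'$ be nondegenerate homogeneous linear pencils, where $L'$ has coefficients in $\mathbb C^{\ell'\times\ell}$. If $f:\mathcal B_L\to\mathcal B_{L'}$ is a pencil ball to pencil ball map, then $$(L'\circ f)(x)=\mathscr F_{L'\circ f(0)}\big(\varphi(x)\big),$$ where $$\varphi(x)=\mathscr F_{L'\circ f(0)}\big((L'\circ f)(x)\big)$$ is a pencil ball map $\mathcal B_L\to\mathcal M_{\ell',\ell}$ mapping $0$ to $0$. It is therefore completely described as follows: if $\tilde L$ is a minimal dimensional defining pencil for $\mathcal B_L$, then there are $m,m'\in\mathbb N_0$, unitaries $U\in\mathbb C^{\ell'\times\ell'}$, $V\in\mathbb C^{\ell\times\ell}$, and a contraction-valued analytic $\tilde f:\mathcal B_L\to\mathcal M_{m',m}$ with $$\varphi(x)=U\begin{pmatrix}\tilde L(x)&0\\0&\tilde f(x)\end{pmatrix}V^*.$$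
   Context: Pencils. A $d'\times d$ homogeneous linear pencil in $g$ variables is $L(x)=\sum_{j=1}^g A_jx_j$ with $A_j\in\mathbb C^{d'\times d}$. For $X=(X_1,\dots,X_g)\in(\mathbb C^{n\times n})^g$ put $L(X)=\sum_j A_j\otimes X_j$; $\|\cdot\|$ is the operator norm. $L$ is nondegenerate if for all $n$ and all $X\in(\mathbb C^{n\times n})^g$, $L(X)=0$ implies $X=0$. The pencil ball is $\mathcal B_L=(\mathcal B_L(n))_{n\in\mathbb N}$ with $\mathcal B_L(n)=\{X\in(\mathbb C^{n\times n})^g:\|L(X)\|<1\}$, and its boundary is $\partial\mathcal B_L=(\partial\mathcal B_L(n))_{n}$ with $\partial\mathcal B_L(n)=\{X:\|L(X)\|=1\}$. A nondegenerate $p'\times p$ homogeneous linear pencil $\tilde L$ is a minimal dimensional defining pencil for a ball if every nondegenerate $d'\times d$ homogeneous linear pencil $L$ with $\mathcal B_L=\mathcal B_{\tilde L}$ satisfies $p'p\le d'd$; it is a minimal dimensional defining pencil for $\mathcal B_L$ if moreover $\mathcal B_{\tilde L}=\mathcal B_L$. Analytic maps. $\mathcal M_{\ell',\ell}=((\mathbb C^{n\times n})^{\ell'\times\ell})_{n\in\mathbb N}$. Let $\langle x\rangle$ be the set of words in the noncommuting variables $x_1,\dots,x_g$ (including the empty word). A formal power series $f=\sum_{m\ge0}\sum_{|w|=m}f_ww$ with $f_w\in\mathbb C^{\ell'\times\ell}$ is evaluated at $X\in(\mathbb C^{n\times n})^g$ by $f(X)=\sum_{m=0}^\infty\sum_{|w|=m}f_w\otimes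 w(X)$ (summed in this order), where $w(X)=X_{j_1}\cdots X_{j_k}$ for $w=x_{j_1}\cdots x_{j_k}$. It is analytic on $\mathcal B_L$, written $f:\mathcal B_L\to\mathcal M_{\ell',\ell}$, if the series converges for all $n$ and all $X\in\mathcal B_L(n)$; it is contraction-valued if $\|f(X)\|\le1$ for all $X\in\mathcal B_L$. If $f$ is contraction-valued and $X\in\partial\mathcal B_L(n)$, the bounded analytic function $z\mapsto f(zX)$ on the unit disc has boundary values $f(\exp(it)X)$ for almost every $t$ (Fatou). A pencil ball map is a contraction-valued analytic $f$ with $\|f(\exp(it)X)\|=1$ for a.e. $t$, for every $n$ and every $X\in\partial\mathcal B_L(n)$. Maps between pencil balls. Let $L'$ be a homogeneous linear pencil in $g'$ variables. An analytic map $f:\mathcal B_L\to\mathcal B_{L'}$ is a tuple $f=(f_1,\dots,f_{g'})$ of formal power series with scalar coefficients, analytic on $\mathcal B_L$, with $f(X)\in\mathcal B_{L'}(n)$ for all $n$ and $X\in\mathcal B_L(n)$; $(L'\circ f)(X)=L'(f(X))$, and $L'\circ f(0)\in\mathbb C^{\ell'\times\ell}$ is its constant term. It is a pencil ball to pencil ball map if $f(\partial\mathcal B_L)\subseteq\partial\mathcal B_{L'}$, meaning in terms of boundary values: for every $n$ and $X\in\partial\mathcal B_L(n)$, the boundary values $(L'\circ f)(\exp(it)X)$ (which exist for a.e. $t$) have norm $1$ for a.e. $t$. Linear fractional maps. For an $\ell'\times\ell$ matrix $v$ with $\|v\|<1$ and $u$ of the same size with $\|u\|\le1$, $\mathscr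 F_v(u)=v-(I_{\ell'}-vv^* )^{1/2}u(I_\ell-v^*u)^{-1}(I_\ell-v^*v)^{1/2}$. When $v\in\mathbb C^{\ell'\times\ell}$ is applied to $u\in\mathbb C^{\ell'\times\ell}\otimes\mathbb C^{n\times n}$, $v$ is replaced by $v\otimes I_n$ (and identities are of the corresponding size). Blocks of size $0$ are allowed: if $m=0$ and/or $m'=0$ the corresponding block columns and/or rows are absent. *)

(* Defs.v *)
From HB Require Import structures.
From mathcomp Require Import all_boot all_order all_algebra.
From mathcomp Require Import all_classical all_reals all_analysis.
From mathcomp Require Import complex mxtens.

Set Implicit Arguments.
Unset Strict Implicit.
Unset Printing Implicit Defensive.

Import Order.TTheory GRing.Theory Num.Theory.
Import numFieldNormedType.Exports.

Local Open Scope classical_set_scope.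
Local Open Scope ring_scope.
Local Open Scope sesquilinear_scope.

(* The type annotation is what equips R[i], and hence matrices over it, with
   the topologies that MathComp-Analysis puts on a numClosedFieldType. *)
Definition Cplx (R : realType) : numClosedFieldType := R[i].

Section Matrices.
Variable R : realType.
Local Notation C := (Cplx R).

Definition normv k (x : 'cV[C]_k) : R :=
  Num.sqrt (\sum_(i < k) Normc.normc (x i 0) ^+ 2).

(* The set contains 0 and is bounded, so its supremum is the norm of A as an
   operator between Hilbert spaces; it is 0 when p = 0 or q = 0. *)
Definition opnorm p q (A : 'M[C]_(p, q)) : R :=
  sup [set normv (A *m x) | x in [set x : 'cV[C]_q | normv x <= 1]].

(* Functional calculus: spectralmx A is unitary and, for normal A,
   A = (spectralmx A)^-1 *m diag_mx (spectral_diag A) *m spectralmx A; hence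
   for positive semidefinite A this is its positive semidefinite root. *)
Definition psd_sqrtmx k (A : 'M[C]_k) : 'M[C]_k :=
  invmx (spectralmx A) *m diag_mx (map_mx sqrtC (spectral_diag A))
    *m spectralmx A.

(* Meaningful for opnorm v < 1 and opnorm u <= 1, when 1 - v^* u is
   invertible. *)
Definition linfrac p q (v u : 'M[C]_(p, q)) : 'M[C]_(p, q) :=
  v - psd_sqrtmx (1%:M - v *m v^t*) *m u *m invmx (1%:M - v^t* *m u)
        *m psd_sqrtmx (1%:M - v^t* *m v).

Definition ampl n p q (v : 'M[C]_(p, q)) : 'M[C]_(p * n, q * n) :=
  v *t (1%:M : 'M[C]_n).

End Matrices.

Section Pencils.
Variables (R : realType) (g : nat).
Local Notation C := (Cplx R).

Definition mxtuple n := 'I_g -> 'M[C]_n.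
Definition pencil p q := 'I_g -> 'M[C]_(p, q).

Definition pencil_eval p q (L : pencil p q) n (X : mxtuple n) :
    'M[C]_(p * n, q * n) :=
  \sum_(j < g) L j *t X j.

Definition nondegenerate_pencil p q (L : pencil p q) : Prop :=
  forall n (X : mxtuple n), pencil_eval L X = 0 -> forall j, X j = 0.

Definition pencil_ball p q (L : pencil p q) n : set (mxtuple n) :=
  [set X | opnorm (pencil_eval L X) < 1].

Definition pencil_bdry p q (L : pencil p q) n : set (mxtuple n) :=
  [set X | opnorm (pencil_eval L X) = 1].

Definition same_ball p q (L : pencil p q) p' q' (L' : pencil p' q') : Prop :=
  forall n, pencil_ball L (n:=n) = pencil_ball L' (n:=n).

Definition minimal_pencil p' p (Lt : pencil p' p) : Prop :=
  nondegenerate_pencil Lt /\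
  forall d' d (L : pencil d' d),
    nondegenerate_pencil L -> same_ball L Lt -> (p' * p <= d' * d)%N.

Definition minimal_pencil_for p' p (Lt : pencil p' p) d' d (L : pencil d' d) :
    Prop :=
  minimal_pencil Lt /\ same_ball Lt L.

Definition word := seq 'I_g.

Definition word_eval n (X : mxtuple n) (w : word) : 'M[C]_n :=
  \prod_(j <- w) X j.

Definition fps p q := word -> 'M[C]_(p, q).

Definition pencil_fps p q (L : pencil p q) : fps p q :=
  fun w => if w is [:: j] then L j else 0.

Definition fps_homog p q (f : fps p q) n (X : mxtuple n) (k : nat) :
    'M[C]_(p * n, q * n) :=
  \sum_(w : k.-tuple 'I_g) f w *t word_eval X w.

(* A junk value when the series diverges. *)
Definition fps_eval p q (f : fps p q) n (X : mxtuple n) :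
    'M[C]_(p * n, q * n) :=
  limn (series (fps_homog f X)).

Definition analytic d' d (L : pencil d' d) p q (f : fps p q) : Prop :=
  forall n (X : mxtuple n),
    pencil_ball L X -> cvgn (series (fps_homog f X)).

(* Scalar series are kept apart from fps 1 1, whose values have size
   (1 * n) x (1 * n) rather than n x n. *)
Definition sfps := word -> C.

Definition sfps_homog (f : sfps) n (X : mxtuple n) (k : nat) : 'M[C]_n :=
  \sum_(w : k.-tuple 'I_g) f w *: word_eval X w.

Definition sfps_eval (f : sfps) n (X : mxtuple n) : 'M[C]_n :=
  limn (series (sfps_homog f X)).

Definition sanalytic d' d (L : pencil d' d) (f : sfps) : Prop :=
  forall n (X : mxtuple n),
    pencil_ball L X -> cvgn (series (sfps_homog f X)).

Definition contraction_valued d' d (L : pencil d' d) p q (f : fps p q) : Prop :=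
  analytic L f /\
  forall n (X : mxtuple n), pencil_ball L X -> opnorm (fps_eval f X) <= 1.

Definition polar (r t : R) : C := (r * cos t +i* (r * sin t))%C.

(* The Fatou boundary value of F at exp(it) X is taken as a radial limit. *)
Definition boundary_value n p q (F : mxtuple n -> 'M[C]_(p, q))
    (X : mxtuple n) (t : R) (Y : 'M[C]_(p, q)) : Prop :=
  (fun r : R => F (fun j => polar r t *: X j)) @ 1^'- --> Y.

Definition bdry_norm1 n p q (F : mxtuple n -> 'M[C]_(p, q)) (X : mxtuple n) :
    Prop :=
  {ae (@lebesgue_measure R), forall t : R,
    exists2 Y, boundary_value F X t Y & opnorm Y = 1}.

Definition pencil_ball_map d' d (L : pencil d' d) p q (f : fps p q) : Prop :=
  contraction_valued L f /\
  forall n (X : mxtuple n),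
    pencil_bdry L X -> bdry_norm1 (fps_eval f (n:=n)) X.

End Pencils.

Section Maps.
Variables (R : realType) (g g' : nat).
Local Notation C := (Cplx R).

Definition sfps_tuple := 'I_g' -> sfps R g.

Definition tuple_eval (f : sfps_tuple) n (X : mxtuple R g n) : mxtuple R g' n :=
  fun j => sfps_eval (f j) X.

Definition comp_eval p q (L' : pencil R g' p q) (f : sfps_tuple) n
    (X : mxtuple R g n) : 'M[C]_(p * n, q * n) :=
  pencil_eval L' (tuple_eval f X).

Definition comp_const p q (L' : pencil R g' p q) (f : sfps_tuple) :
    'M[C]_(p, q) :=
  \sum_(j < g') f j [::] *: L' j.

Definition analytic_ball_map d' d (L : pencil R g d' d)
    p q (L' : pencil R g' p q) (f : sfps_tuple) : Prop :=
  (forall j, sanalytic L (f j)) /\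
  forall n (X : mxtuple R g n),
    pencil_ball L X -> pencil_ball L' (tuple_eval f X).

Definition ball_to_ball_map d' d (L : pencil R g d' d)
    p q (L' : pencil R g' p q) (f : sfps_tuple) : Prop :=
  analytic_ball_map L L' f /\
  forall n (X : mxtuple R g n),
    pencil_bdry L X -> bdry_norm1 (comp_eval L' f (n:=n)) X.

End Maps.

(* Main.v *)
Require Import Defs.
From HB Require Import structures.
From mathcomp Require Import all_boot all_order all_algebra.
From mathcomp Require Import all_classical all_reals all_analysis.
From mathcomp Require Import complex mxtens.
From mathcomp Require Import ring lra.

(** For |v| < 1 the map F_v is an involution of the closed unit ball of matrices
    that preserves the sphere of norm one, by the indefinite isometry of the
    Halmos matrix of v.  So phi = F_v o (L' o f) with v = (L' o f)(0) inherits the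
    boundary behaviour of u = L' o f, and F_v o phi = u.  The coefficients of phi
    satisfy a convolution recursion.  The errors e_m of its partial sums satisfy
    e_m = r_m + sum_i u_i v^* e_(m-i) with r_m a tail of the series u; the
    coefficients u_i act as a contractive Toeplitz matrix, so |v| < 1 bounds
    sum |e_m|^2 by a multiple of sum |r_m|^2, and phi converges on the ball.

    Let phi be a pencil ball map with phi(0) = 0 and linear part M.  At a nilpotent
    tuple X (x) E_10 only the linear part survives, so the boundary condition forces
    the balls of M and L to be equal.  If the ball of A is contained in that of M,
    then M_j = sum_i f_i^* A_j h_i with isometric columns (f_i), (h_i), by extension
    of positive functionals on quadratic forms and the spectral theorem.  For equal
    balls the two representations compose to one of A by itself; for a minimal
    pencil A a Schwarz inequality shows that its coefficients commute with A, and
    since A has no square zero commutant, intertwiners of A and M combine to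
    isometries W', W with M_j W = W' A_j and M_j^* W' = W A_j^*.

    Evaluating phi at block shifts whose entries vary along the diagonal isolates a
    word of length at least two and shows that the column with entries A_j and
    T_j = phi_(w j) W, suitably scaled, is contractive on the whole ball of A.
    Minimality of A then gives T = 0, and dually for W'^* phi_(j w).  Completing W'
    and W to unitaries gives the block form. *)

Set Implicit Arguments.
Unset Strict Implicit.
Unset Printing Implicit Defensive.

Import Order.TTheory GRing.Theory Num.Theory.
Import numFieldNormedType.Exports.

Local Open Scope classical_set_scope.
Local Open Scope ring_scope.
Local Open Scope sesquilinear_scope.

(** * Real inner products of complex matrices *)

(** Operator bounds are written with the squared Hilbert-Schmidt norm [nn] of matrices of arbitrary
    width. There a tensor product acts by x -> A x B^T, and a block shift acts on sequences of such
    x. Inclusion of the ball of A in that of M says that A_j -> M_j is completely contractive. In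
    finite dimension its extension and factorization come together: quadratic forms in a pair (y, x)
    carry A off the diagonal, M prescribes a positive functional on them, and the matrix
    representing an extension splits into evaluation points, which are the columns wanted.
    Minimality compares only products of sizes. Rigidity exploits it in a single way: no direction
    can be split off the domain of A without enlarging the ball. A direction on which c_i A_j = A_j
    d_i fails would fade when the representation is iterated, and so could be split off. Inverting 1
    - v^* u yields values of phi, but convergence is required for sums by degree; hence the square
    summable estimate for the partial sums. *)

Section ComplexMatrices.
Variable R : realType.
Local Notation C := (Cplx R).

Definition re (z : C) : R := complex.Re z.
Definition rc (r : R) : C := (r%:C)%C.

Lemma reD (z w : C) : re (z + w) = re z + re w.
Proof. by case: z w => [a b] [c d]. Qed.
Lemma reN (z : C) : re (- z) = - re z. Proof. by case: z. Qed.
Lemma re_sum I (r : seq I) (P : pred I) (F : I -> C) :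
  re (\sum_(i <- r | P i) F i) = \sum_(i <- r | P i) re (F i).
Proof. exact: (big_morph _ reD). Qed.

Lemma re_conj (z : C) : re (Num.conj z) = re z. Proof. by case: z. Qed.

Lemma re_rcM (r : R) (z : C) : re (rc r * z) = r * re z.
Proof. by case: z => a b; rewrite /re /= mul0r subr0. Qed.

Lemma re_rc (r : R) : re (rc r) = r. Proof. by []. Qed.

Lemma conj_rc (r : R) : Num.conj (rc r) = rc r.
Proof. exact: conjc_real. Qed.

Lemma re_mul_conj (z : C) : re (z * Num.conj z) = Normc.normc z ^+ 2.
Proof.
case: z => a b; rewrite /re /= sqr_sqrtr; last by rewrite addr_ge0 // sqr_ge0.
by rewrite mulrN opprK -!expr2.
Qed.

Lemma rc_re (z : C) : 0 <= z -> rc (re z) = z.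
Proof. by move=> h; exact: RRe_real (ger0_real h). Qed.

Lemma rcM (a b : R) : rc (a * b) = rc a * rc b.
Proof. exact: (rmorphM (real_complex R)). Qed.
Lemma rc_eq0 (a : R) : (rc a == 0) = (a == 0).
Proof. exact: (fmorph_eq0 (real_complex R)). Qed.

Section Adjoint.
Variables (m n : nat).
Implicit Types A B : 'M[C]_(m, n).
Lemma adjD A B : (A + B)^t* = A^t* + B^t*.
Proof. by rewrite linearD map_mxD. Qed.
Lemma adjN A : (- A)^t* = - A^t*.
Proof. by rewrite linearN map_mxN. Qed.
Lemma adjB A B : (A - B)^t* = A^t* - B^t*.
Proof. by rewrite adjD adjN. Qed.
Lemma adj0 : (0 : 'M[C]_(m, n))^t* = 0.
Proof. by rewrite trmx0 map_mx0. Qed.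
Lemma adjZ c A : (c *: A)^t* = Num.conj c *: A^t*.
Proof. by rewrite linearZ map_mxZ. Qed.
Lemma adjM p A (B : 'M[C]_(n, p)) : (A *m B)^t* = B^t* *m A^t*.
Proof. by rewrite trmx_mul map_mxM. Qed.
Lemma adj1 : (1%:M : 'M[C]_n)^t* = 1%:M.
Proof. by rewrite trmx1 map_mx1. Qed.
Lemma adj_sum I (r : seq I) (P : pred I) (F : I -> 'M[C]_(m, n)) :
  (\sum_(i <- r | P i) F i)^t* = \sum_(i <- r | P i) (F i)^t*.
Proof. by rewrite linear_sum map_mx_sum. Qed.
End Adjoint.

Lemma adjK m n (A : 'M[C]_(m, n)) : A^t*^t* = A. Proof. exact: trmxCK. Qed.

Lemma re_tr_adj n (A : 'M[C]_n) : re (\tr (A^t*)) = re (\tr A).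
Proof. by rewrite trace_map_mx mxtrace_tr re_conj. Qed.

(** The real Hilbert-Schmidt inner product. A matrix acts on all columns of x at once, so
    inequalities between [nn] for every width encode operator inequalities. *)
Definition ip m n (x y : 'M[C]_(m, n)) : R := re (\tr (x *m y^t*)).
Definition nn m n (x : 'M[C]_(m, n)) : R := ip x x.

Section InnerProduct.
Variables (m n : nat).
Implicit Types x y z : 'M[C]_(m, n).

Lemma ipC x y : ip x y = ip y x.
Proof. by rewrite /ip -re_tr_adj adjM adjK. Qed.
Lemma ipDl x y z : ip (x + y) z = ip x z + ip y z.
Proof. by rewrite /ip mulmxDl mxtraceD reD. Qed.
Lemma ipDr x y z : ip z (x + y) = ip z x + ip z y.
Proof. by rewrite ipC ipDl ![ip _ z]ipC. Qed.
Lemma ipNl x y : ip (- x) y = - ip x y.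
Proof. by rewrite /ip mulNmx raddfN reN. Qed.
Lemma ipNr x y : ip x (- y) = - ip x y.
Proof. by rewrite ipC ipNl ipC. Qed.
Lemma ipBl x y z : ip (x - y) z = ip x z - ip y z.
Proof. by rewrite ipDl ipNl. Qed.
Lemma ipBr x y z : ip z (x - y) = ip z x - ip z y.
Proof. by rewrite ipDr ipNr. Qed.
Lemma ip0l x : ip 0 x = 0.
Proof. by rewrite /ip mul0mx raddf0. Qed.
Lemma ip0r x : ip x 0 = 0.
Proof. by rewrite ipC ip0l. Qed.
Lemma ipZl (r : R) x y : ip (rc r *: x) y = r * ip x y.
Proof. by rewrite /ip -scalemxAl mxtraceZ re_rcM. Qed.
Lemma ipZr (r : R) x y : ip x (rc r *: y) = r * ip x y.
Proof. by rewrite ipC ipZl ipC. Qed.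
Lemma ip_suml I (r : seq I) (P : pred I) (F : I -> 'M[C]_(m, n)) y :
  ip (\sum_(i <- r | P i) F i) y = \sum_(i <- r | P i) ip (F i) y.
Proof. by rewrite /ip mulmx_suml (raddf_sum (@mxtrace _ m)) re_sum. Qed.
Lemma ip_sumr I (r : seq I) (P : pred I) (F : I -> 'M[C]_(m, n)) y :
  ip y (\sum_(i <- r | P i) F i) = \sum_(i <- r | P i) ip y (F i).
Proof. by rewrite ipC ip_suml; apply: eq_bigr => i _; rewrite ipC. Qed.

Lemma nnE x : nn x = \sum_i \sum_j Normc.normc (x i j) ^+ 2.
Proof.
rewrite /nn /ip /mxtrace re_sum; apply: eq_bigr => i _.
by rewrite !mxE re_sum; apply: eq_bigr => j _; rewrite !mxE re_mul_conj.
Qed.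
Lemma nn_ge0 x : 0 <= nn x.
Proof. by rewrite nnE; do 2!(apply: sumr_ge0 => ? _); rewrite sqr_ge0. Qed.
Lemma nn0 : nn (0 : 'M[C]_(m, n)) = 0. Proof. exact: ip0l. Qed.
Lemma nn_eq0 x : nn x = 0 -> x = 0.
Proof.
rewrite nnE => h; apply/matrixP => i j; rewrite mxE; apply: Normc.eq0_normc.
have hi : \sum_j Normc.normc (x i j) ^+ 2 = 0.
  by apply: (psumr_eq0P _ h) => // k _; apply: sumr_ge0 => l _; apply: sqr_ge0.
apply/eqP; rewrite -sqrf_eq0; apply/eqP.
by apply: (psumr_eq0P _ hi) => // k _; apply: sqr_ge0.
Qed.
Lemma nnN x : nn (- x) = nn x.
Proof. by rewrite /nn ipNl ipNr opprK. Qed.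
Lemma nnZ (c : C) x : nn (c *: x) = Normc.normc c ^+ 2 * nn x.
Proof.
rewrite !nnE mulr_sumr; apply: eq_bigr => i _; rewrite mulr_sumr.
by apply: eq_bigr => j _; rewrite mxE Normc.normcM exprMn.
Qed.
Lemma nnZr (r : R) x : nn (rc r *: x) = r ^+ 2 * nn x.
Proof. by rewrite /nn ipZl ipZr mulrA expr2. Qed.
Lemma nnD x y : nn (x + y) = nn x + 2 * ip x y + nn y.
Proof. by rewrite /nn ipDl !ipDr [ip y x]ipC; ring. Qed.
Lemma nnB x y : nn (x - y) = nn x - 2 * ip x y + nn y.
Proof. by rewrite nnD ipNr nnN mulrN. Qed.
Lemma ip_le_nn x y : 2 * ip x y <= nn x + nn y.
Proof. by have := nn_ge0 (x - y); rewrite nnB; lra. Qed.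
Lemma nnB_le2 x y : nn (x - y) <= 2 * nn x + 2 * nn y.
Proof.
have := ip_le_nn (- x) y; rewrite nnB ipNl nnN.
by move: (ip _ _) (nn x) (nn y) => a b c; lra.
Qed.
Lemma ip_le_nn_scaled (s : R) x y : 0 < s -> 2 * ip x y <= nn x / s + s * nn y.
Proof.
move=> s0; have := nn_ge0 (x - rc s *: y).
rewrite nnB ipZr nnZr => h; rewrite -(ler_pM2l s0).
have -> : s * (nn x / s + s * nn y) = nn x + s ^+ 2 * nn y.
  by rewrite mulrDr mulrCA divff ?gt_eqF // mulr1 mulrA expr2.
by rewrite mulrCA; lra.
Qed.
(** Convexity of the square: the defect is |(1 - t) x - t y|^2 / (t (1 - t)). It replaces the
    triangle inequality, as all norms are kept squared. *)
Lemma nnD_le (t : R) x y : 0 < t < 1 -> nn (x + y) <= nn x / t + nn y / (1 - t).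
Proof.
move=> /andP[t0 t1]; have u0 : 0 < 1 - t by lra.
have -> : x + y = x - (- y) by rewrite opprK.
set z := - y; rewrite -[nn y]nnN -/z nnB.
have := nn_ge0 (rc (1 - t) *: x + rc t *: z).
rewrite nnD !nnZr ipZl ipZr => h.
have e : nn x / t + nn z / (1 - t) - (nn x - 2 * ip x z + nn z) =
    ((1 - t) ^+ 2 * nn x + 2 * ((1 - t) * (t * ip x z)) + t ^+ 2 * nn z)
      / (t * (1 - t)).
  by field; rewrite !gt_eqF.
by rewrite -subr_ge0 e divr_ge0 // mulr_ge0 // ltW.
Qed.
End InnerProduct.

Lemma ip_mull m n p (A : 'M[C]_(m, n)) (x : 'M[C]_(n, p)) y :
  ip (A *m x) y = ip x (A^t* *m y).
Proof. by rewrite /ip adjM adjK -mulmxA mxtrace_mulC mulmxA. Qed.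
Lemma ip_mulr m n p (A : 'M[C]_(n, p)) (x : 'M[C]_(m, n)) y :
  ip (x *m A) y = ip x (y *m A^t*).
Proof. by rewrite /ip adjM adjK mulmxA. Qed.
Lemma ip_adj m n (x y : 'M[C]_(m, n)) : ip (x^t*) (y^t*) = ip x y.
Proof. by rewrite [RHS]ipC /ip adjK mxtrace_mulC. Qed.
Lemma nn_adj m n (x : 'M[C]_(m, n)) : nn (x^t*) = nn x.
Proof. exact: ip_adj. Qed.
Lemma nn_isom m n p (A : 'M[C]_(m, n)) (x : 'M[C]_(n, p)) :
  A^t* *m A = 1%:M -> nn (A *m x) = nn x.
Proof. by move=> h; rewrite /nn ip_mull mulmxA h mul1mx. Qed.
Lemma nn_isomr m n p (A : 'M[C]_(m, n)) (x : 'M[C]_(p, m)) :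
  A *m A^t* = 1%:M -> nn (x *m A) = nn x.
Proof. by move=> h; rewrite /nn ip_mulr -mulmxA h mulmx1. Qed.

Lemma eq_mx_ip m n (A B : 'M[C]_(m, n)) : (forall Q, ip Q A = ip Q B) -> A = B.
Proof.
move=> h; apply/subr0_eq/nn_eq0.
by rewrite /nn ipBr h subrr.
Qed.

End ComplexMatrices.
Arguments rc {R}. Arguments re {R}.

(** * Positive semidefinite matrices *)

Section FunctionalCalculus.
Variable R : realType.
Local Notation C := (Cplx R).

Definition psd k (H : 'M[C]_k) : Prop :=
  H^t* = H /\ forall n (x : 'M[C]_(k, n)), 0 <= ip (H *m x) x.

(** Only the values of h at the eigenvalues matter, so discontinuous h are allowed; kernel
    projections and pseudo-inverses are obtained this way. *)
Definition fcalc k (h : C -> C) (H : 'M[C]_k) : 'M[C]_k :=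
  (spectralmx H)^t* *m diag_mx (map_mx h (spectral_diag H)) *m spectralmx H.

Lemma psd_sqrtmxE k (H : 'M[C]_k) : psd_sqrtmx H = fcalc sqrtC H.
Proof. by rewrite /psd_sqrtmx invmx_unitary ?spectral_unitarymx. Qed.

Section Spectral.
Variables (k : nat) (H : 'M[C]_k).
Hypothesis Hh : H^t* = H.
Local Notation P := (spectralmx H).

Lemma spectral_mulCmx : P^t* *m P = 1%:M.
Proof. by rewrite -(invmx_unitary (spectral_unitarymx H)) mulVmx ?spectral_unit. Qed.
Lemma spectral_mulmxC : P *m P^t* = 1%:M.
Proof. exact/unitarymxP/spectral_unitarymx. Qed.

Lemma fcalc_id : fcalc id H = H.
Proof.
rewrite /fcalc [map_mx id _]map_mx_id // -(invmx_unitary (spectral_unitarymx H)).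
apply/esym/orthomx_spectralP/normalmxP; by rewrite Hh.
Qed.

Lemma spectralE : H = P^t* *m diag_mx (spectral_diag H) *m P.
Proof. by rewrite -[LHS]fcalc_id /fcalc [map_mx id _]map_mx_id. Qed.

Lemma row_spectral r : row r P *m H = spectral_diag H 0 r *: row r P.
Proof.
rewrite {2}spectralE -row_mul !mulmxA spectral_mulmxC mul1mx.
by apply/rowP => j; rewrite mxE mul_diag_mx !mxE.
Qed.

Lemma spectral_diag_real r : spectral_diag H 0 r \is Num.real.
Proof.
have hs : H \is hermsymmx by apply/is_hermitianmxP; rewrite expr0 scale1r Hh.
by have /mxOverP/(_ 0 r) := hermitian_spectral_diag_real hs.
Qed.

Lemma spectral_col r : H *m (row r P)^t* = spectral_diag H 0 r *: (row r P)^t*.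
Proof.
have -> : H *m (row r P)^t* = (row r P *m H)^t*; first by rewrite adjM Hh.
by rewrite row_spectral adjZ (CrealP (spectral_diag_real r)).
Qed.

Lemma nn_row_spectral r : nn (row r P) = 1.
Proof.
rewrite /nn /ip.
have -> : row r P *m (row r P)^t* = (1%:M : 'M[C]_1).
  rewrite rowE adjM mulmxA -(mulmxA _ P) spectral_mulmxC mulmx1.
  rewrite trmx_delta map_delta_mx mul_delta_mx.
  by apply/matrixP => i j; rewrite !mxE !ord1.
by rewrite mxtrace1.
Qed.

End Spectral.

Lemma spectral_diag_ge0 k (H : 'M[C]_k) r : psd H -> 0 <= spectral_diag H 0 r.
Proof.
move=> [Hh Hp]; have real := spectral_diag_real Hh r.
have := Hp _ ((row r (spectralmx H))^t*); rewrite spectral_col //.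
rewrite -(RRe_real real) ipZl -/(nn _) nn_adj nn_row_spectral mulr1 => h.
by rewrite ler0c.
Qed.

Lemma fcalcM k (H : 'M[C]_k) h1 h2 :
  fcalc h1 H *m fcalc h2 H = fcalc (fun z => h1 z * h2 z) H.
Proof.
rewrite /fcalc !mulmxA -(mulmxA _ (spectralmx H)) spectral_mulmxC mulmx1.
rewrite -(mulmxA _ (diag_mx _) (diag_mx _)) mulmx_diag; congr (_ *m diag_mx _ *m _).
by apply/rowP => i; rewrite !mxE.
Qed.

Lemma fcalc_adj k (H : 'M[C]_k) h : (fcalc h H)^t* = fcalc (Num.conj \o h) H.
Proof.
rewrite /fcalc !adjM adjK mulmxA; congr (_ *m _ *m _).
by rewrite tr_diag_mx map_diag_mx; congr diag_mx; apply/rowP => i; rewrite !mxE.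
Qed.

Lemma eq_fcalc k (H : 'M[C]_k) h1 h2 :
  (forall r, h1 (spectral_diag H 0 r) = h2 (spectral_diag H 0 r)) ->
  fcalc h1 H = fcalc h2 H.
Proof.
move=> e; rewrite /fcalc; congr (_ *m diag_mx _ *m _).
by apply/rowP => i; rewrite !mxE e.
Qed.

Lemma fcalcB k (H : 'M[C]_k) h1 h2 :
  fcalc h1 H - fcalc h2 H = fcalc (fun z => h1 z - h2 z) H.
Proof.
rewrite /fcalc -mulmxBl -mulmxBr; congr (_ *m _ *m _).
by apply/matrixP => i j; rewrite !mxE -mulrnBl.
Qed.

Lemma fcalc1 k (H : 'M[C]_k) : fcalc (fun=> 1) H = 1%:M.
Proof.
rewrite /fcalc; have -> : map_mx (fun=> 1) (spectral_diag H) = const_mx (1 : C).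
  by apply/rowP => i; rewrite !mxE.
by rewrite diag_const_mx mulmx1 spectral_mulCmx.
Qed.

(** In the two eigenbases an entry of M vanishes unless its eigenvalues of S1 and S2 agree, and then
    h takes one value on both sides. *)
Lemma fcalc_intertwine h k1 k2 (S1 : 'M[C]_k1) (S2 : 'M[C]_k2) (M : 'M[C]_(k1, k2)) :
  S1^t* = S1 -> S2^t* = S2 -> S1 *m M = M *m S2 ->
  fcalc h S1 *m M = M *m fcalc h S2.
Proof.
move=> h1 h2 e.
set P1 := spectralmx S1; set P2 := spectralmx S2.
set M' := P1 *m M *m P2^t*.
have eM : diag_mx (spectral_diag S1) *m M' = M' *m diag_mx (spectral_diag S2).
  have -> : diag_mx (spectral_diag S1) *m M' = P1 *m (S1 *m M) *m P2^t*.
    rewrite {2}(spectralE h1) /M' -/P1 !mulmxA.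
    by rewrite spectral_mulmxC mul1mx.
  rewrite e {1}(spectralE h2) /M' -/P2 !mulmxA -(mulmxA _ P2).
  by rewrite spectral_mulmxC mulmx1.
have eh : diag_mx (map_mx h (spectral_diag S1)) *m M' =
          M' *m diag_mx (map_mx h (spectral_diag S2)).
  apply/matrixP => i j; move/matrixP/(_ i j): eM.
  rewrite !mul_diag_mx !mul_mx_diag ![_ i j]mxE !mxE => /eqP.
  rewrite [X in _ == X]mulrC -subr_eq0 -mulrBl mulf_eq0 subr_eq0.
  by case/orP => [/eqP ->|/eqP ->]; rewrite ?mulr0 ?mul0r // mulrC.
have eMM : M = P1^t* *m M' *m P2.
  by rewrite /M' !mulmxA spectral_mulCmx mul1mx -mulmxA spectral_mulCmx mulmx1.
clearbody M'.
rewrite {1}eMM /fcalc -/P1 -/P2 !mulmxA -(mulmxA _ P1) spectral_mulmxC mulmx1.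
rewrite -(mulmxA _ (diag_mx _)) eh.
by rewrite [in RHS]eMM -!mulmxA (mulmxA P2) spectral_mulmxC mul1mx.
Qed.

Section Sqrt.
Variables (k : nat) (H : 'M[C]_k).
Hypothesis Hp : psd H.
Local Notation T := (psd_sqrtmx H).

Lemma psd_sqrtmx_adj : T^t* = T.
Proof.
rewrite psd_sqrtmxE fcalc_adj; apply: eq_fcalc => r /=.
by rewrite geC0_conj // sqrtC_ge0 spectral_diag_ge0.
Qed.
Lemma psd_sqrtmxK : T *m T = H.
Proof.
rewrite psd_sqrtmxE fcalcM -[RHS]fcalc_id; last by case: Hp.
by apply: eq_fcalc => r; rewrite -expr2 sqrtCK.
Qed.
Lemma psd_sqrtmx_unit : H \in unitmx -> T \in unitmx.
Proof. by rewrite -{1}psd_sqrtmxK unitmx_mul => /andP[]. Qed.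
End Sqrt.

Lemma psd_sqrtmx_intertwine k1 k2 (S1 : 'M[C]_k1) (S2 : 'M[C]_k2)
    (M : 'M[C]_(k1, k2)) :
  S1^t* = S1 -> S2^t* = S2 -> S1 *m M = M *m S2 ->
  psd_sqrtmx S1 *m M = M *m psd_sqrtmx S2.
Proof. by rewrite !psd_sqrtmxE; exact: fcalc_intertwine. Qed.

End FunctionalCalculus.

(** * Positive functionals on quadratic forms *)

Section PositiveExtension.
Variables (R : realType) (E : Type).
Implicit Types (G : (E -> R) -> R -> Prop) (v w : E -> R).

(* The graph of a positive linear functional on a subspace of E -> R. *)
Definition positive_graph G : Prop :=
  [/\ forall v a w b, G v a -> G w b -> G (fun e => v e + w e) (a + b),
      forall (c : R) v a, G v a -> G (fun e => c * v e) (c * a)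
    & forall v a, G v a -> (forall e, 0 <= v e) -> 0 <= a].

(** Monotonicity. Used in both directions on one vector, it shows that a positive relation is
    single-valued. *)
Lemma positive_graph_le G v a w b : positive_graph G ->
  G v a -> G w b -> (forall e, v e <= w e) -> a <= b.
Proof.
move=> [GD GZ G0] Gv Gw le_vw; rewrite -subr_ge0 -mulN1r addrC.
apply: (G0 _ _ (GD _ _ _ _ (GZ (-1) _ _ Gv) Gw)) => e.
by rewrite mulN1r addrC subr_ge0.
Qed.

(** Riesz extension by one vector: the supremum of the values of minorants of v0 is an admissible
    value for v0. *)
Lemma positive_graph_extend G v0 : positive_graph G ->
  (exists v a, G v a /\ forall e, v0 e <= v e) ->
  (exists v a, G v a /\ forall e, v e <= v0 e) ->
  exists G', [/\ positive_graph G', forall v a, G v a -> G' v a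
               & exists a, G' v0 a].
Proof.
move=> pG [v1 [a1 [G1 le1]]] [v2 [a2 [G2 le2]]]; have [GD GZ G0] := pG.
pose S := [set a | exists v, G v a /\ forall e, v e <= v0 e].
have Sne : S !=set0 by exists a2, v2.
have ubS v a : G v a -> (forall e, v0 e <= v e) -> ubound S a.
  move=> Gv hv b [w [Gw hw]]; apply: (positive_graph_le pG Gw Gv) => e.
  exact: le_trans (hw e) (hv e).
have hS : has_sup S by split => //; exists a1; apply: ubS G1 le1.
pose alpha := sup S.
exists (fun w b => exists v a c,
  [/\ G v a, w = (fun e => v e + c * v0 e) & b = a + c * alpha]).
split.
- split.
  + move=> _ _ _ _ [v [a [c [Gv -> ->]]]] [w [b [d [Gw -> ->]]]].
    exists (fun e => v e + w e), (a + b), (c + d); split; first exact: GD.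
      by apply: funext => e; ring.
    by ring.
  + move=> k _ _ [v [a [c [Gv -> ->]]]].
    exists (fun e => k * v e), (k * a), (k * c); split; first exact: GZ.
      by apply: funext => e; ring.
    by ring.
  + move=> _ _ [v [a [c [Gv -> ->]]]] h.
    (* For c > 0 the vector -v/c lies below v0, so its value is at most the supremum; for c < 0 it
       lies above v0 and bounds the supremum. *)
    have [c0|c0|c0] := ltgtP c 0; last first.
    * by rewrite c0 mul0r addr0; apply: (G0 _ _ Gv) => e; have := h e; rewrite c0; lra.
    * have : - c^-1 * a <= alpha.
        apply: sup_upper_bound => //; exists (fun e => - c^-1 * v e).
        split; first exact: GZ.
        move=> e; rewrite -(ler_pM2l c0) mulrA mulrN divff ?gt_eqF // mulN1r.
        by have := h e; lra.
      by rewrite -(ler_pM2l c0) mulrA mulrN divff ?gt_eqF // mulN1r; lra.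
    * have nc0 : 0 < - c by lra.
      have : alpha <= (- c)^-1 * a.
        apply: ge_sup => //; apply: (ubS (fun e => (- c)^-1 * v e)).
          exact: GZ.
        move=> e; rewrite -(ler_pM2l nc0) mulrA divff ?gt_eqF // mul1r.
        by have := h e; lra.
      by rewrite -(ler_pM2l nc0) mulrA divff ?gt_eqF // mul1r; lra.
- move=> v a Gv; exists v, a, 0; split=> //; last by rewrite mul0r addr0.
  by apply: funext => e; rewrite mul0r addr0.
- exists alpha, (fun e => 0 * v2 e), (0 * a2), 1; split; first exact: GZ.
    by apply: funext => e; rewrite mul0r mul1r add0r.
  by rewrite mul0r mul1r add0r.
Qed.

Lemma positive_graph_extend_seq (T : eqType) (s : seq T) (f : T -> E -> R) G :
  positive_graph G ->
  (forall t, exists v a, G v a /\ forall e, f t e <= v e) ->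
  (forall t, exists v a, G v a /\ forall e, v e <= f t e) ->
  exists G', [/\ positive_graph G', forall v a, G v a -> G' v a
               & forall t, t \in s -> exists a, G' (f t) a].
Proof.
move=> pG; elim: s => [|t s IH] up lo; first by exists G; split.
have [G1 [pG1 sub1 ext1]] := IH up lo.
have [v [a [Gv hv]]] := up t; have [w [b [Gw hw]]] := lo t.
have [||G2 [pG2 sub2 [c ext2]]] := @positive_graph_extend G1 (f t) pG1.
- by exists v, a; split=> //; apply: sub1.
- by exists w, b; split=> //; apply: sub1.
exists G2; split=> //; first by move=> x y /sub1 /sub2.
move=> u; rewrite inE => /orP[/eqP ->|/ext1[x /sub2 hx]]; first by exists c.
by exists x.
Qed.

Lemma positive_graph_sum G (I : Type) (r : seq I) (F : I -> E -> R) (a c : I -> R) :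
  positive_graph G -> (exists v b, G v b) -> (forall i, G (F i) (a i)) ->
  G (fun e => \sum_(i <- r) c i * F i e) (\sum_(i <- r) c i * a i).
Proof.
move=> [GD GZ _] [v [b Gv]] h; elim: r => [|i r IH].
  have := GZ 0 _ _ Gv; congr G; last by rewrite big_nil mul0r.
  by apply: funext => e; rewrite big_nil mul0r.
have := GD _ _ _ _ (GZ (c i) _ _ (h i)) IH; congr G; last by rewrite big_cons.
by apply: funext => e; rewrite big_cons.
Qed.

End PositiveExtension.

Section QuadraticForms.
Variables (R : realType) (m : nat).
Local Notation C := (Cplx R).

Definition qform (Q : 'M[C]_m) (e : 'rV[C]_m) : R := ip (e *m Q) e.

(** A basis over the reals: E_ij for [true], i E_ij for [false]. *)
Let elem (t : 'I_m * 'I_m * bool) : 'M[C]_m :=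
  (if t.2 then 1 else 'i%C) *: delta_mx t.1.1 t.1.2.
Let coord (Q : 'M[C]_m) (t : 'I_m * 'I_m * bool) : R :=
  let z := Q t.1.1 t.1.2 in if t.2 then re z else complex.Im z.

Lemma qformD Q Q' e : qform (Q + Q') e = qform Q e + qform Q' e.
Proof. by rewrite /qform mulmxDr ipDl. Qed.
Lemma qformN Q e : qform (- Q) e = - qform Q e.
Proof. by rewrite /qform mulmxN ipNl. Qed.
Lemma qformZ r Q e : qform (rc r *: Q) e = r * qform Q e.
Proof. by rewrite /qform -scalemxAr ipZl. Qed.
Lemma qform_sum I (s : seq I) (F : I -> 'M[C]_m) e :
  qform (\sum_(i <- s) F i) e = \sum_(i <- s) qform (F i) e.
Proof. by rewrite /qform mulmx_sumr ip_suml. Qed.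

Let elem_sum Q : Q = \sum_t rc (coord Q t) *: elem t.
Proof.
rewrite -(pair_bigA _ (fun ij b => rc (coord Q (ij, b)) *: elem (ij, b))) /=.
rewrite -(pair_bigA _ (fun i j => \sum_b rc (coord Q (i, j, b)) *: elem (i, j, b))) /=.
rewrite {1}[Q]matrix_sum_delta; apply: eq_bigr => i _; apply: eq_bigr => j _.
rewrite big_bool /= /elem /coord /= !scalerA -scalerDl mulr1; congr (_ *: _).
by rewrite {1}[Q i j]complexE mulrC [X in _ = _ + X]mulrC addrC [RHS]addrC mulrC.
Qed.

Lemma spectral_sum (K : 'M[C]_m) : K^t* = K ->
  K = \sum_r spectral_diag K 0 r *:
        ((row r (spectralmx K))^t* *m row r (spectralmx K)).
Proof.
move=> hK; rewrite -[LHS]mul1mx -(spectral_mulCmx K) -mulmxA.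
set P := spectralmx K.
have -> : P^t* *m (P *m K) = \sum_r (row r P)^t* *m (row r P *m K).
  under eq_bigr do rewrite -row_mul.
  move: (P *m K) => M; apply/matrixP => i j; rewrite summxE mxE.
  by apply: eq_bigr => k _; rewrite !mxE big_ord1 !mxE.
by apply: eq_bigr => r _; rewrite /P row_spectral // scalemxAr.
Qed.

(* The Gram matrix of the extended functional is positive semidefinite, so by
   the spectral theorem the functional is a sum of evaluations. *)
Lemma positive_functional_evaluations (G : ('rV[C]_m -> R) -> R -> Prop) :
  positive_graph G ->
  (forall Q, exists v a, G v a /\ forall e, qform Q e <= v e) ->
  exists k : 'I_m -> 'rV[C]_m,
    forall Q a, G (qform Q) a -> a = \sum_r qform Q (k r).
Proof.
move=> pG up.
have lo Q : exists v a, G v a /\ forall e, v e <= qform Q e.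
  have [v [a [Gv h]]] := up (- Q); have [_ GZ _] := pG.
  exists (fun e => -1 * v e), (-1 * a); split; first exact: GZ.
  by move=> e; have := h e; rewrite qformN; lra.
have [G' [pG' sub ext]] := positive_graph_extend_seq (index_enum _) pG
  (fun t => up (elem t)) (fun t => lo (elem t)).
have {}ext t : exists a, G' (qform (elem t)) a by apply: ext; apply: mem_index_enum.
have [a ha] := choice ext.
(* Riesz representative of the extended functional: the real and imaginary parts of its entries are
   the values at E_ij and i E_ij. *)
pose K : 'M[C]_m := \matrix_(i, j) (a (i, j, true) +i* a (i, j, false))%C.
have GK Q : G' (qform Q) (ip Q K).
  have [v [b [Gv _]]] := up 0.
  have := positive_graph_sum (index_enum _) (coord Q) pG'
    (ex_intro _ _ (ex_intro _ _ (sub _ _ Gv))) ha.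
  congr G'.
    apply: funext => e; rewrite [in RHS](elem_sum Q) qform_sum.
    by apply: eq_bigr => t _; rewrite qformZ.
  rewrite (eq_bigr (fun t => coord Q (t.1.1, t.1.2, t.2) * a (t.1.1, t.1.2, t.2)));
    last by case=> [[]].
  rewrite -(pair_bigA _ (fun ij b => coord Q (ij.1, ij.2, b) * a (ij.1, ij.2, b))) /=.
  rewrite -(pair_bigA _ (fun i j => \sum_b coord Q (i, j, b) * a (i, j, b))) /=.
  rewrite /ip /mxtrace re_sum; apply: eq_bigr => i _.
  rewrite mxE re_sum; apply: eq_bigr => j _; rewrite !mxE big_bool /coord /=.
  by case: (Q i j) => x y; rewrite /re /=; ring.
have uniqF Q b : G' (qform Q) b -> b = ip Q K.
  move=> h; apply/le_anti/andP; split.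
    exact: positive_graph_le pG' h (GK Q) _.
  exact: positive_graph_le pG' (GK Q) h _.
(* A skew-Hermitian Q has zero quadratic form, so the functional kills it; applied to K - K^* this
   makes K Hermitian. *)
have skew Q : Q^t* = - Q -> ip Q K = 0.
  move=> hQ; apply/esym/uniqF; have [v [b [Gv _]]] := up 0.
  have [_ GZ _] := pG'; have := GZ 0 _ _ (sub _ _ Gv); congr G'; last by rewrite mul0r.
  apply: funext => e; rewrite mul0r /qform; apply/esym.
  have : ip (e *m Q) e = - ip (e *m Q) e by rewrite {1}ip_mulr hQ mulmxN ipNr ipC.
  by lra.
have hK : K^t* = K.
  apply/esym/subr0_eq/nn_eq0.
  have sk : (K - K^t*)^t* = - (K - K^t*) by rewrite adjB adjK opprB.
  by rewrite /nn ipBr skew // -ip_adj adjK sk ipNl skew // oppr0 subr0.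
have la0 r : 0 <= re (spectral_diag K 0 r) /\
    rc (re (spectral_diag K 0 r)) = spectral_diag K 0 r.
  have e : rc (re (spectral_diag K 0 r)) = spectral_diag K 0 r.
    exact: RRe_real (spectral_diag_real hK r).
  split=> //; set c := row r (spectralmx K).
  have : 0 <= ip (c^t* *m c) K.
    have [_ _ G0] := pG'; apply: (G0 _ _ (GK _)) => f.
    by rewrite /qform mulmxA ip_mulr nn_ge0.
  by rewrite ip_mull adjK row_spectral // -e ipZr -/(nn _) nn_row_spectral mulr1 re_rc.
exists (fun r => rc (Num.sqrt (re (spectral_diag K 0 r))) *: row r (spectralmx K)).
move=> Q b /sub /uniqF ->; rewrite {1}(spectral_sum hK) ip_sumr; apply: eq_bigr => r _.
have [ge0 e] := la0 r; rewrite -{1}e ipZr /qform -scalemxAl ipZl ipZr mulrA.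
rewrite -expr2 sqr_sqrtr //; congr (_ * _).
by rewrite /ip adjM adjK mulmxA mxtrace_mulC mulmxA.
Qed.

End QuadraticForms.

(** * Contractive implications between pencils *)

Section NormEstimates.
Variable R : realType.
Local Notation C := (Cplx R).

Lemma nn_sum_le m n (I : finType) (F : I -> 'M[C]_(m, n)) :
  nn (\sum_i F i) <= #|I|%:R * \sum_i nn (F i).
Proof.
rewrite /nn ip_suml -(ler_pM2l (ltr0Sn R 1)) mulr_sumr.
have -> : 2 * (#|I|%:R * \sum_i ip (F i) (F i)) =
    \sum_i \sum_j (nn (F i) + nn (F j)).
  under [RHS]eq_bigr => i _ do rewrite big_split /= sumr_const.
  rewrite big_split /= sumr_const sumrMnl -mulr_natl -[#|I|]/(#|xpredT|).
  by move: (#|_|) => k; rewrite /nn; ring.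
apply: ler_sum => i _; rewrite ip_sumr mulr_sumr; apply: ler_sum => j _.
exact: ip_le_nn.
Qed.

Lemma nn_mulmx_le m k n (A : 'M[C]_(m, k)) (x : 'M[C]_(k, n)) :
  nn (A *m x) <= k%:R * nn A * nn x.
Proof.
have -> : A *m x = \sum_r col r A *m row r x.
  apply/matrixP => i j; rewrite summxE mxE; apply: eq_bigr => l _.
  by rewrite !mxE big_ord1 !mxE.
apply: le_trans (nn_sum_le _) _; rewrite card_ord -mulrA ler_wpM2l //.
have nnx : nn x = \sum_r nn (row r x).
  rewrite nnE; apply: eq_bigr => r _; rewrite nnE big_ord1.
  by apply: eq_bigr => j _; rewrite mxE.
rewrite nnx mulr_sumr; apply: ler_sum => r _.
have -> : nn (col r A *m row r x) = nn (col r A) * nn (row r x).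
  rewrite !nnE big_ord1 mulr_suml; apply: eq_bigr => i _.
  rewrite big_ord1 mulr_sumr; apply: eq_bigr => j _.
  by rewrite !mxE big_ord1 !mxE Normc.normcM exprMn.
rewrite ler_wpM2r ?nn_ge0 // !nnE; apply: ler_sum => i _.
by rewrite big_ord1 mxE (bigD1 r) //= lerDl sumr_ge0 // => ? _; rewrite sqr_ge0.
Qed.

Lemma nn_mulmx_bounded m k (A : 'M[C]_(m, k)) :
  exists2 c : R, 0 < c & forall n (x : 'M[C]_(k, n)), nn (A *m x) <= c * nn x.
Proof.
exists (k%:R * nn A + 1) => [|n x].
  by rewrite ltr_pwDr // mulr_ge0 ?nn_ge0.
by rewrite mulrDl mul1r; apply: ler_wpDr; [exact: nn_ge0 | exact: nn_mulmx_le].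
Qed.

Lemma ip_rows m n (x y : 'M[C]_(m, n)) : ip x y = \sum_r ip (row r x) (row r y).
Proof.
rewrite /ip /mxtrace re_sum; apply: eq_bigr => r _; rewrite big_ord1.
by congr re; rewrite !mxE; apply: eq_bigr => j _; rewrite !mxE.
Qed.

Lemma unitmx_inj k (A : 'M[C]_k) :
  (forall x : 'cV[C]_k, A *m x = 0 -> x = 0) -> A \in unitmx.
Proof.
move=> h; rewrite -unitmx_tr -row_free_unit; apply: inj_row_free => v hv.
apply: trmx_inj; rewrite trmx0; apply: h; apply: trmx_inj.
by rewrite trmx_mul trmxK hv trmx0.
Qed.

Lemma ip_mxvec m n (x y : 'M[C]_(m, n)) : ip (mxvec x) (mxvec y) = ip x y.
Proof.
rewrite /ip /mxtrace big_ord1 !re_sum mxE re_sum.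
rewrite (reindex _ (curry_mxvec_bij m n)) /=.
rewrite (eq_bigr (fun t => re (mxvec x 0 (mxvec_index t.1 t.2) *
  (mxvec y)^t* (mxvec_index t.1 t.2) 0))); last by case.
rewrite -(pair_bigA _ (fun i j => re (mxvec x 0 (mxvec_index i j) *
  (mxvec y)^t* (mxvec_index i j) 0))) /=.
apply: eq_bigr => i _; rewrite mxE re_sum; apply: eq_bigr => j _.
by rewrite !mxE !mxvecE.
Qed.

Lemma nn_row_mx m n1 n2 (x : 'M[C]_(m, n1)) (y : 'M[C]_(m, n2)) :
  nn (row_mx x y) = nn x + nn y.
Proof.
rewrite !nnE -big_split; apply: eq_bigr => i _ /=.
by rewrite big_split_ord /=; congr (_ + _); apply: eq_bigr => j _;
  rewrite ?row_mxEl ?row_mxEr.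
Qed.

Lemma nn_mxvec m n (x : 'M[C]_(m, n)) : nn (mxvec x) = nn x.
Proof. exact: ip_mxvec. Qed.

Lemma qform_of_linear m a b (S T : {linear 'rV[C]_m -> 'M[C]_(a, b)}) :
  exists Q, forall e, ip (S e) (T e) = qform Q e.
Proof.
exists (lin1_mx (mxvec \o S) *m (lin1_mx (mxvec \o T))^t*) => e.
rewrite /qform mulmxA ip_mulr adjK !mul_rV_lin1 /=.
by rewrite ip_mxvec.
Qed.

(** The eps makes the Hermitian part of a positive definite, so that its root S is invertible. As r
    > 0, positivity at height r can be tested on single rows. *)
Lemma posdef_factor k r (a : 'M[C]_k) (eps : R) : (0 < r)%N -> 0 < eps ->
  (forall y : 'M[C]_(r, k), 0 <= ip (y *m a) y) ->
  exists S : 'M[C]_k, [/\ S \in unitmx, S^t* = S,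
    nn S = re (\tr a) + eps * k%:R
    & forall n (y : 'M[C]_(n, k)), nn (y *m S) = ip (y *m a) y + eps * nn y].
Proof.
case: r => // r _ eps0 ha.
have hrow n (y : 'M[C]_(n, k)) : 0 <= ip (y *m a) y.
  rewrite ip_rows; apply: sumr_ge0 => i _; rewrite row_mul.
  pose D : 'cV[C]_r.+1 := delta_mx 0 0.
  have DK : D^t* *m D = 1%:M.
    rewrite trmx_delta map_delta_mx mul_delta_mx.
    by apply/matrixP => u v; rewrite !mxE !ord1.
  have := ha (D *m row i y).
  by rewrite -mulmxA ip_mull !mulmxA DK mul1mx.
pose H := rc 2^-1 *: (a + a^t*) + (rc eps)%:M.
have HE n (y : 'M[C]_(n, k)) : ip (y *m H) y = ip (y *m a) y + eps * nn y.
  rewrite mulmxDr ipDl -scalemxAr ipZl mulmxDr ipDl mul_mx_scalar ipZl.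
  by rewrite [ip (y *m a^t*) y]ip_mulr adjK [ip y _]ipC /nn; field.
have Hadj : H^t* = H.
  rewrite adjD adjZ conj_rc adjD adjK [a^t* + a]addrC; congr (_ + _).
  by rewrite tr_scalar_mx map_scalar_mx /= conj_rc.
have Hpsd n (x : 'M[C]_(k, n)) : ip (H *m x) x = ip (x^t* *m a) (x^t*) + eps * nn x.
  by rewrite -(nn_adj x) -HE -ip_adj adjM Hadj.
have pH : psd H.
  by split=> // n x; rewrite Hpsd addr_ge0 // mulr_ge0 ?nn_ge0 // ltW.
have uH : H \in unitmx.
  apply: unitmx_inj => x hx; apply: nn_eq0; apply/le_anti/andP; split; last exact: nn_ge0.
  have := Hpsd _ x; rewrite hx ip0l => e; rewrite -(ler_pM2l eps0) mulr0.
  by have := hrow _ (x^t*); lra.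
have SE n (y : 'M[C]_(n, k)) : nn (y *m psd_sqrtmx H) = ip (y *m a) y + eps * nn y.
  by rewrite /nn ip_mulr psd_sqrtmx_adj // -mulmxA psd_sqrtmxK // ipC HE.
exists (psd_sqrtmx H); split=> //.
- exact: psd_sqrtmx_unit.
- exact: psd_sqrtmx_adj.
- rewrite -[psd_sqrtmx H]mul1mx SE mul1mx /nn /ip adj1 !mulmx1 mxtrace1.
  by congr (_ + _ * _); rewrite -[k%:R in LHS]/(1 *+ k) /re raddfMn.
Qed.

End NormEstimates.

(** * Two-sided representations from inclusions of balls *)

Section Wittstock.
Variables (R : realType) (g : nat).
Local Notation C := (Cplx R).

(* By [pball_opnorm] below, the pencil A evaluated at the transposes of the
   X j is a contraction. *)
Definition pball p' p (A : 'I_g -> 'M[C]_(p', p)) n n' (X : 'I_g -> 'M[C]_(n, n')) :=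
  forall (x : 'M[C]_(p, n)) (y : 'M[C]_(p', n')),
    2 * \sum_j ip (A j *m x *m X j) y <= nn x + nn y.

Lemma pball_le p' p (A : 'I_g -> 'M[C]_(p', p)) n n' (X : 'I_g -> 'M[C]_(n, n'))
    x y (s : R) :
  pball A X -> s = \sum_j ip (A j *m x *m X j) y -> 2 * s <= nn x + nn y.
Proof. by move=> h ->; exact: h. Qed.

(** A rectangular X is put into a corner of a square matrix of size n + n', and cutting test vectors
    down to the corner does not increase their norm. *)
Lemma pball_rect p' p (A : 'I_g -> 'M[C]_(p', p)) q' q (M : 'I_g -> 'M[C]_(q', q)) :
  (forall n (X : 'I_g -> 'M[C]_n), pball A X -> pball M X) ->
  forall n n' (X : 'I_g -> 'M[C]_(n, n')), pball A X -> pball M X.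
Proof.
move=> h n n' X hX.
pose E1 : 'M[C]_(n, n + n') := row_mx 1%:M 0.
pose E2 : 'M[C]_(n', n + n') := row_mx 0 1%:M.
have E1K : E1 *m E1^t* = 1%:M.
  by rewrite tr_row_mx map_col_mx mul_row_col mul0mx addr0 adj1 mul1mx.
have E2K : E2 *m E2^t* = 1%:M.
  by rewrite tr_row_mx map_col_mx mul_row_col mul0mx add0r adj1 mul1mx.
have le_coisom a b k (E : 'M[C]_(a, b)) (z : 'M[C]_(k, b)) :
    E *m E^t* = 1%:M -> nn (z *m E^t*) <= nn z.
  have e : ip z (z *m E^t* *m E) = nn (z *m E^t*) by rewrite ipC ip_mulr.
  by move=> hE; have := nn_ge0 (z - z *m E^t* *m E); rewrite nnB nn_isomr // e; lra.
have {}h : pball M (fun j => E1^t* *m X j *m E2).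
  apply: h => x y; apply: le_trans (lerD (le_coisom _ _ _ _ x E1K) (le_coisom _ _ _ _ y E2K)).
  have := hX (x *m E1^t*) (y *m E2^t*); congr (_ * _ <= _).
  by apply: eq_bigr => j _; rewrite !mulmxA [in RHS]ip_mulr.
move=> x y; have := h (x *m E1) (y *m E2).
rewrite !nn_isomr //; congr (_ * _ <= _); apply: eq_bigr => j _.
rewrite !mulmxA -(mulmxA _ E1) E1K mulmx1 ip_mulr -(mulmxA y) E2K mulmx1 //.
Qed.

Section Extension.
Variables (p' p q' q : nat).
Variables (A : 'I_g -> 'M[C]_(p', p)) (M : 'I_g -> 'M[C]_(q', q)).
Hypothesis p'_gt0 : (0 < p')%N.
Hypothesis p_gt0 : (0 < p)%N.
Hypothesis AM : forall n n' (X : 'I_g -> 'M[C]_(n, n')), pball A X -> pball M X.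

(** Quadratic forms in the pair (y, x), with free diagonal part (a, b) and the pencil off the
    diagonal. [trform] is the value that summation over the points (c_r, d_r) of a representation of
    M by A would give. *)
Let form (a : 'M[C]_q') (b : 'M[C]_q) (X : 'I_g -> 'M[C]_(q, q'))
    (y : 'M[C]_(p', q')) (x : 'M[C]_(p, q)) : R :=
  ip (y *m a) y + 2 * \sum_j ip (A j *m x *m X j) y + ip (x *m b) x.

Let trform (a : 'M[C]_q') (b : 'M[C]_q) (X : 'I_g -> 'M[C]_(q, q')) : R :=
  re (\tr a) + 2 * \sum_j re (\tr (M j *m X j)) + re (\tr b).

(** Up to eps the diagonal part is (S^2, T^2). Normalizing it to the identity turns a nonnegative
    form into the point -T^-1 X S^-1 of the ball of A, hence of M, and the test pair (T, S) undoes
    the normalization. *)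
Let trform_ge0 a b X : (forall y x, 0 <= form a b X y x) -> 0 <= trform a b X.
Proof.
move=> h.
suff le eps : 0 < eps -> - (eps * (q'%:R + q%:R)) <= trform a b X.
  apply/ler_addgt0Pr => e e0.
  have c0 : 0 < q'%:R + q%:R + 1 :> R by rewrite ltr_wpDl // addr_ge0.
  have := le (e / (q'%:R + q%:R + 1)) (divr_gt0 e0 c0).
  have : e / (q'%:R + q%:R + 1) * (q'%:R + q%:R) <= e.
    rewrite mulrAC ler_pdivrMr // ler_wpM2l // ?ltW //; lra.
  by lra.
move=> eps0.
have [//|//||S [uS hS nS SE]] := @posdef_factor _ q' p' a eps.
  move=> y; have := h y 0; rewrite /form mul0mx ip0l addr0.
  by rewrite big1 ?mulr0 ?addr0 // => j _; rewrite mulmx0 mul0mx ip0l.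
have [//|//||T [uT hT nT TE]] := @posdef_factor _ q p b eps.
  move=> x; have := h 0 x; rewrite /form mul0mx ip0l add0r.
  by rewrite big1 ?mulr0 ?add0r // => j _; rewrite ip0r.
have hSV : (invmx S)^t* = invmx S by rewrite trmx_inv map_invmx hS.
pose X' j := - (invmx T *m X j *m invmx S).
have ballA : pball A X'.
  move=> x y; have := h (y *m invmx S) (x *m invmx T); rewrite /form => hh.
  have := SE _ (y *m invmx S); rewrite -mulmxA mulVmx // mulmx1 => ->.
  have := TE _ (x *m invmx T); rewrite -mulmxA mulVmx // mulmx1 => ->.
  have e : \sum_j ip (A j *m x *m X' j) y =
      - \sum_j ip (A j *m (x *m invmx T) *m X j) (y *m invmx S).
    rewrite -sumrN; apply: eq_bigr => j _.
    by rewrite /X' mulmxN ipNl !mulmxA (ip_mulr (invmx S)) hSV.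
  rewrite e; have := mulr_ge0 (ltW eps0) (nn_ge0 (x *m invmx T)).
  by have := mulr_ge0 (ltW eps0) (nn_ge0 (y *m invmx S)); lra.
have := AM ballA T S; rewrite nS nT.
have -> : \sum_j ip (M j *m T *m X' j) S = - \sum_j re (\tr (M j *m X j)).
  rewrite -sumrN; apply: eq_bigr => j _.
  rewrite /X' mulmxN ipNl !mulmxA -(mulmxA _ T) mulmxV // mulmx1.
  by rewrite /ip hS -(mulmxA _ (invmx S)) mulVmx // mulmx1.
by rewrite /trform; lra.
Qed.

(** By [trform_ge0], [form] -> [trform] is a positive functional, hence a sum of evaluations at
    pairs (c_r, d_r). Varying a, b and X separately gives the three identities. Here m is the
    dimension of the space of pairs. *)
Theorem wittstock : exists N (c : 'I_N -> 'M[C]_(p', q')) (d : 'I_N -> 'M[C]_(p, q)),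
  [/\ \sum_r (c r)^t* *m c r = 1%:M, \sum_r (d r)^t* *m d r = 1%:M
    & forall j, M j = \sum_r (c r)^t* *m A j *m d r].
Proof.
pose m := (p' * q' + p * q)%N.
pose Y (e : 'rV[C]_m) : 'M[C]_(p', q') := vec_mx (lsubmx e).
pose Z (e : 'rV[C]_m) : 'M[C]_(p, q) := vec_mx (rsubmx e).
have nnYZ e : nn e = nn (Y e) + nn (Z e).
  by rewrite -(nn_mxvec (Y e)) -(nn_mxvec (Z e)) !vec_mxK -nn_row_mx hsubmxK.
have formq a b X : exists Q, forall e, form a b X (Y e) (Z e) = qform Q e.
  have [Q1 h1] := qform_of_linear (mulmxr a \o (vec_mx \o lsubmx)) (vec_mx \o lsubmx)
    (m := m) (a := p') (b := q').
  have [Q2 h2] := qform_of_linear (mulmxr b \o (vec_mx \o rsubmx)) (vec_mx \o rsubmx)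
    (m := m) (a := p) (b := q).
  have /choice [Q3 h3] : forall j, exists Q, forall e : 'rV[C]_m,
      ip (A j *m Z e *m X j) (Y e) = qform Q e.
    move=> j; exact: (qform_of_linear (mulmxr (X j) \o (mulmx (A j) \o (vec_mx \o rsubmx)))
      (vec_mx \o lsubmx)).
  exists (Q1 + rc 2 *: \sum_j Q3 j + Q2) => e.
  rewrite !qformD qformZ qform_sum -h1 -h2 /form; congr (_ + _ * _ + _).
  exact: eq_bigr.
pose G (v : 'rV[C]_m -> R) (s : R) := exists a b X,
  (forall e, v e = form a b X (Y e) (Z e)) /\ s = trform a b X.
have pG : positive_graph G.
  split.
  - move=> v s w t [a [b [X [hv ->]]]] [a' [b' [X' [hw ->]]]].
    exists (a + a'), (b + b'), (fun j => X j + X' j); split.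
      move=> e; rewrite hv hw /form !mulmxDr !ipDl.
      under [in RHS]eq_bigr do rewrite mulmxDr ipDl.
      by rewrite big_split /=; ring.
    rewrite /trform !mxtraceD !reD.
    under [in RHS]eq_bigr do rewrite mulmxDr mxtraceD reD.
    by rewrite big_split /=; ring.
  - move=> k v s [a [b [X [hv ->]]]].
    exists (rc k *: a), (rc k *: b), (fun j => rc k *: X j); split.
      move=> e; rewrite hv /form -!scalemxAr !ipZl.
      under [in RHS]eq_bigr do rewrite -scalemxAr ipZl.
      by rewrite -mulr_sumr; ring.
    rewrite /trform !mxtraceZ !re_rcM.
    under [in RHS]eq_bigr do rewrite -scalemxAr mxtraceZ re_rcM.
    by rewrite -mulr_sumr; ring.
  - move=> v s [a [b [X [hv ->]]]] hge; apply: trform_ge0 => y x.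
    have := hge (row_mx (mxvec y) (mxvec x)).
    by rewrite hv /Y /Z row_mxKl row_mxKr !mxvecK.
have [|k hk] := positive_functional_evaluations pG.
  move=> Q; have [c c0 hc] := nn_mulmx_bounded (Q^t*).
  (* Since 2 qform Q e <= |e Q|^2 + |e|^2 <= (c + 1) |e|^2, a multiple of the identity form
     majorizes Q. *)
  pose s := (c + 1) / 2.
  exists (fun e => form (rc s)%:M (rc s)%:M (fun=> 0) (Y e) (Z e)).
  exists (trform (rc s)%:M (rc s)%:M (fun=> 0)); split; first by exists (rc s)%:M, (rc s)%:M, (fun=> 0).
  move=> e; rewrite /form big1 => [|j _]; last by rewrite mulmx0 ip0l.
  rewrite !mul_mx_scalar !ipZl mulr0 addr0 -mulrDr -!/(nn _) -nnYZ /qform.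
  have := ip_le_nn (e *m Q) e; have := hc _ (e^t*).
  by rewrite nn_adj -adjM nn_adj /s; lra.
exists m, (fun r => Y (k r)), (fun r => Z (k r)).
have key a b X : trform a b X = \sum_r form a b X (Y (k r)) (Z (k r)).
  have [Q hQ] := formq a b X; under eq_bigr do rewrite hQ.
  by apply: hk; exists a, b, X; split=> // e; rewrite hQ.
have tr0 : re (\tr (0 : 'M[C]_q)) = 0 /\ re (\tr (0 : 'M[C]_q')) = 0.
  by rewrite !raddf0.
have sum0 (I : Type) (s : seq I) (F : I -> R) : (forall i, F i = 0) -> \sum_(i <- s) F i = 0.
  by move=> h; rewrite big1.
split.
- apply: eq_mx_ip => a; rewrite ip_sumr.
  have := key a 0 (fun=> 0); rewrite /trform tr0.1 sum0; last by move=> j; rewrite mulmx0 raddf0.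
  rewrite mulr0 !addr0 /ip adj1 mulmx1 => ->; apply: eq_bigr => r _.
  rewrite /form mulmx0 ip0l sum0 ?mulr0 ?addr0; last by move=> j; rewrite mulmx0 ip0l.
  by rewrite -[RHS]/(ip _ _) ip_mull.
- apply: eq_mx_ip => b; rewrite ip_sumr.
  have := key 0 b (fun=> 0); rewrite /trform tr0.2 sum0; last by move=> j; rewrite mulmx0 raddf0.
  rewrite mulr0 !add0r /ip adj1 mulmx1 => ->; apply: eq_bigr => r _.
  rewrite /form mulmx0 ip0l sum0 ?mulr0 ?add0r; last by move=> j; rewrite mulmx0 ip0l.
  by rewrite -[RHS]/(ip _ _) ip_mull.
- move=> j0; rewrite -[LHS]adjK -[RHS]adjK; congr (_^t*).
  rewrite adj_sum; apply: eq_mx_ip => W.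
  have := key 0 0 (fun j => if j == j0 then W else 0).
  rewrite /trform tr0.1 tr0.2 add0r addr0 (bigD1 j0) //= eqxx big1 ?addr0; last first.
    by move=> j /negbTE ->; rewrite mulmx0 raddf0.
  move=> e; rewrite ip_sumr {1}/ip adjK mxtrace_mulC; apply: (@mulfI _ 2) => //; rewrite e mulr_sumr.
  apply: eq_bigr => r _; rewrite /form !mulmx0 !ip0l add0r addr0 (bigD1 j0) //= eqxx big1 ?addr0; last first.
    by move=> j /negbTE ->; rewrite mulmx0 ip0l.
  by congr (_ * _); rewrite ip_mull !adjM adjK mulmxA.
Qed.
End Extension.

End Wittstock.

(** * Rigidity of representations of a minimal pencil by itself *)

Section Minimality.
Variables (R : realType) (g : nat).
Local Notation C := (Cplx R).

(** Minimality in terms of [pball], as the algebraic part uses it; [minimal_ball_minimal] deduces it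
    from [minimal_pencil]. *)
Definition ball_minimal p' p (A : 'I_g -> 'M[C]_(p', p)) : Prop :=
  forall r' r (B : 'I_g -> 'M[C]_(r', r)),
    (forall n (X : 'I_g -> 'M[C]_n), pball B X <-> pball A X) ->
    (p' * p <= r' * r)%N.

Lemma pball_adj p' p (A : 'I_g -> 'M[C]_(p', p)) n n' (X : 'I_g -> 'M[C]_(n, n')) :
  pball (fun j => (A j)^t*) X <-> pball A (fun j => (X j)^t*).
Proof.
have e x y : \sum_j ip ((A j)^t* *m x *m X j) y = \sum_j ip (A j *m y *m (X j)^t*) x.
  by apply: eq_bigr => j _; rewrite ip_mulr ip_mull adjK ipC mulmxA.
by split=> h x y; have := h y x; rewrite e addrC.
Qed.

Lemma ball_minimal_adj p' p (A : 'I_g -> 'M[C]_(p', p)) :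
  ball_minimal A -> ball_minimal (fun j => (A j)^t*).
Proof.
move=> minA r' r B h; rewrite mulnC [leqRHS]mulnC.
apply: (minA _ _ (fun j => (B j)^t*)) => n X; rewrite pball_adj h pball_adj.
by have -> : (fun j => (X j)^t*^t*) = X by apply: funext => j; rewrite adjK.
Qed.

(** Each term is A tested on (d_i x, c_i y), and the squared norms of these pairs add up to those of
    x and y. *)
Lemma kraus_pball (I : finType) p' p q' q (A : 'I_g -> 'M[C]_(p', p))
    (c : I -> 'M[C]_(p', q')) (d : I -> 'M[C]_(p, q)) n n' (X : 'I_g -> 'M[C]_(n, n')) :
  \sum_i (c i)^t* *m c i = 1%:M -> \sum_i (d i)^t* *m d i = 1%:M ->
  pball A X -> pball (fun j => \sum_i (c i)^t* *m A j *m d i) X.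
Proof.
move=> hc hd hA x y.
have E k a (f : I -> 'M[C]_(a, k)) m (z : 'M[C]_(k, m)) :
    \sum_i (f i)^t* *m f i = 1%:M -> nn z = \sum_i nn (f i *m z).
  move=> h; rewrite /nn -{1}[z]mul1mx -h mulmx_suml ip_suml.
  by apply: eq_bigr => i _; rewrite -mulmxA ip_mull adjK.
rewrite (E _ _ _ _ x hd) (E _ _ _ _ y hc) -big_split /=.
have -> : \sum_j ip ((\sum_i (c i)^t* *m A j *m d i) *m x *m X j) y =
    \sum_i \sum_j ip (A j *m (d i *m x) *m X j) (c i *m y).
  rewrite exchange_big; apply: eq_bigr => j _; rewrite !mulmx_suml ip_suml.
  by apply: eq_bigr => i _; rewrite -!mulmxA ip_mull adjK !mulmxA.
by rewrite mulr_sumr; apply: ler_sum => i _; exact: hA.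
Qed.

Section Compression.
Variables (p' p : nat) (A : 'I_g -> 'M[C]_(p', p)).
Hypotheses (p'_gt0 : (0 < p')%N) (p_gt0 : (0 < p)%N) (minA : ball_minimal A).

(** The form in which rigidity uses minimality. Since 1 - q q^* = Q^* Q for a coisometry Q with p -
    1 rows, A Q^* would define the same ball with one column less. H merely provides an orthonormal
    basis containing q. *)
Lemma compression_absurd (H : 'M[C]_p) r :
  let q := (row r (spectralmx H))^t* in
  (forall n (X : 'I_g -> 'M[C]_n),
     pball (fun j => A j *m (1%:M - q *m q^t*)) X -> pball A X) -> False.
Proof.
set P := spectralmx H => /= h.
pose Q := row' r P.
have QQ : Q^t* *m Q = 1%:M - (row r P)^t* *m row r P.
  rewrite -(spectral_mulCmx H) -/P; apply/matrixP => i j; rewrite !mxE big_ord1.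
  rewrite [in RHS](bigD1_ord r) //= !mxE addrAC subrr add0r.
  by apply: eq_bigr => k _; rewrite !mxE.
have QQ1 : Q *m Q^t* = 1%:M.
  apply/matrixP => i j; have /matrixP/(_ (lift r i) (lift r j)) := spectral_mulmxC H.
  rewrite -/P !mxE (inj_eq (@lift_inj _ r)) => <-.
  by apply: eq_bigr => k _; rewrite !mxE.
rewrite adjK -QQ in h.
clearbody Q.
have := minA (B := fun j => A j *m Q^t*); rewrite leqNgt => hB.
have lt : (p' * p.-1 < p' * p)%N by rewrite ltn_pmul2l // prednK.
suff : ~~ (p' * p.-1 < p' * p)%N by rewrite lt.
apply: hB => n X; split=> hX.
  apply: h => x y; apply: (@le_trans _ _ (nn (Q *m x) + nn y)).
    by apply: pball_le hX _; apply: eq_bigr => j _; rewrite !mulmxA.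
  rewrite lerD2r {1}/nn ip_mull mulmxA QQ mulmxBl mul1mx ipBr.
  by rewrite lerBlDr lerDl ipC -mulmxA ip_mull adjK nn_ge0.
have nnQ n' (x : 'M[C]_(p.-1, n')) : nn (Q^t* *m x) = nn x.
  by apply: nn_isom; rewrite adjK.
move=> x y.
rewrite -nnQ; apply: pball_le hX _.
by apply: eq_bigr => j _; rewrite !mulmxA.
Qed.

Section Rigidity.
Variables (N : nat) (c : 'I_N -> 'M[C]_p') (d : 'I_N -> 'M[C]_p).
Hypotheses (hc : \sum_i (c i)^t* *m c i = 1%:M) (hd : \sum_i (d i)^t* *m d i = 1%:M).
Hypothesis hA : forall j, A j = \sum_i (c i)^t* *m A j *m d i.

Let phi (G : 'M[C]_p) := \sum_i (d i)^t* *m G *m d i.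
Let psi (T : 'M[C]_(p', p)) := \sum_i (c i)^t* *m T *m d i.

Let nn_d n (z : 'M[C]_(p, n)) : nn z = \sum_i nn (d i *m z).
Proof.
rewrite /nn -{1}[z]mul1mx -hd mulmx_suml ip_suml.
by apply: eq_bigr => i _; rewrite -mulmxA ip_mull adjK.
Qed.
Let nn_c n (z : 'M[C]_(p', n)) : nn z = \sum_i nn (c i *m z).
Proof.
rewrite /nn -{1}[z]mul1mx -hc mulmx_suml ip_suml.
by apply: eq_bigr => i _; rewrite -mulmxA ip_mull adjK.
Qed.
Let ip_phi n G (z w : 'M[C]_(p, n)) :
  ip (phi G *m z) w = \sum_i ip (G *m (d i *m z)) (d i *m w).
Proof.
rewrite /phi mulmx_suml ip_suml; apply: eq_bigr => i _.
by rewrite -!mulmxA ip_mull adjK.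
Qed.
Let ip_psi n T (z : 'M[C]_(p, n)) w :
  ip (psi T *m z) w = \sum_i ip (T *m (d i *m z)) (c i *m w).
Proof.
rewrite /psi mulmx_suml ip_suml; apply: eq_bigr => i _.
by rewrite -!mulmxA ip_mull adjK.
Qed.
Let phiB G G' : phi (G - G') = phi G - phi G'.
Proof. by rewrite /phi -sumrB; apply: eq_bigr => i _; rewrite mulmxBr mulmxBl. Qed.
Let psiD T T' : psi (T + T') = psi T + psi T'.
Proof. by rewrite /psi -big_split; apply: eq_bigr => i _; rewrite mulmxDr mulmxDl. Qed.
Let psiZ a T : psi (a *: T) = a *: psi T.
Proof.
by rewrite /psi scaler_sumr; apply: eq_bigr => i _; rewrite -scalemxAr -scalemxAl.
Qed.
Let phiZ a T : phi (a *: T) = a *: phi T.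
Proof.
by rewrite /phi scaler_sumr; apply: eq_bigr => i _; rewrite -scalemxAr -scalemxAl.
Qed.

(** As w is free, this is the operator inequality T^* T <= G. It is stable under applying psi to T
    and phi to G. *)
Let dom T G := forall n (z : 'M[C]_(p, n)) (w : 'M[C]_(p', n)),
  2 * ip (T *m z) w <= ip (G *m z) z + nn w.

Let iter_dom k T G : dom T G -> dom (iter k psi T) (iter k phi G).
Proof.
move=> h; elim: k => [|k IH] n z w; first exact: h.
rewrite !iterS ip_phi ip_psi nn_c -big_split mulr_sumr; apply: ler_sum => i _.
exact: IH.
Qed.

(** T0 measures the failure of c_i A_j = A_j d_i, as [ip_T0] shows; the goal is T0 = 0. *)
Let S := \sum_j (A j)^t* *m A j.
Let T0 := phi S - S.

Let ip_S n (z : 'M[C]_(p, n)) : ip (S *m z) z = \sum_j nn (A j *m z).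
Proof.
rewrite /S mulmx_suml ip_suml; apply: eq_bigr => j _.
by rewrite -mulmxA ip_mull adjK.
Qed.

(* The Schwarz inequality for the completely positive map phi. *)
Let ip_T0 n (z : 'M[C]_(p, n)) :
  ip (T0 *m z) z = \sum_j \sum_i nn (c i *m A j *m z - A j *m d i *m z).
Proof.
rewrite mulmxBl ipBl ip_phi ip_S; under eq_bigr do rewrite ip_S.
rewrite exchange_big -sumrB; apply: eq_bigr => j _ /=.
under [RHS]eq_bigr do rewrite nnB -!mulmxA.
rewrite big_split sumrB /= -nn_c -mulr_sumr.
have -> : \sum_i ip (c i *m (A j *m z)) (A j *m (d i *m z)) = nn (A j *m z).
  rewrite /nn [in X in _ = ip _ X]hA mulmx_suml ip_sumr; apply: eq_bigr => i _.
  by rewrite ip_mull -!mulmxA.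
by ring.
Qed.

Let iter_phi_ge0 k n (z : 'M[C]_(p, n)) : 0 <= ip (iter k phi T0 *m z) z.
Proof.
elim: k z => [|k IH] z /=; last by rewrite ip_phi; apply: sumr_ge0.
by rewrite ip_T0; do 2!(apply: sumr_ge0 => ? _); exact: nn_ge0.
Qed.

(** By telescoping, the forms of the iterates phi^k(T0) have bounded sums, so some of them are
    arbitrarily small. *)
Let iter_phi_sum k n (z : 'M[C]_(p, n)) :
  \sum_(i < k) ip (iter i phi T0 *m z) z = ip (iter k phi S *m z) z - ip (S *m z) z.
Proof.
have e i : iter i phi T0 = iter i.+1 phi S - iter i phi S.
  by elim: i => //= i ->; rewrite phiB.
elim: k => [|k IH]; first by rewrite big_ord0 subrr.
have gen (a b c' : R) : a - c' + (b - a) = b - c' by ring.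
by rewrite big_ord_recr IH e mulmxBl ipBl; exact: gen.
Qed.

Let iter_phi_bounded : exists2 B, 0 < B &
  forall k n (z : 'M[C]_(p, n)), ip (iter k phi S *m z) z <= B * nn z.
Proof.
have [B B0 hB] := nn_mulmx_bounded S.
exists ((B + 1) / 2); first by rewrite divr_gt0 // addr_gt0.
elim=> [|k IH] n z.
  have gen (a b : R) : 2 * a <= B * b + b -> a <= (B + 1) / 2 * b by lra.
  by apply: gen; apply: le_trans (ip_le_nn (S *m z) z) _; rewrite lerD2r.
rewrite iterS ip_phi nn_d mulr_sumr; apply: ler_sum => i _; exact: IH.
Qed.

Lemma exists_small (t : nat -> R) (B e : R) : 0 < e ->
  (forall k, \sum_(i < k) t i <= B) -> exists k, t k <= e.
Proof.
move=> e0 hB; apply: contrapT => /forallNP h.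
pose k := Num.bound (B / e).
have : k%:R * e <= B.
  apply: le_trans (hB k); rewrite mulr_natl -[k in leLHS]card_ord -sumr_const.
  by apply: ler_sum => i _; have /negP := h i; rewrite -ltNge => /ltW.
rewrite leNgt -ltr_pdivrMr // => /negP; apply.
have B0 : 0 <= B by have := hB 0%N; rewrite big_ord0.
by apply: archi_boundP; rewrite divr_ge0 // ltW.
Qed.

(** Otherwise T0 has an eigenvector q with positive eigenvalue. With E = 1 - q q^*, A = psi^k(A)
    splits into psi^k(A E), contractive wherever A E is, and psi^k(A q q^* ), dominated by a
    multiple of phi^k(T0) and thus negligible. So A is contractive on the ball of A E, against
    [compression_absurd]. *)
Let rigid_T0 : T0 = 0.
Proof.
have T0h : T0^t* = T0.
  have Sh : S^t* = S.
    by rewrite /S adj_sum; apply: eq_bigr => j _; rewrite adjM adjK.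
  rewrite adjB Sh /phi adj_sum; congr (_ - _); apply: eq_bigr => i _.
  by rewrite !adjM adjK Sh mulmxA.
have T0p : psd T0 by split=> // n z; exact: (iter_phi_ge0 0).
apply: contrapT => /eqP nz.
have [r lr] : exists r, spectral_diag T0 0 r != 0.
  apply: contrapT => /forallNP h; move/negP: nz; apply; apply/eqP.
  rewrite (spectral_sum T0h) big1 // => r _.
  by have /negP := h r; rewrite negbK => /eqP ->; rewrite scale0r.
set P := spectralmx T0; set la := spectral_diag T0.
have rla k : rc (re (la 0 k)) = la 0 k by rewrite rc_re ?spectral_diag_ge0.
have la_ge0 k : 0 <= re (la 0 k) by rewrite -ler0c -/(rc _) rla spectral_diag_ge0.
have la_gt0 : 0 < re (la 0 r).
  by rewrite lt_neqAle la_ge0 andbT eq_sym -rc_eq0 rla.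
have ip_ge n (z : 'M[C]_(p, n)) : re (la 0 r) * nn (row r P *m z) <= ip (T0 *m z) z.
  rewrite (spectral_sum T0h) mulmx_suml ip_suml (bigD1 r) //= -/P -/la.
  rewrite -scalemxAl -{2}(rla r) ipZl -mulmxA ip_mull adjK -/(nn _) lerDl; apply: sumr_ge0 => k _.
  by rewrite -scalemxAl -/la -(rla k) ipZl -mulmxA ip_mull adjK mulr_ge0 ?nn_ge0.
apply: (@compression_absurd T0 r); rewrite -/P /= adjK => n X hX x y.
set q := (row r P)^t*.
pose E := 1%:M - q *m row r P.
(* Because T0 >= la q q^*, each A_j q q^* is dominated by a multiple of T0. *)
have /choice [b hb] : forall j, exists b, 0 < b /\ forall m (z : 'M[C]_(p, m)),
    nn (A j *m q *m row r P *m z) <= b * ip (T0 *m z) z.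
  move=> j; have [b b0 hb] := nn_mulmx_bounded (A j *m q).
  exists (b / re (la 0 r)); split=> [|m z]; first exact: divr_gt0.
  rewrite -mulmxA; apply: le_trans (hb _ _) _; rewrite -mulrA ler_pM2l //.
  by rewrite ler_pdivlMl.
have hdom k j (tau : R) m (z : 'M[C]_(p, m)) w :
    2 * tau * ip (iter k psi (A j *m q *m row r P) *m z) w <=
    tau ^+ 2 * b j * ip (iter k phi T0 *m z) z + nn w.
  have itZ a T : iter k psi (a *: T) = a *: iter k psi T.
    by elim: k => //= k ->; rewrite psiZ.
  have itZ' a T : iter k phi (a *: T) = a *: iter k phi T.
    by elim: k {itZ} => //= k ->; rewrite phiZ.
  have := @iter_dom k (rc tau *: (A j *m q *m row r P)) (rc (tau ^+ 2 * b j) *: T0) _ _ z w.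
  rewrite itZ itZ' -!scalemxAl !ipZl mulrA; apply.
  move=> m' z' w'; apply: le_trans (ip_le_nn _ _) _; rewrite lerD2r -!scalemxAl nnZr ipZl.
  by rewrite -mulrA ler_wpM2l ?sqr_ge0 //; exact: (hb j).2.
apply/ler_addgt0Pr => eps eps0.
have [B B0 hB] := iter_phi_bounded.
pose bb := \sum_j b j + 1.
have b_le j : b j <= bb.
  rewrite /bb (bigD1 j) //= -addrA lerDl addr_ge0 // sumr_ge0 // => i _.
  by have [/ltW] := hb i.
have bb0 : 0 < bb by rewrite ltr_wpDl // sumr_ge0 // => i _; have [/ltW] := hb i.
pose t k := \sum_j ip (iter k phi T0 *m (x *m X j)) (x *m X j).
(* Young's inequality with weight tau: a large tau makes the cost g |y|^2 / tau at most eps / 2, and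
   then k is chosen to make tau bb t_k at most eps / 2. *)
pose tau := 2 * (g%:R * nn y + 1) / eps.
have gy : 0 <= g%:R * nn y by rewrite mulr_ge0 ?nn_ge0.
have tau0 : 0 < tau by rewrite divr_gt0 // mulr_gt0 // ltr_wpDl.
have [||k hk] := @exists_small t (\sum_j B * nn (x *m X j)) (eps / (2 * tau * bb)).
- by apply: divr_gt0 => //; apply: mulr_gt0 => //; apply: mulr_gt0.
- move=> k; rewrite exchange_big; apply: ler_sum => j _; rewrite iter_phi_sum.
  apply: le_trans (hB k _ _); rewrite lerBlDr lerDl ip_S.
  by apply: sumr_ge0 => ? _; exact: nn_ge0.
have e1 : pball (fun j => iter k psi (A j *m E)) X.
  elim: k {hk} => [|k IH]; first exact: hX.
  by under eq_fun do rewrite iterS; exact: (kraus_pball hc hd IH).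
have eA j : A j = iter k psi (A j *m E) + iter k psi (A j *m q *m row r P).
  have itD T T' : iter k psi (T + T') = iter k psi T + iter k psi T'.
    by elim: k {hk e1} => //= k ->; rewrite psiD.
  have itA : iter k psi (A j) = A j.
    by elim: k {hk e1 itD} => [//|k IH]; rewrite iterS IH /psi -hA.
  by rewrite -itD -mulmxA -mulmxDr subrK mulmx1 itA.
have -> : \sum_j ip (A j *m x *m X j) y = \sum_j ip (iter k psi (A j *m E) *m x *m X j) y
    + \sum_j ip (iter k psi (A j *m q *m row r P) *m x *m X j) y.
  rewrite -big_split; apply: eq_bigr => j _ /=.
  by rewrite {1}eA !mulmxDl ipDl.
rewrite mulrDr; apply: lerD; first exact: e1.
rewrite -(ler_pM2l tau0).
have : tau * (2 * \sum_j ip (iter k psi (A j *m q *m row r P) *m x *m X j) y)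
    <= tau ^+ 2 * bb * t k + g%:R * nn y.
  rewrite mulrA !mulr_sumr.
  have -> : g%:R * nn y = \sum_(j < g) nn y by rewrite sumr_const card_ord mulr_natl.
  rewrite -big_split; apply: ler_sum => j _ /=.
  have := hdom k j tau _ (x *m X j) y; rewrite mulmxA [2 * tau]mulrC.
  move/le_trans; apply; rewrite lerD2r ler_wpM2r ?iter_phi_ge0 //.
  by rewrite ler_wpM2l ?sqr_ge0.
move/le_trans; apply.
have : tau ^+ 2 * bb * t k <= tau * eps / 2.
  apply: (@le_trans _ _ (tau ^+ 2 * bb * (eps / (2 * tau * bb)))).
    by rewrite ler_wpM2l // mulr_ge0 ?sqr_ge0 // ltW.
  by rewrite le_eqVlt; apply/orP; left; apply/eqP; field; rewrite !gt_eqF.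
have : tau * eps = 2 * (g%:R * nn y + 1) by rewrite /tau divfK // gt_eqF.
by lra.
Qed.

Lemma kraus_fixed_commute i j : c i *m A j = A j *m d i.
Proof.
have := ip_T0 1%:M; rewrite rigid_T0 mul0mx ip0l => /esym h.
have h1 : \sum_i nn (c i *m A j *m 1%:M - A j *m d i *m 1%:M) = 0.
  by apply: (psumr_eq0P _ h) => // k _; apply: sumr_ge0 => ? _; exact: nn_ge0.
have := psumr_eq0P (fun k _ => nn_ge0 (c k *m A j *m 1%:M - A j *m d k *m 1%:M)) h1.
by move=> /(_ i isT)/nn_eq0; rewrite !mulmx1 => /subr0_eq.
Qed.

End Rigidity.
End Compression.

Lemma kraus_fixed_commute_adj p' p (A : 'I_g -> 'M[C]_(p', p)) N
    (c : 'I_N -> 'M[C]_p') (d : 'I_N -> 'M[C]_p) :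
  (0 < p')%N -> (0 < p)%N -> ball_minimal A ->
  \sum_i (c i)^t* *m c i = 1%:M -> \sum_i (d i)^t* *m d i = 1%:M ->
  (forall j, A j = \sum_i (c i)^t* *m A j *m d i) ->
  forall i j, d i *m (A j)^t* = (A j)^t* *m c i.
Proof.
move=> p'0 p0 minA hc hd hA i j.
apply: (kraus_fixed_commute p0 p'0 (ball_minimal_adj minA) hd hc) => {}j.
rewrite [in LHS]hA adj_sum; apply: eq_bigr => k _.
by rewrite !adjM adjK mulmxA.
Qed.

End Minimality.

(** * Minimal pencils *)

Section KernelProjection.
Variables (R : realType) (k : nat).
Local Notation C := (Cplx R).

Definition kerproj (H : 'M[C]_k) : 'M[C]_k := fcalc (fun z => (z == 0)%:R) H.

Lemma kerproj_adj (H : 'M[C]_k) : (kerproj H)^t* = kerproj H.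
Proof. by rewrite fcalc_adj; apply: eq_fcalc => r /=; rewrite rmorph_nat. Qed.

Lemma kerproj_idem (H : 'M[C]_k) : kerproj H *m kerproj H = kerproj H.
Proof. by rewrite fcalcM; apply: eq_fcalc => r; case: eqP; rewrite ?mulr0 ?mulr1. Qed.

Lemma mul_kerproj (H : 'M[C]_k) : H^t* = H -> H *m kerproj H = 0.
Proof.
move=> hH; rewrite -{1}(fcalc_id hH) fcalcM -[RHS](subrr (kerproj H)) fcalcB.
by apply: eq_fcalc => r; rewrite subrr; case: eqP => [->|_]; rewrite ?mul0r ?mulr0.
Qed.

(** On the spectrum h(z) = (h(z) / z) z; at z = 0 this holds because h 0 = 0. *)
Lemma fcalc_kernel h (H : 'M[C]_k) n (x : 'M[C]_(k, n)) :
  H^t* = H -> h 0 = 0 -> H *m x = 0 -> fcalc h H *m x = 0.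
Proof.
move=> hH h0 hx.
have -> : fcalc h H = fcalc (fun z => h z / z) H *m H.
  rewrite -{3}(fcalc_id hH) fcalcM; apply: eq_fcalc => r.
  by case: (eqVneq (spectral_diag H 0 r) 0) => [->|nz]; rewrite ?h0 ?mulr0 ?divfK.
by rewrite -mulmxA hx mulmx0.
Qed.

Lemma kerproj_id (H : 'M[C]_k) n (x : 'M[C]_(k, n)) :
  H^t* = H -> H *m x = 0 -> kerproj H *m x = x.
Proof.
move=> hH hx; apply/subr0_eq.
rewrite -{2}[x]mul1mx -mulmxBl -(fcalc1 H) fcalcB.
by apply: fcalc_kernel => //; rewrite eqxx subrr.
Qed.

Lemma row_fcalc h (H : 'M[C]_k) r :
  row r (spectralmx H) *m fcalc h H = h (spectral_diag H 0 r) *: row r (spectralmx H).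
Proof.
rewrite /fcalc -row_mul !mulmxA spectral_mulmxC mul1mx.
by apply/rowP => j; rewrite mxE mul_diag_mx !mxE.
Qed.

End KernelProjection.

Opaque fcalc.

Section Polar.
Variables (R : realType) (q k : nat) (W : 'M[Cplx R]_(q, k)).
Local Notation S := (W^t* *m W).

Lemma gram_adj : S^t* = S. Proof. by rewrite adjM adjK. Qed.

Lemma gram_psd : psd S.
Proof.
split=> [|n x]; first exact: gram_adj.
by rewrite -mulmxA ip_mull adjK nn_ge0.
Qed.

Lemma gram_ker n (x : 'M[Cplx R]_(k, n)) : S *m x = 0 -> W *m x = 0.
Proof.
move=> h; apply: nn_eq0; rewrite /nn ip_mull mulmxA h ip0r //.
Qed.

Lemma mul_kerproj_gram : W *m kerproj S = 0.
Proof. by apply/gram_ker/mul_kerproj/gram_adj. Qed.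

(* Since 0^-1 = 0, this is the partial isometry of the polar decomposition. *)
Definition polar_part := W *m fcalc (fun z => (sqrtC z)^-1) S.

Lemma polar_partK : polar_part^t* *m polar_part = 1%:M - kerproj S.
Proof.
have e D : S *m D = fcalc id S *m D by rewrite (fcalc_id gram_adj).
rewrite /polar_part adjM -mulmxA (mulmxA (W^t*)) e fcalc_adj !fcalcM -(fcalc1 S) fcalcB.
apply: eq_fcalc => r /=; have ge0 := spectral_diag_ge0 r gram_psd.
set z := spectral_diag _ 0 r in ge0 *.
have [->|nz] := eqVneq z 0; first by rewrite mul0r mulr0 subrr.
have sn : sqrtC z != 0 by rewrite sqrtC_eq0.
rewrite geC0_conj ?invr_ge0 ?sqrtC_ge0 // subr0.
by rewrite -[X in _ * (X * _)](sqrtCK z) expr2 mulfK // mulVf.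
Qed.
End Polar.

(** * Isometric intertwiners out of a minimal pencil *)

Section Intertwiners.
Variables (R : realType) (g : nat).
Local Notation C := (Cplx R).

(** The two relations say that the direct sum of W' and W intertwines the self-adjoint matrices with
    off-diagonal blocks M_j, M_j^* and A_j, A_j^*. This keeps the class stable under adjoints and
    functional calculus. *)
Definition intertwines q' q (M : 'I_g -> 'M[C]_(q', q)) p' p (A : 'I_g -> 'M[C]_(p', p))
    (W' : 'M[C]_(q', p')) (W : 'M[C]_(q, p)) : Prop :=
  forall j, M j *m W = W' *m A j /\ (M j)^t* *m W' = W *m (A j)^t*.

Section Operations.
Variables (q' q : nat) (M : 'I_g -> 'M[C]_(q', q)).
Variables (p' p : nat) (A : 'I_g -> 'M[C]_(p', p)).

Lemma intertwinesD W' W V' V : intertwines M A W' W -> intertwines M A V' V ->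
  intertwines M A (W' + V') (W + V).
Proof.
move=> hW hV j; have [e1 e2] := hW j; have [e3 e4] := hV j.
by rewrite !mulmxDr !mulmxDl e1 e2 e3 e4.
Qed.

Lemma intertwines_adj W' W : intertwines M A W' W -> intertwines A M (W'^t*) (W^t*).
Proof.
move=> hW j; have [e1 e2] := hW j; split.
  by rewrite -[LHS]adjK adjM !adjK -e2 adjM adjK.
by rewrite -adjM -e1 adjM.
Qed.

Lemma intertwines_flip W' W : intertwines M A W' W ->
  intertwines (fun j => (M j)^t*) (fun j => (A j)^t*) W W'.
Proof. by move=> hW j; have [e1 e2] := hW j; rewrite !adjK. Qed.

Lemma intertwines_comp r' r (B : 'I_g -> 'M[C]_(r', r)) W' W V' V :
  intertwines M A W' W -> intertwines A B V' V ->
  intertwines M B (W' *m V') (W *m V).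
Proof.
move=> hW hV j; have [e1 e2] := hW j; have [e3 e4] := hV j.
by split; rewrite mulmxA ?e1 ?e2 -mulmxA ?e3 ?e4 mulmxA.
Qed.

Lemma intertwines_gram W' W : intertwines M A W' W ->
  intertwines A A (W'^t* *m W') (W^t* *m W).
Proof.
move=> hW j; have [e1 e2] := hW j; have [e3 e4] := intertwines_adj hW j.
by split; rewrite mulmxA ?e3 ?e4 -mulmxA ?e1 ?e2 mulmxA.
Qed.

Lemma intertwines_fcalc h W' W : W'^t* = W' -> W^t* = W ->
  intertwines A A W' W -> intertwines A A (fcalc h W') (fcalc h W).
Proof.
move=> hW' hW e j; have [e1 e2] := e j; split.
  by apply/esym/fcalc_intertwine.
by apply/esym/fcalc_intertwine => //; rewrite e2.
Qed.

End Operations.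

Section MinimalPencil.
Variables (p' p : nat) (A : 'I_g -> 'M[C]_(p', p)).
Hypotheses (p'_gt0 : (0 < p')%N) (p_gt0 : (0 < p)%N) (minA : ball_minimal A).

(* A minimal pencil is multiplicity free: a nonzero square zero Z would map a
   reducing part of A isomorphically onto another one, which could be dropped. *)
Lemma commutant_sqr0 Z' Z : intertwines A A Z' Z -> Z *m Z = 0 -> Z = 0.
Proof.
move=> hZ ZZ; set S := Z^t* *m Z.
apply: contrapT => nz.
have [r lr] : exists r, spectral_diag S 0 r != 0.
  apply: contrapT => /forallNP h; apply: nz.
  have S0 : S = 0.
    rewrite /S (spectral_sum (gram_adj Z)) big1 // => r _.
    by have /negP := h r; rewrite negbK => /eqP ->; rewrite scale0r.
  by rewrite -[Z]mulmx1; apply: gram_ker; rewrite -/S S0 mul0mx.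
have hS := intertwines_gram hZ.
have hK := intertwines_fcalc (fun z => (z == 0)%:R) (gram_adj _) (gram_adj _) hS.
have hY := intertwines_comp hZ
  (intertwines_fcalc (fun z => (sqrtC z)^-1) (gram_adj _) (gram_adj _) hS).
rewrite -!/(kerproj _) -!/(polar_part _) -/S in hK hY.
set K := kerproj S in hK; set K' := kerproj _ in hK.
set Y := polar_part Z in hY; set Y' := polar_part Z' in hY.
have KK : K^t* = K by exact: kerproj_adj.
(* Z Z = 0 puts the range of Y into the kernel of Z, which is the range of K. *)
have KY : K *m Y = Y.
  apply: kerproj_id; first exact: gram_adj.
  by rewrite /S /Y /polar_part (mulmxA (Z^t* *m Z) Z) -(mulmxA (Z^t*) Z Z) ZZ mulmx0 mul0mx.
have K2 : K *m K = K by exact: kerproj_idem.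
have Y2 : Y^t* *m Y = 1%:M - K by exact: polar_partK.
have K'K : K'^t* = K' by exact: kerproj_adj.
have K'2 : K' *m K' = K' by exact: kerproj_idem.
have Y'2 : Y'^t* *m Y' = 1%:M - K' by exact: polar_partK.
have Kle n (x : 'M[C]_(p, n)) : nn (K *m x) <= nn x.
  have e : nn x = nn (K *m x) + nn (Y *m x).
    rewrite /nn !ip_mull !(mulmxA _ _ x) KK K2 Y2.
    by rewrite -ipDr -mulmxDl addrC subrK mul1mx.
  by rewrite e lerDl nn_ge0.
apply: (compression_absurd p'_gt0 p_gt0 minA (H := S) (r := r)) => n X hX.
(* q belongs to a nonzero eigenvalue, hence is orthogonal to the range of K, and A K factors through
   A (1 - q q^* ). *)
have hAK : pball (fun j => A j *m K) X.
  move=> x y; apply: (@le_trans _ _ (nn (K *m x) + nn y)); last by rewrite lerD2r.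
  apply: pball_le hX _; apply: eq_bigr => j _.
  have qK : row r (spectralmx S) *m K = 0.
    by rewrite /K /kerproj row_fcalc (negbTE lr) scale0r.
  rewrite adjK (mulmxA _ K x) -(mulmxA (A j) _ K).
  by rewrite mulmxBl mul1mx -(mulmxA _ _ K) qK mulmx0 subr0.
(* A is rebuilt from A K by two terms: K' (A K) K is A K, and Y'^* (A K) Y is A (1 - K). *)
pose c (b : bool) := if b then K' else Y'.
pose d (b : bool) := if b then K else Y.
have hc : \sum_b (c b)^t* *m c b = 1%:M by rewrite big_bool /= K'K K'2 Y'2 addrC subrK.
have hd : \sum_b (d b)^t* *m d b = 1%:M by rewrite big_bool /= KK K2 Y2 addrC subrK.
suff eA : A = (fun j => \sum_b (c b)^t* *m (A j *m K) *m d b).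
  by rewrite eA; exact: kraus_pball hc hd hAK.
apply: funext => j; have [e1 _] := hK j; have [e2 _] := intertwines_adj hY j.
have t1 : K' *m (A j *m K) *m K = A j *m K.
  by rewrite -(mulmxA K') -(mulmxA (A j)) K2 mulmxA -e1 -mulmxA K2.
have t2 : Y'^t* *m (A j *m K) *m Y = A j *m (1%:M - K).
  by rewrite -(mulmxA (Y'^t*)) -(mulmxA (A j)) KY mulmxA -e2 -mulmxA Y2.
by rewrite big_bool /= K'K t1 t2 mulmxBr mulmx1 addrC subrK.
Qed.

End MinimalPencil.

Section IsometricEmbedding.
Variables (p' p : nat) (A : 'I_g -> 'M[C]_(p', p)).
Hypotheses (p'_gt0 : (0 < p')%N) (p_gt0 : (0 < p)%N) (minA : ball_minimal A).

Lemma commutant_sqr0_flip Z' Z : intertwines A A Z' Z -> Z' *m Z' = 0 -> Z' = 0.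
Proof.
by move=> /intertwines_flip; exact: commutant_sqr0 (ball_minimal_adj minA) _ _.
Qed.

Section IsometricIntertwiner.
Variables (q' q : nat) (M : 'I_g -> 'M[C]_(q', q)).
Variables (N : nat) (c : 'I_N -> 'M[C]_(q', p')) (d : 'I_N -> 'M[C]_(q, p)).
Hypotheses (hc : \sum_i (c i)^t* *m c i = 1%:M) (hd : \sum_i (d i)^t* *m d i = 1%:M).
Hypothesis hcd : forall i, intertwines M A (c i) (d i).

(** d_i is added only on the kernel of W, with projection K. As K W^* = 0, W^* d_i K squares to zero
    and vanishes by [commutant_sqr0]; the ranges of W and d_i K are then orthogonal, and the sum
    kills only what both W and d_i kill. *)
Let step (W' : 'M[C]_(q', p')) (W : 'M[C]_(q, p)) i : intertwines M A W' W ->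
  exists (V' : 'M[C]_(q', p')) (V : 'M[C]_(q, p)), [/\ intertwines M A V' V,
    forall x : 'M[C]_p, V *m x = 0 -> W *m x = 0 /\ d i *m x = 0
  & forall x : 'M[C]_p', V' *m x = 0 -> W' *m x = 0 /\ c i *m x = 0].
Proof.
move=> hW; pose S := W^t* *m W; pose S' := W'^t* *m W'.
have Sh : S^t* = S := gram_adj W; have S'h : S'^t* = S' := gram_adj W'.
have hK := intertwines_fcalc (fun z => (z == 0)%:R) S'h Sh (intertwines_gram hW).
rewrite -!/(kerproj _) in hK; set K := kerproj S in hK; set K' := kerproj S' in hK.
have hcK := intertwines_comp (hcd i) hK.
have hZ := intertwines_comp (intertwines_adj hW) hcK.
have KW : K *m W^t* = 0.
  by rewrite -[LHS]adjK adjM adjK kerproj_adj mul_kerproj_gram adj0.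
have K'W : K' *m W'^t* = 0.
  by rewrite -[LHS]adjK adjM adjK kerproj_adj mul_kerproj_gram adj0.
have Z0 : W^t* *m (d i *m K) = 0.
  apply: (commutant_sqr0 p'_gt0 p_gt0 minA hZ).
  by rewrite -(mulmxA (W^t*)) -(mulmxA (d i)) (mulmxA K) KW mul0mx !mulmx0.
have Z'0 : W'^t* *m (c i *m K') = 0.
  apply: (commutant_sqr0_flip hZ).
  by rewrite -(mulmxA (W'^t*)) -(mulmxA (c i)) (mulmxA K') K'W mul0mx !mulmx0.
exists (W' + c i *m K'), (W + d i *m K); split; first exact: intertwinesD.
- move=> x hx; have Wx : W *m x = 0.
    have e : W^t* *m W = W^t* *m (W + d i *m K) by rewrite mulmxDr Z0 addr0.
    by apply: gram_ker; rewrite e -mulmxA hx mulmx0.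
  split=> //; rewrite -[RHS]hx mulmxDl Wx add0r -mulmxA (kerproj_id Sh) //.
  by rewrite /S -mulmxA Wx mulmx0.
- move=> x hx; have Wx : W' *m x = 0.
    have e : W'^t* *m W' = W'^t* *m (W' + c i *m K') by rewrite mulmxDr Z'0 addr0.
    by apply: gram_ker; rewrite e -mulmxA hx mulmx0.
  split=> //; rewrite -[RHS]hx mulmxDl Wx add0r -mulmxA (kerproj_id S'h) //.
  by rewrite /S' -mulmxA Wx mulmx0.
Qed.

(** After all pairs have been added only common kernels of the d_i and of the c_i remain, and these
    are trivial by [hd] and [hc]. Polar parts turn injective intertwiners into isometric ones. *)
Lemma isometric_intertwiner : exists (W' : 'M[C]_(q', p')) (W : 'M[C]_(q, p)),
  [/\ intertwines M A W' W, W'^t* *m W' = 1%:M & W^t* *m W = 1%:M].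
Proof.
have [W' [W [hW kW kW']]] : exists (W' : 'M[C]_(q', p')) (W : 'M[C]_(q, p)),
    [/\ intertwines M A W' W,
        forall x : 'M[C]_p, W *m x = 0 -> forall i, i \in enum 'I_N -> d i *m x = 0
      & forall x : 'M[C]_p', W' *m x = 0 -> forall i, i \in enum 'I_N -> c i *m x = 0].
  elim: (enum 'I_N) => [|i s [W' [W [hW kW kW']]]].
    by exists 0, 0; split=> // j; rewrite !mulmx0 !mul0mx.
  have [V' [V [hV kV kV']]] := step i hW.
  exists V', V; split=> // x hx k.
    by have [Wx dx] := kV _ hx; rewrite inE => /predU1P[->//|]; exact: kW.
  by have [Wx dx] := kV' _ hx; rewrite inE => /predU1P[->//|]; exact: kW'.
have K0 : kerproj (W^t* *m W) = 0.
  rewrite -[LHS]mul1mx -hd mulmx_suml big1 // => i _.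
  by rewrite -mulmxA (kW _ (mul_kerproj_gram W)) ?mulmx0 // mem_enum.
have K'0 : kerproj (W'^t* *m W') = 0.
  rewrite -[LHS]mul1mx -hc mulmx_suml big1 // => i _.
  by rewrite -mulmxA (kW' _ (mul_kerproj_gram W')) ?mulmx0 // mem_enum.
exists (polar_part W'), (polar_part W); split.
- apply: (intertwines_comp hW).
  exact: intertwines_fcalc (gram_adj _) (gram_adj _) (intertwines_gram hW).
- by rewrite polar_partK K'0 subr0.
- by rewrite polar_partK K0 subr0.
Qed.

End IsometricIntertwiner.

End IsometricEmbedding.

Section Embedding.
Variables (p' p : nat) (A : 'I_g -> 'M[C]_(p', p)).
Hypotheses (p'_gt0 : (0 < p')%N) (p_gt0 : (0 < p)%N) (minA : ball_minimal A).

Lemma kraus_comp (I J : finType) a b e (f : I -> 'M[C]_(b, e)) (h : J -> 'M[C]_(a, b))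
    a' b' e' (f' : I -> 'M[C]_(b', e')) (h' : J -> 'M[C]_(a', b')) (T : 'M[C]_(a, a')) :
  \sum_i (f i)^t* *m (\sum_j (h j)^t* *m T *m h' j) *m f' i =
  \sum_(k : I * J) (h k.2 *m f k.1)^t* *m T *m (h' k.2 *m f' k.1).
Proof.
rewrite -(pair_bigA _ (fun i j => (h j *m f i)^t* *m T *m (h' j *m f' i))) /=.
apply: eq_bigr => i _; rewrite mulmx_sumr mulmx_suml; apply: eq_bigr => j _.
by rewrite adjM !mulmxA.
Qed.

(** Rigidity of the composed representation gives M_j d_i = sum_k f_k^* A_j h_k d_i = sum_k f_k^*
    f_k c_i A_j = c_i A_j. So each pair (c_i, d_i) intertwines. *)
Lemma isometric_embedding q' q (M : 'I_g -> 'M[C]_(q', q)) :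
  (forall n (X : 'I_g -> 'M[C]_n), pball M X <-> pball A X) ->
  exists (W' : 'M[C]_(q', p')) (W : 'M[C]_(q, p)),
    [/\ intertwines M A W' W, W'^t* *m W' = 1%:M & W^t* *m W = 1%:M].
Proof.
move=> MA.
have qq_gt0 : (0 < q' * q)%N by apply: leq_trans (minA MA); rewrite muln_gt0 p'_gt0.
have [q'_gt0 q_gt0] : (0 < q')%N /\ (0 < q)%N by apply/andP; rewrite -muln_gt0.
have [K [f [h [hf hh eM]]]] := wittstock p'_gt0 p_gt0
  (pball_rect (fun n X => (MA n X).2)).
have [N [c [d [hc hd eA]]]] := wittstock q'_gt0 q_gt0
  (pball_rect (fun n X => (MA n X).1)).
pose I : finType := ('I_N * 'I_K)%type.
pose cc (k : 'I_#|I|) := f (enum_val k).2 *m c (enum_val k).1.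
pose dd (k : 'I_#|I|) := h (enum_val k).2 *m d (enum_val k).1.
have reidx a b (F : I -> 'M[C]_(a, b)) : \sum_(k < #|I|) F (enum_val k) = \sum_k F k.
  rewrite [RHS](reindex (@enum_val I xpredT)) //; apply: onW_bij.
  exact: enum_val_bij.
have hcc : \sum_k (cc k)^t* *m cc k = 1%:M.
  rewrite (reidx _ _ (fun k => (f k.2 *m c k.1)^t* *m (f k.2 *m c k.1))).
  have := kraus_comp c f c f 1%:M; under [X in X = _ -> _]eq_bigr do
    under eq_bigr do rewrite mulmx1.
  under [X in _ = X -> _]eq_bigr do rewrite mulmx1.
  by move=> <-; rewrite hf; under eq_bigr do rewrite mulmx1.
have hdd : \sum_k (dd k)^t* *m dd k = 1%:M.
  rewrite (reidx _ _ (fun k => (h k.2 *m d k.1)^t* *m (h k.2 *m d k.1))).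
  have := kraus_comp d h d h 1%:M; under [X in X = _ -> _]eq_bigr do
    under eq_bigr do rewrite mulmx1.
  under [X in _ = X -> _]eq_bigr do rewrite mulmx1.
  by move=> <-; rewrite hh; under eq_bigr do rewrite mulmx1.
have hA j : A j = \sum_k (cc k)^t* *m A j *m dd k.
  rewrite (reidx _ _ (fun k => (f k.2 *m c k.1)^t* *m A j *m (h k.2 *m d k.1))).
  by rewrite -kraus_comp -eM -eA.
have comm i k j : f k *m c i *m A j = A j *m (h k *m d i).
  have := kraus_fixed_commute p'_gt0 p_gt0 minA hcc hdd hA (enum_rank (i, k)) j.
  by rewrite /cc /dd enum_rankK.
have comm' i k j : h k *m d i *m (A j)^t* = (A j)^t* *m (f k *m c i).
  have := kraus_fixed_commute_adj p'_gt0 p_gt0 minA hcc hdd hA (enum_rank (i, k)) j.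
  by rewrite /cc /dd enum_rankK.
apply: (isometric_intertwiner p'_gt0 p_gt0 minA hc hd) => i j; split.
  rewrite eM mulmx_suml -[RHS]mul1mx -hf mulmx_suml; apply: eq_bigr => k _.
  by rewrite -!mulmxA -comm !mulmxA.
rewrite eM adj_sum mulmx_suml -[RHS]mul1mx -hh mulmx_suml; apply: eq_bigr => k _.
by rewrite !adjM adjK -!mulmxA -comm' !mulmxA.
Qed.

(** In a representation of the column by A, let c1 and c2 be the parts of c_k belonging to A and to
    T. Rigidity gives A_j d_k = c1_k A_j, so T_j = (sum_k c2_k^* c1_k) A_j, and the sum is an
    off-diagonal block of the identity. *)
Lemma column_vanishes r (T : 'I_g -> 'M[C]_(r, p)) :
  (forall n (X : 'I_g -> 'M[C]_n), pball A X -> pball (fun j => col_mx (A j) (T j)) X) ->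
  forall j, T j = 0.
Proof.
move=> h j.
have [N [c [d [hc hd e]]]] := wittstock p'_gt0 p_gt0 (pball_rect h).
pose E1 : 'M[C]_(p' + r, p') := col_mx 1%:M 0.
pose E2 : 'M[C]_(p' + r, r) := col_mx 0 1%:M.
have E1a : E1^t* = row_mx 1%:M 0 by rewrite tr_col_mx map_row_mx adj1 adj0.
have E2a : E2^t* = row_mx 0 1%:M by rewrite tr_col_mx map_row_mx adj1 adj0.
pose c1 k := c k *m E1; pose c2 k := c k *m E2.
have compress a (F : 'M[C]_(p' + r, a)) i : F^t* *m col_mx (A i) (T i) =
    \sum_k (c k *m F)^t* *m A i *m d k.
  by rewrite e mulmx_sumr; apply: eq_bigr => k _; rewrite adjM !mulmxA.
have hA i : A i = \sum_k (c1 k)^t* *m A i *m d k.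
  by rewrite -compress E1a mul_row_col mul1mx mul0mx addr0.
have hT i : T i = \sum_k (c2 k)^t* *m A i *m d k.
  by rewrite -compress E2a mul_row_col mul1mx mul0mx add0r.
have gram a b (F : 'M[C]_(p' + r, a)) (F' : 'M[C]_(p' + r, b)) :
    \sum_k (c k *m F)^t* *m (c k *m F') = F^t* *m F'.
  rewrite -[F' in RHS]mul1mx -hc mulmx_suml mulmx_sumr; apply: eq_bigr => k _.
  by rewrite adjM !mulmxA.
have hc1 : \sum_k (c1 k)^t* *m c1 k = 1%:M.
  by rewrite gram E1a mul_row_col mul1mx mul0mx addr0.
have hc21 : \sum_k (c2 k)^t* *m c1 k = 0.
  by rewrite gram E2a mul_row_col mulmx0 mul0mx addr0.
rewrite hT; transitivity ((\sum_k (c2 k)^t* *m c1 k) *m A j); last by rewrite hc21 mul0mx.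
rewrite mulmx_suml; apply: eq_bigr => k _.
by rewrite -mulmxA -(kraus_fixed_commute p'_gt0 p_gt0 minA hc1 hd hA) mulmxA.
Qed.

End Embedding.

Lemma row_vanishes p' p (A : 'I_g -> 'M[C]_(p', p)) r (T : 'I_g -> 'M[C]_(p', r)) :
  (0 < p')%N -> (0 < p)%N -> ball_minimal A ->
  (forall n (X : 'I_g -> 'M[C]_n), pball A X -> pball (fun j => row_mx (A j) (T j)) X) ->
  forall j, T j = 0.
Proof.
move=> p'0 p0 minA h j; rewrite -[T j]adjK -[0]adjK adj0; congr (_^t*).
move: j; apply: (column_vanishes p0 p'0 (ball_minimal_adj minA)) => n X.
move=> /pball_adj /h hX.
have -> : (fun j => col_mx ((A j)^t*) ((T j)^t*)) = (fun j => (row_mx (A j) (T j))^t*).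
  by apply: funext => j; rewrite tr_row_mx map_col_mx.
exact/pball_adj.
Qed.

End Intertwiners.

(** * Operator norm and convergence *)

Section OperatorNorm.
Variable R : realType.
Local Notation C := (Cplx R).

(* k bounds the square of the operator norm of M. *)
Definition bnd q' q (k : R) (M : 'M[C]_(q', q)) : Prop :=
  forall n (x : 'M[C]_(q, n)), nn (M *m x) <= k * nn x.

Lemma normvE k (x : 'cV[C]_k) : normv x = Num.sqrt (nn x).
Proof. by rewrite /normv nnE; congr Num.sqrt; apply: eq_bigr => i _; rewrite big_ord1. Qed.

Lemma normv_le1 k (x : 'cV[C]_k) : normv x <= 1 -> nn x <= 1.
Proof.
by rewrite normvE => h; rewrite -[nn x]sqr_sqrtr ?nn_ge0 // expr_le1 ?sqrtr_ge0.
Qed.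

Lemma nn_cols m n (x : 'M[C]_(m, n)) : nn x = \sum_j nn (col j x).
Proof.
rewrite nnE exchange_big; apply: eq_bigr => j _; rewrite nnE.
by apply: eq_bigr => i _; rewrite big_ord1 mxE.
Qed.

Lemma bnd_col q' q k (M : 'M[C]_(q', q)) :
  (forall x : 'cV[C]_q, nn (M *m x) <= k * nn x) -> bnd k M.
Proof.
move=> h n x; rewrite nn_cols [nn x]nn_cols mulr_sumr; apply: ler_sum => j _.
by rewrite !colE -mulmxA.
Qed.

Section Fixed.
Variables (q' q : nat) (M : 'M[C]_(q', q)).

Let S := [set normv (M *m x) | x in [set x : 'cV[C]_q | normv x <= 1]].

Let S0 : S 0.
Proof. by exists 0; rewrite /= ?mulmx0 normvE nn0 sqrtr0. Qed.

Let hsS : has_sup S.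
Proof.
split; first by exists 0.
have [c c0 hc] := nn_mulmx_bounded M.
exists (Num.sqrt c) => _ [x /= hx <-]; rewrite normvE ler_wsqrtr //.
by apply: le_trans (hc _ x) _; apply: ler_piMr; [exact: ltW | exact: normv_le1].
Qed.

Lemma opnorm_ge0 : 0 <= opnorm M.
Proof. exact: sup_upper_bound. Qed.

Lemma opnorm_leP c : 0 <= c -> opnorm M <= c <-> bnd (c ^+ 2) M.
Proof.
move=> c0; split=> h.
  apply: bnd_col => x.
  have [/nn_eq0 ->|nz] := eqVneq (nn x) 0; first by rewrite mulmx0 !nn0 mulr0.
  have x0 : 0 < nn x by rewrite lt_neqAle eq_sym nz nn_ge0.
  pose r := (Num.sqrt (nn x))^-1.
  have r2 : r ^+ 2 = (nn x)^-1 by rewrite exprVn sqr_sqrtr // ltW.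
  have : normv (M *m (rc r *: x)) <= c.
    apply: le_trans h; apply: sup_upper_bound => //; exists (rc r *: x) => //=.
    by rewrite normvE nnZr r2 mulVf ?gt_eqF // sqrtr1.
  rewrite normvE -scalemxAr nnZr r2 -(ler_pXn2r (n := 2)) ?nnegrE ?sqrtr_ge0 //.
  by rewrite sqr_sqrtr ?mulr_ge0 ?invr_ge0 ?nn_ge0 // ler_pdivrMl // mulrC.
apply: ge_sup; first by exists 0.
move=> _ [x /= hx <-]; rewrite normvE -(ger0_norm c0) -sqrtr_sqr ler_wsqrtr //.
by apply: le_trans (h _ x) _; apply: ler_piMr; [exact: sqr_ge0 | exact: normv_le1].
Qed.

Lemma opnorm_le1P : opnorm M <= 1 <-> bnd 1 M.
Proof. by rewrite opnorm_leP // expr1n. Qed.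

Lemma bnd_le k k' : k <= k' -> bnd k M -> bnd k' M.
Proof. by move=> le h n x; apply: le_trans (h _ _) _; rewrite ler_wpM2r ?nn_ge0. Qed.

Lemma opnorm_lt1P : opnorm M < 1 <-> exists k, [/\ 0 < k, k < 1 & bnd k M].
Proof.
split=> [h|[k [k0 k1 h]]].
  pose c := (1 + opnorm M) / 2.
  have c0 : 0 < c by rewrite divr_gt0 // ltr_wpDr // opnorm_ge0.
  have c1 : c < 1 by rewrite /c; lra.
  exists (c ^+ 2); split; rewrite ?exprn_gt0 ?expr_lt1 ?ltW //.
  by apply/opnorm_leP; [exact: ltW | rewrite /c; lra].
apply: (@le_lt_trans _ _ (Num.sqrt k)).
  by apply/opnorm_leP; rewrite ?sqrtr_ge0 // sqr_sqrtr // ltW.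
by rewrite -[1]sqrtr1 ltr_sqrt.
Qed.

Lemma opnorm_eq1 : bnd 1 M -> (forall k, 0 < k < 1 -> ~ bnd k M) -> opnorm M = 1.
Proof.
move=> /opnorm_le1P le h; apply/le_anti; rewrite le leNgt /=; apply/negP.
by move=> /opnorm_lt1P[k [k0 k1]]; apply: h; rewrite k0.
Qed.

Lemma opnorm_eq1_bnd : opnorm M = 1 ->
  bnd 1 M /\ forall k, 0 < k < 1 -> ~ bnd k M.
Proof.
move=> e; split; first by apply/opnorm_le1P; rewrite e.
move=> k /andP[k0 k1] h.
have : opnorm M < 1 by apply/opnorm_lt1P; exists k.
by rewrite e ltxx.
Qed.

(** Young's inequality with weight k for |M^* y|^2 = ip (M M^* y) y. *)
Lemma bnd_adj k : 0 < k -> bnd k M -> bnd k (M^t*).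
Proof.
move=> k0 h n y; have := ip_le_nn_scaled (M *m (M^t* *m y)) y k0.
have -> : ip (M *m (M^t* *m y)) y = nn (M^t* *m y) by rewrite ip_mull.
have : nn (M *m (M^t* *m y)) / k <= nn (M^t* *m y).
  by rewrite ler_pdivrMr // mulrC.
by lra.
Qed.

End Fixed.

Lemma bndZ q' q (M : 'M[C]_(q', q)) k (r : C) :
  bnd k M -> bnd (Normc.normc r ^+ 2 * k) (r *: M).
Proof.
by move=> h n x; rewrite -scalemxAl nnZ -[leRHS]mulrA; apply: ler_wpM2l (h _ x); exact: sqr_ge0.
Qed.

End OperatorNorm.

Section Limits.
Variable R : realType.
Local Notation C := (Cplx R).
Variables (m n : nat).
Implicit Types l : 'M[C]_(m, n).

Lemma normc_ge0 (z : C) : 0 <= Normc.normc z.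
Proof. by case: z => a b; exact: sqrtr_ge0. Qed.

Lemma normr_normc (z : C) : `|z| = rc (Normc.normc z).
Proof. by rewrite normc_def; case: z. Qed.

Lemma nn_entry (x : 'M[C]_(m, n)) i j : Normc.normc (x i j) ^+ 2 <= nn x.
Proof.
rewrite nnE (bigD1 i) //= (bigD1 j) //= -addrA lerDl addr_ge0 //.
  by apply: sumr_ge0 => ? _; exact: sqr_ge0.
by do 2!(apply: sumr_ge0 => ? _); exact: sqr_ge0.
Qed.

Lemma cvg_nnP (T : Type) (F : set_system T) (FF : Filter F) (u : T -> 'M[C]_(m, n)) l :
  u @ F --> l <-> forall e : R, 0 < e -> \forall t \near F, nn (u t - l) <= e.
Proof.
split=> [/cvg_ballP h e e0|h].
  pose s := Num.sqrt (e / (m * n).+1%:R).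
  have s2 : s ^+ 2 = e / (m * n).+1%:R by rewrite sqr_sqrtr // divr_ge0 // ltW.
  have s0 : 0 < s by rewrite sqrtr_gt0 divr_gt0.
  have sC : (0 : C) < rc s by rewrite ltcR.
  move: (h _ sC); apply: filterS => t [_ ht].
  apply: (@le_trans _ _ (\sum_(i < m) \sum_(j < n) s ^+ 2)).
    rewrite nnE; apply: ler_sum => i _; apply: ler_sum => j _.
    have := ht i j; rewrite -ball_normE /= distrC normr_normc ltcR => /ltW hij.
    by rewrite !mxE ler_pXn2r // ?nnegrE ?normc_ge0 // ltW.
  rewrite !sumr_const !card_ord -mulrnA s2 -[leLHS]mulr_natr mulrAC ler_pdivrMr //.
  apply: ler_wpM2l; first exact: ltW.
  by rewrite ler_nat mulnC leqnSn.
apply/cvg_ballP => eps eps0.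
have [s e0] : exists s : R, eps = rc s by exists (re eps); rewrite rc_re // ltW.
subst eps; have s0 : 0 < s by rewrite -ltcR.
have := h (s ^+ 2 / 4) (divr_gt0 (exprn_gt0 2 s0) (ltr0Sn _ _)).
apply: filterS => t ht; split=> // i j.
rewrite -ball_normE /= distrC normr_normc ltcR.
have := le_trans (nn_entry _ i j) ht; rewrite !mxE.
have lt : s ^+ 2 / 4 < s ^+ 2 by have := exprn_gt0 2 s0; lra.
move=> /le_lt_trans/(_ lt).
by rewrite ltr_pXn2r // ?nnegrE ?normc_ge0 // ltW.
Qed.

Lemma cvg_nn_unique (T : Type) (F : set_system T) (FF : ProperFilter F)
    (u : T -> 'M[C]_(m, n)) l l' : u @ F --> l -> u @ F --> l' -> l = l'.
Proof.
move=> /cvg_nnP h /cvg_nnP h'; apply/subr0_eq/nn_eq0/le_anti.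
rewrite nn_ge0 andbT; apply/ler_addgt0Pr => e e0; rewrite add0r.
have e4 : 0 < e / 4 by rewrite divr_gt0.
have [t [h1 h2]] := filter_ex (filterI (h _ e4) (h' _ e4)).
have -> : l - l' = (u t - l') - (u t - l) by rewrite opprB [RHS]addrC addrA subrK.
apply: le_trans (nnB_le2 _ _) _; move: h1 h2 => /=.
by move: (nn _) (nn _) => a b; lra.
Qed.

Lemma limn_nn (u : nat -> 'M[C]_(m, n)) l : u @ \oo --> l -> limn u = l.
Proof.
move=> h; apply: (@cvg_nn_unique nat \oo _ u) (h).
by apply/cvg_ex; exists l.
Qed.

End Limits.

(** * Evaluation at block shifts *)

Section Vectorization.
Variable R : realType.
Local Notation C := (Cplx R).

(** Row-major order, matching [mxtens_index]; through [tensmx_tvec] Kronecker products disappear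
    from the later estimates. *)
Definition tvec p n (x : 'M[C]_(p, n)) : 'cV[C]_(p * n) :=
  \col_k x (mxtens_unindex k).1 (mxtens_unindex k).2.
Definition untvec p n (v : 'cV[C]_(p * n)) : 'M[C]_(p, n) :=
  \matrix_(i, j) v (mxtens_index (i, j)) 0.

Lemma tvecK p n : cancel (@tvec p n) (@untvec p n).
Proof. by move=> x; apply/matrixP => i j; rewrite !mxE mxtens_indexK. Qed.
Lemma untvecK p n : cancel (@untvec p n) (@tvec p n).
Proof.
move=> v; apply/colP => k; rewrite !mxE.
by rewrite -surjective_pairing mxtens_unindexK.
Qed.

Lemma tvecD p n (x y : 'M[C]_(p, n)) : tvec (x + y) = tvec x + tvec y.
Proof. by apply/colP => k; rewrite !mxE. Qed.
Lemma tvecN p n (x : 'M[C]_(p, n)) : tvec (- x) = - tvec x.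
Proof. by apply/colP => k; rewrite !mxE. Qed.
Lemma tvecB p n (x y : 'M[C]_(p, n)) : tvec (x - y) = tvec x - tvec y.
Proof. by rewrite tvecD tvecN. Qed.
Lemma tvec_sum p n I (r : seq I) (P : pred I) (F : I -> 'M[C]_(p, n)) :
  tvec (\sum_(i <- r | P i) F i) = \sum_(i <- r | P i) tvec (F i).
Proof.
by apply: (big_morph _ (@tvecD p n)); apply/colP => k; rewrite !mxE.
Qed.

Lemma sum_mxtens (T : nmodType) p n (F : 'I_(p * n) -> T) :
  \sum_k F k = \sum_i \sum_j F (mxtens_index (i, j)).
Proof.
rewrite (reindex (@mxtens_index p n)) /=; last first.
  exists (@mxtens_unindex p n) => k _; [exact: mxtens_indexK|exact: mxtens_unindexK].
by rewrite pair_bigA; apply: eq_bigr => -[].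
Qed.

Lemma tensmx_tvec p q n n' (A : 'M[C]_(p, q)) (B : 'M[C]_(n', n)) (x : 'M[C]_(q, n)) :
  (A *t B) *m tvec x = tvec (A *m x *m B^T).
Proof.
apply/colP => k; case: (mxtens_indexP k) => i j.
rewrite !mxE mxtens_indexK /= sum_mxtens exchange_big; apply: eq_bigr => b _.
rewrite !mxE mulr_suml; apply: eq_bigr => a _.
by rewrite tensmxE !mxE mxtens_indexK /= mulrAC.
Qed.

Lemma nn_tvec p n (x : 'M[C]_(p, n)) : nn (tvec x) = nn x.
Proof.
rewrite !nnE sum_mxtens; apply: eq_bigr => i _; apply: eq_bigr => j _.
by rewrite big_ord1 mxE mxtens_indexK.
Qed.

Lemma bnd_tvec p q n n' k (M : 'M[C]_(p * n', q * n)) :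
  (forall x : 'M[C]_(q, n), nn (M *m tvec x) <= k * nn x) -> bnd k M.
Proof. by move=> h; apply: bnd_col => v; rewrite -[v]untvecK nn_tvec. Qed.

Lemma ampl_tvec n p q (v : 'M[C]_(p, q)) (x : 'M[C]_(q, n)) :
  ampl n v *m tvec x = tvec (v *m x).
Proof. by rewrite /ampl tensmx_tvec trmx1 mulmx1. Qed.

Lemma eq_mx_tvec p q n (M N : 'M[C]_(p, q * n)) :
  (forall x : 'M[C]_(q, n), M *m tvec x = N *m tvec x) -> M = N.
Proof.
move=> h; apply/matrixP => i j; have := h (untvec (delta_mx j 0)).
by rewrite untvecK => /matrixP/(_ i 0); rewrite -!colE !mxE.
Qed.

End Vectorization.

Section WordSums.
Variables (g : nat) (T : nmodType).

Lemma sum_words0 (F : word g -> T) : \sum_(w : 0.-tuple 'I_g) F w = F [::].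
Proof.
by rewrite (bigD1 [tuple]) //= big1 ?addr0 // => w /eqP[]; exact: tuple0.
Qed.

Lemma sum_wordsS k (F : word g -> T) :
  \sum_(w : k.+1.-tuple 'I_g) F w = \sum_j \sum_(w : k.-tuple 'I_g) F (j :: w).
Proof.
rewrite (reindex (fun t : 'I_g * k.-tuple 'I_g => [tuple of t.1 :: t.2])) /=.
  by rewrite pair_bigA.
exists (fun w => (thead w, [tuple of behead w])) => [[j w] _|w _] /=.
  by rewrite theadE; congr pair; apply: val_inj.
by rewrite -tuple_eta.
Qed.

Lemma sum_words_cat i k (F : word g -> T) :
  \sum_(w : (i + k).-tuple 'I_g) F w =
  \sum_(u : i.-tuple 'I_g) \sum_(v : k.-tuple 'I_g) F (u ++ v).
Proof.
elim: i F => [|i IH] F; first by rewrite (sum_words0 (fun u => \sum_(v : k.-tuple 'I_g) F (u ++ v))).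
rewrite (sum_wordsS i (fun u => \sum_(v : k.-tuple 'I_g) F (u ++ v))).
rewrite (sum_wordsS (i + k)); apply: eq_bigr => j _.
exact: (IH (fun w => F (j :: w))).
Qed.

End WordSums.

Section NilpotentEvaluation.
Variables (R : realType) (g : nat).
Local Notation C := (Cplx R).

Lemma pencil_eval_tvec p q (L : pencil R g p q) n (X : mxtuple R g n) x :
  pencil_eval L X *m tvec x = tvec (\sum_j L j *m x *m (X j)^T).
Proof.
rewrite /pencil_eval mulmx_suml tvec_sum; apply: eq_bigr => j _.
exact: tensmx_tvec.
Qed.

Lemma pball_opnorm p q (L : pencil R g p q) n (X : mxtuple R g n) :
  opnorm (pencil_eval L X) <= 1 <-> pball L (fun j => (X j)^T).
Proof.
rewrite opnorm_le1P; split=> [h x y|h].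
  have := h _ (tvec x); rewrite pencil_eval_tvec !nn_tvec mul1r -ip_suml.
  have := ip_le_nn (\sum_j L j *m x *m (X j)^T) y.
  by move: (nn x) (nn y) (nn _) (ip _ _) => a b c e; lra.
apply: bnd_tvec => x; rewrite pencil_eval_tvec nn_tvec mul1r.
have := h x (\sum_j L j *m x *m (X j)^T); rewrite -ip_suml -/(nn _).
by move: (nn x) (nn _) => a b; lra.
Qed.

Lemma word_eval_nil n (X : mxtuple R g n) : word_eval X [::] = 1%:M.
Proof. by rewrite /word_eval big_nil. Qed.
Lemma word_eval_cons n (X : mxtuple R g n) j w :
  word_eval X (j :: w) = X j *m word_eval X w.
Proof. by rewrite /word_eval big_cons. Qed.
Lemma word_eval_cat n (X : mxtuple R g n) u w :
  word_eval X (u ++ w) = word_eval X u *m word_eval X w.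
Proof. by rewrite /word_eval big_cat. Qed.

(* Word in matrices that vary along the word: the letter at distance s from the
   right end is evaluated in the tuple Xs (t + s). *)
Fixpoint word_eval_along n (Xs : nat -> mxtuple R g n) (t : nat) (w : word g) : 'M[C]_n :=
  if w is j :: w' then Xs (t + size w')%N j *m word_eval_along Xs t w' else 1%:M.

Lemma word_eval_along_cst n (X : mxtuple R g n) t w :
  word_eval_along (fun=> X) t w = word_eval X w.
Proof.
by elim: w => [|j w IH] /=; rewrite ?word_eval_nil // IH word_eval_cons.
Qed.

(* The action of the homogeneous part of degree k on vectorized matrices, as in
   [fps_homog_tvec], with a tuple that varies along the word. *)
Definition hact_along p q (f : fps R g p q) n (Xs : nat -> mxtuple R g n) t k
    (x : 'M[C]_(q, n)) : 'M[C]_(p, n) :=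
  \sum_(w : k.-tuple 'I_g) f w *m x *m (word_eval_along Xs t w)^T.

Definition hact p q (f : fps R g p q) n (X : mxtuple R g n) k (x : 'M[C]_(q, n)) :
    'M[C]_(p, n) :=
  \sum_(w : k.-tuple 'I_g) f w *m x *m (word_eval X w)^T.

Lemma hact_along_cst p q (f : fps R g p q) n (X : mxtuple R g n) t k x :
  hact_along f (fun=> X) t k x = hact f X k x.
Proof. by apply: eq_bigr => w _; rewrite word_eval_along_cst. Qed.

Lemma fps_homog_tvec p q (f : fps R g p q) n (X : mxtuple R g n) k x :
  fps_homog f X k *m tvec x = tvec (hact f X k x).
Proof.
rewrite /fps_homog mulmx_suml tvec_sum; apply: eq_bigr => w _.
exact: tensmx_tvec.
Qed.

Definition lact p q (L : pencil R g p q) n (X : mxtuple R g n) (x : 'M[C]_(q, n)) :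
    'M[C]_(p, n) :=
  \sum_j L j *m x *m (X j)^T.

Lemma bnd_lact p q (L : pencil R g p q) n (X : mxtuple R g n) k :
  bnd k (pencil_eval L X) <-> forall x, nn (lact L X x) <= k * nn x.
Proof.
split=> [h x|h].
  by have := h _ (tvec x); rewrite pencil_eval_tvec !nn_tvec.
by apply: bnd_tvec => x; rewrite pencil_eval_tvec nn_tvec; exact: h.
Qed.

Section Shift.
Variables (n N : nat) (Xs : nat -> mxtuple R g n).

(** Inclusion of block s. It is zero for s >= N, so whatever is shifted past the last block is
    lost. *)
Let J (s : nat) : 'M[C]_(n, N * n) :=
  \matrix_(a, k) (((mxtens_unindex k).1 == s :> nat) && ((mxtens_unindex k).2 == a))%:R.

Let J_big s : (N <= s)%N -> J s = 0.
Proof.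
move=> h; apply/matrixP => a k; rewrite !mxE.
by have := ltn_ord (mxtens_unindex k).1; case: eqP => // ->; rewrite ltnNge h.
Qed.

Let J_orth s t : J s *m (J t)^T = if (s == t) && (s < N)%N then 1%:M else 0.
Proof.
case: (ltnP s N) => hs; last by rewrite J_big // mul0mx andbF.
rewrite andbT; apply/matrixP => a b; rewrite mxE sum_mxtens.
rewrite (bigD1 (Ordinal hs)) //= [X in _ + X]big1 ?addr0; last first.
  move=> i; rewrite -val_eqE /= => hi; apply: big1 => j _.
  by rewrite !mxE mxtens_indexK /= (negbTE hi) mul0r.
rewrite (bigD1 a) //= [X in _ + X]big1 ?addr0; last first.
  by move=> j hj; rewrite !mxE mxtens_indexK /= (negbTE hj) andbF mul0r.
rewrite !mxE mxtens_indexK /= !eqxx mul1r.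
by case: eqP => _; rewrite !mxE.
Qed.

Let J_adj s : (J s)^t* = (J s)^T.
Proof. by apply/matrixP => i j; rewrite !mxE conjC_nat. Qed.

Let J_sum : \sum_(s < N) (J s)^T *m J s = 1%:M.
Proof.
apply/matrixP => k l; rewrite summxE.
case: (mxtens_indexP k) => s a; case: (mxtens_indexP l) => t b.
rewrite (bigD1 s) //= [X in _ + X]big1 ?addr0; last first.
  move=> i; rewrite -val_eqE /= => hi; rewrite mxE big1 // => c _.
  by rewrite !mxE mxtens_indexK /= [_ == i :> nat]eq_sym (negbTE hi) mul0r.
rewrite !mxE (bigD1 a) //= [X in _ + X]big1 ?addr0; last first.
  by move=> c hc; rewrite !mxE mxtens_indexK /= eq_sym (negbTE hc) andbF mul0r.
rewrite !mxE !mxtens_indexK /= !eqxx mul1r.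
rewrite (inj_eq (can_inj (@mxtens_indexK _ _))) xpair_eqE.
by rewrite -!val_eqE /=; congr (nat_of_bool (_ && _))%:R; exact: eq_sym.
Qed.

(* Block matrices with the Xs s on the subdiagonal. *)
Definition shift_tuple : mxtuple R g (N * n) :=
  fun i => \sum_(s < N) (J s.+1)^T *m Xs s i *m J s.

Lemma word_eval_shift w : word_eval shift_tuple w =
  \sum_(s < N) (J (s + size w))^T *m word_eval_along Xs s w *m J s.
Proof.
elim: w => [|j w IH] /=.
  by rewrite word_eval_nil -J_sum; apply: eq_bigr => s _; rewrite addn0 mulmx1.
rewrite word_eval_cons IH mulmx_sumr; apply: eq_bigr => s _.
rewrite /shift_tuple mulmx_suml addnS.
case: (ltnP (s + size w) N) => hs; last first.
  rewrite (J_big hs) (J_big (leqW hs)) !trmx0 !mul0mx big1 // => t _.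
  by rewrite mulmx0.
rewrite (bigD1 (Ordinal hs)) //= big1 ?addr0 => [|t].
  rewrite !mulmxA -(mulmxA _ (J (s + size w))) J_orth eqxx hs /= mulmx1.
  by [].
rewrite -val_eqE /= => ht.
by rewrite !mulmxA -(mulmxA _ (J t)) J_orth (negbTE ht) /= mulmx0 !mul0mx.
Qed.

Lemma word_eval_shift0 w : (N <= size w)%N -> word_eval shift_tuple w = 0.
Proof.
move=> h; rewrite word_eval_shift big1 // => s _.
by rewrite J_big ?trmx0 ?mul0mx // (leq_trans h) // leq_addl.
Qed.

Section Packing.
Variable q : nat.

Definition pack (x : nat -> 'M[C]_(q, n)) : 'M[C]_(q, N * n) :=
  \sum_(s < N) x s *m J s.

Lemma nn_pack x : nn (pack x) = \sum_(s < N) nn (x s).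
Proof.
rewrite /pack /nn ip_suml; apply: eq_bigr => s _; rewrite ip_sumr (bigD1 s) //=.
rewrite big1 ?addr0 => [|t]; last first.
  rewrite -val_eqE /= eq_sym => ht.
  by rewrite ip_mulr J_adj -mulmxA J_orth eq_sym (negbTE ht) /= mulmx0 ip0r.
by rewrite ip_mulr J_adj -mulmxA J_orth eqxx ltn_ord mulmx1.
Qed.

Lemma packP (y : 'M[C]_(q, N * n)) : exists x, y = pack x.
Proof.
exists (fun s => y *m (J s)^T); rewrite -[LHS]mulmx1 -J_sum mulmx_sumr.
by apply: eq_bigr => s _; rewrite mulmxA.
Qed.

End Packing.

Lemma lact_shift p q (L : pencil R g p q) x :
  lact L shift_tuple (pack x) =
  pack (fun m => if m is s.+1 then lact L (Xs s) (x s) else 0).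
Proof.
have xJ (s : 'I_N) : pack x *m (J s)^T = x s.
  rewrite /pack mulmx_suml (bigD1 s) //= big1 ?addr0 => [|t].
    by rewrite -mulmxA J_orth eqxx ltn_ord mulmx1.
  by rewrite -val_eqE /= => ht; rewrite -mulmxA J_orth (negbTE ht) mulmx0.
have -> : lact L shift_tuple (pack x) = \sum_(s < N) lact L (Xs s) (x s) *m J s.+1.
  rewrite /lact /shift_tuple.
  under eq_bigr do rewrite [(\sum_(_ < N) _)^T]raddf_sum mulmx_sumr.
  rewrite exchange_big; apply: eq_bigr => s _; rewrite mulmx_suml.
  apply: eq_bigr => j _ /=.
  by rewrite !trmx_mul trmxK (mulmxA _ ((J s)^T)) -(mulmxA (L j)) xJ mulmxA.
rewrite /pack; have := J_big (leqnn N); move: J; case: (N) => [|N'] J' hJ.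
  by rewrite !big_ord0.
rewrite big_ord_recr [RHS]big_ord_recl /= hJ mulmx0 mul0mx addr0 add0r.
by apply: eq_bigr.
Qed.

(** A word of length k carries block s to block s + k. Evaluation is thus block lower triangular,
    with the part of degree m - s in position (m, s), and degrees from N on vanish. *)
Lemma hact_shift p q (f : fps R g p q) x :
  \sum_(k < N) hact f shift_tuple k (pack x) =
  pack (fun m => \sum_(s < m.+1) hact_along f Xs s (m - s) (x s)).
Proof.
have e k : hact f shift_tuple k (pack x) =
    \sum_(s < N) hact_along f Xs s k (x s) *m J (s + k).
  rewrite /hact; under eq_bigr => w _ do
    rewrite word_eval_shift size_tuple [(\sum_(_ < N) _)^T]raddf_sum mulmx_sumr.
  rewrite exchange_big; apply: eq_bigr => s _.
  rewrite /hact_along mulmx_suml; apply: eq_bigr => w _ /=.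
  rewrite !trmx_mul trmxK -!mulmxA; congr (_ *m _); rewrite !mulmxA; congr (_ *m _ *m _).
  rewrite /pack mulmx_suml (bigD1 s) //= big1 ?addr0 => [|t].
    by rewrite -mulmxA J_orth eqxx ltn_ord mulmx1.
  by rewrite -val_eqE /= => ht; rewrite -mulmxA J_orth (negbTE ht) mulmx0.
under eq_bigr do rewrite e.
rewrite exchange_big /pack /=.
transitivity (\sum_(s < N) \sum_(m < N | (s <= m)%N)
    hact_along f Xs s (m - s) (x s) *m J m).
  apply: eq_bigr => s _.
  pose F k := hact_along f Xs s k (x s) *m J (s + k).
  rewrite -(big_mkord xpredT F) (big_cat_nat (n := N - s)) ?leq_subr //=.
  rewrite [X in _ + X]big_nat_cond [X in _ + X]big1 ?addr0 => [|k]; last first.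
    by rewrite andbT /F => /andP[hk _]; rewrite J_big ?mulmx0 // -leq_subLR.
  rewrite -(big_mkord (fun m => (s <= m)%N)
    (fun m => hact_along f Xs s (m - s) (x s) *m J m)).
  rewrite [RHS](big_cat_nat (n := s)) ?(ltnW (ltn_ord s)) //=.
  rewrite [X in _ = X + _]big_nat_cond [X in _ = X + _]big1 ?add0r => [|m]; last first.
    by rewrite leq0n /= => /andP[ms sm]; move: (leq_trans ms sm); rewrite ltnn.
  rewrite [RHS](big_addn 0 N s (fun m => (s <= m)%N)
    (fun m => hact_along f Xs s (m - s) (x s) *m J m)) [RHS]big_mkcond.
  apply: eq_bigr => k _.
  by rewrite leq_addl addnK /F addnC.
rewrite (exchange_big_dep xpredT) //=; apply: eq_bigr => m _.
rewrite mulmx_suml.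
by rewrite (big_ord_widen N (fun s => hact_along f Xs s (m - s) (x s) *m J m)).
Qed.

End Shift.
End NilpotentEvaluation.

(** * Linear fractional maps *)

Section Halmos.
Variable R : realType.
Local Notation C := (Cplx R).
Variables (p q : nat) (V : 'M[C]_(p, q)) (D : 'M[C]_p) (D' : 'M[C]_q).
Hypotheses (uD : D \in unitmx) (uD' : D' \in unitmx).
Hypotheses (aD : D^t* = D) (aD' : D'^t* = D').
Hypotheses (sD : D *m D = 1%:M - V *m V^t*) (sD' : D' *m D' = 1%:M - V^t* *m V).
Hypothesis iD : D *m V = V *m D'.

(** The relation between (x, f) and (h, z) is symmetric. For f = F_v(u) x and z = u h, solving it
    backwards is the involution property. *)
Lemma halmos_solve n (x h : 'M[C]_(q, n)) (f z : 'M[C]_(p, n)) :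
  D' *m h = x - V^t* *m f -> D *m z = V *m x - f ->
  D *m f = V *m h - z /\ D' *m x = h - V^t* *m z.
Proof.
move=> e1 e2.
have iD' : D' *m V^t* = V^t* *m D by rewrite -[LHS]adjK adjM adjK aD' -iD adjM aD.
have ef : f = V *m x - D *m z by rewrite e2 opprB addrC subrK.
have ex : x = D' *m h + V^t* *m f by rewrite e1 subrK.
split.
  apply: (can_inj (mulKmx uD)).
  have ef2 : f = V *m D' *m h + V *m V^t* *m f - D *m z.
    by rewrite {1}ef {1}ex mulmxDr !mulmxA.
  rewrite mulmxA sD mulmxBl mul1mx mulmxBr mulmxA iD {1}ef2.
  by rewrite addrAC addrK.
apply: (can_inj (mulKmx uD')).
have ex2 : x = D' *m h + V^t* *m V *m x - V^t* *m (D *m z).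
  by rewrite {1}ex {1}ef mulmxBr addrA !mulmxA.
rewrite mulmxA sD' mulmxBl mul1mx mulmxBr [D' *m (V^t* *m z)]mulmxA iD' {1}ex2.
by rewrite -mulmxA addrAC addrK mulmxA.
Qed.

(* Multiplying by the Halmos matrix of V is isometric for the indefinite form
   |x|^2 - |f|^2. *)
Lemma halmos_identity n (x h : 'M[C]_(q, n)) (f z : 'M[C]_(p, n)) :
  D' *m h = x - V^t* *m f -> D *m z = V *m x - f -> nn x - nn f = nn h - nn z.
Proof.
move=> e1 e2; have [Df Dx] := halmos_solve e1 e2.
have nx : nn x = nn (D' *m x) + nn (V *m x).
  by rewrite /nn !ip_mull aD' !mulmxA sD' -ipDr -mulmxDl subrK mul1mx.
have ev : V *m x = f + D *m z by rewrite e2 addrC subrK.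
have nz : nn (D *m z) = nn z - nn (V^t* *m z).
  by rewrite /nn !ip_mull aD adjK !mulmxA sD mulmxBl mul1mx ipBr.
have cross : ip f (D *m z) = ip (V *m h) z - nn z.
  by rewrite ipC ip_mull aD Df ipC ipBl.
have cross' : ip h (V^t* *m z) = ip (V *m h) z by rewrite ip_mull.
rewrite nx Dx ev nnB nnD nz cross cross'.
move: (nn f) (nn h) (nn z) (nn _) (ip _ _) => a b c e g; ring.
Qed.

Lemma halmos_value (U : 'M[C]_(p, q)) (H : 'M[C]_q) : H - V^t* *m U *m H = D' ->
  D' *m H = 1%:M - V^t* *m (V - D *m U *m H).
Proof.
move=> e.
have iD' : D' *m V^t* = V^t* *m D by rewrite -[LHS]adjK adjM adjK aD' -iD adjM aD.
have eH : H = D' + V^t* *m U *m H by rewrite -{1}e subrK.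
rewrite {1}eH mulmxDr sD' mulmxBr opprB addrCA -!mulmxA (mulmxA D') iD' !mulmxA.
by rewrite addrC -addrA [- _ + _]addrC.
Qed.

Lemma halmos_involution (F U : 'M[C]_(p, q)) (H : 'M[C]_q) : H \in unitmx ->
  D' *m H = 1%:M - V^t* *m F -> D *m (U *m H) = V - F ->
  V - D *m F *m (invmx (1%:M - V^t* *m F) *m D') = U.
Proof.
move=> uH eH ez.
have [] := @halmos_solve _ 1%:M H F (U *m H); rewrite ?mulmx1 // => -> _.
have uDH : D' *m H \in unitmx by rewrite unitmx_mul uD' uH.
have -> : invmx (1%:M - V^t* *m F) *m D' = invmx H.
  rewrite -eH; apply: (can_inj (mulKmx uDH)).
  by rewrite mulmxA mulmxV // mul1mx -mulmxA mulmxV // mulmx1.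
by rewrite -mulmxBl mulmxK // opprB addrC subrK.
Qed.
End Halmos.

Section LinearFractional.
Variable R : realType.
Local Notation C := (Cplx R).
Variables (p q : nat) (V : 'M[C]_(p, q)) (k : R).
Hypotheses (k0 : 0 < k) (k1 : k < 1) (hV : bnd k V).

Local Notation D := (psd_sqrtmx (1%:M - V *m V^t*)).
Local Notation D' := (psd_sqrtmx (1%:M - V^t* *m V)).

Let le_contraction (a : R) : 0 <= a -> a <= k * a -> a = 0.
Proof.
move=> a0 h; apply/le_anti; rewrite a0 andbT.
have k1' : 0 < 1 - k by rewrite subr_gt0.
by rewrite -(ler_pM2l k1') mulr0 mulrBl mul1r subr_le0.
Qed.

Lemma bnd_defect_psd p' q' (W : 'M[C]_(p', q')) :
  bnd k W -> psd (1%:M - W^t* *m W) /\ 1%:M - W^t* *m W \in unitmx.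
Proof.
move=> hW.
have e n (x : 'M[C]_(q', n)) : ip ((1%:M - W^t* *m W) *m x) x = nn x - nn (W *m x).
  by rewrite mulmxBl ipBl mul1mx -mulmxA ip_mull adjK.
split.
  split=> [|n x]; first by rewrite adjB adj1 adjM adjK.
  rewrite e subr_ge0; apply: le_trans (hW _ x) _.
  by apply: ler_piMl; [exact: nn_ge0 | exact: ltW].
apply: unitmx_inj => x hx; apply: nn_eq0.
have := e _ x; rewrite hx ip0l => /esym/eqP; rewrite subr_eq0 => /eqP ex.
by apply: le_contraction; [exact: nn_ge0 | rewrite {1}ex; exact: hW].
Qed.

Let hVa : bnd k (V^t*) := bnd_adj k0 hV.

Lemma defect_psd : psd (1%:M - V *m V^t*).
Proof. by have [] := bnd_defect_psd hVa; rewrite adjK. Qed.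
Lemma defect_psd' : psd (1%:M - V^t* *m V).
Proof. by have [] := bnd_defect_psd hV. Qed.
Lemma defect_unit : D \in unitmx.
Proof.
apply: psd_sqrtmx_unit; first exact: defect_psd.
by have [_] := bnd_defect_psd hVa; rewrite adjK.
Qed.
Lemma defect_unit' : D' \in unitmx.
Proof.
by apply: psd_sqrtmx_unit; [exact: defect_psd' | have [] := bnd_defect_psd hV].
Qed.
Lemma defect_adj : D^t* = D. Proof. exact: psd_sqrtmx_adj defect_psd. Qed.
Lemma defect_adj' : D'^t* = D'. Proof. exact: psd_sqrtmx_adj defect_psd'. Qed.
Lemma defect_sqr : D *m D = 1%:M - V *m V^t*.
Proof. exact: psd_sqrtmxK defect_psd. Qed.
Lemma defect_sqr' : D' *m D' = 1%:M - V^t* *m V.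
Proof. exact: psd_sqrtmxK defect_psd'. Qed.
Lemma defect_intertwine : D *m V = V *m D'.
Proof.
apply: psd_sqrtmx_intertwine; [by case: defect_psd | by case: defect_psd' |].
by rewrite mulmxBl mulmxBr mul1mx mulmx1 !mulmxA.
Qed.
Lemma defect_intertwine' : D' *m V^t* = V^t* *m D.
Proof.
by rewrite -[LHS]adjK adjM adjK defect_adj' -defect_intertwine adjM defect_adj.
Qed.

Lemma contraction_unit (U : 'M[C]_(p, q)) : bnd 1 U -> 1%:M - V^t* *m U \in unitmx.
Proof.
move=> hU; apply: unitmx_inj => x; rewrite mulmxBl mul1mx => /subr0_eq e.
apply: nn_eq0; apply: le_contraction; first exact: nn_ge0.
rewrite {1}e -mulmxA; apply: le_trans (hVa _) _; rewrite ler_pM2l //.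
by have := hU _ x; rewrite mul1r.
Qed.

Section Value.
Variable U : 'M[C]_(p, q).
Hypothesis hU : bnd 1 U.

(** H links the two sides of the Halmos relation: (x, F x) corresponds to (H x, U H x), where F =
    F_V(U). *)
Let H := invmx (1%:M - V^t* *m U) *m D'.

Lemma linfracE : linfrac V U = V - D *m U *m H.
Proof. by rewrite /linfrac /H -(mulmxA (D *m U)). Qed.

Lemma linfrac_h : D' *m H = 1%:M - V^t* *m linfrac V U.
Proof.
rewrite linfracE; apply: (halmos_value defect_adj defect_adj' defect_sqr' defect_intertwine).
by rewrite -{1}[H]mul1mx -mulmxBl /H mulmxA mulmxV ?mul1mx // contraction_unit.
Qed.

Lemma linfrac_z : D *m (U *m H) = V - linfrac V U.
Proof. by rewrite linfracE subKr mulmxA. Qed.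

Lemma linfrac_identity n (x : 'M[C]_(q, n)) :
  nn x - nn (linfrac V U *m x) = nn (H *m x) - nn (U *m (H *m x)).
Proof.
apply: (halmos_identity defect_unit defect_unit' defect_adj defect_adj'
  defect_sqr defect_sqr' defect_intertwine).
  by rewrite (mulmxA D' H) linfrac_h mulmxBl mul1mx -mulmxA.
by rewrite (mulmxA U H) (mulmxA D) linfrac_z mulmxBl.
Qed.

Lemma linfrac_bnd1 : bnd 1 (linfrac V U).
Proof.
move=> n x; rewrite mul1r -subr_ge0 linfrac_identity subr_ge0.
by have := hU (H *m x); rewrite mul1r.
Qed.

Lemma linfrac_h_unit : H \in unitmx.
Proof. by rewrite unitmx_mul unitmx_inv contraction_unit ?defect_unit'. Qed.

(** |x|^2 - |F x|^2 is at least (1 - k') |H x|^2 by [linfrac_identity], and H is invertible. *)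
Lemma linfrac_strict k' : 0 < k' -> k' < 1 -> bnd k' U ->
  exists k'', [/\ 0 < k'', k'' < 1 & bnd k'' (linfrac V U)].
Proof.
move=> k'0 k'1 hU'; have [c c0 hc] := nn_mulmx_bounded (invmx H).
pose e := (1 - k') / (c + 1).
have c1 : 0 < c + 1 by apply: addr_gt0.
have e0 : 0 < e by apply: divr_gt0 => //; rewrite subr_gt0.
have e1 : e < 1.
  by rewrite ltr_pdivrMr //; lra.
exists (1 - e); split; [lra | lra |] => n x.
have hx : nn x <= c * nn (H *m x) by have := hc _ (H *m x); rewrite mulKmx ?linfrac_h_unit.
have hz := hU' _ (H *m x).
have id := linfrac_identity x.
have b0 := nn_ge0 (H *m x).
have : e * nn x <= (1 - k') * nn (H *m x).
  move: hx b0; move: (nn x) (nn (H *m x)) => a b hx b0.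
  rewrite /e mulrAC ler_pdivrMr // -mulrA.
  by apply: ler_wpM2l; [rewrite subr_ge0 ltW | lra].
move: id hz; move: (nn x) (nn _) (nn _) (nn _) => a b b' d; lra.
Qed.

End Value.

Lemma linfracK (U : 'M[C]_(p, q)) : bnd 1 U -> linfrac V (linfrac V U) = U.
Proof.
move=> hU; rewrite [LHS]linfracE.
apply: (halmos_involution defect_unit defect_unit' defect_adj defect_adj' defect_sqr
  defect_sqr' defect_intertwine (linfrac_h_unit hU)).
  exact: linfrac_h.
exact: linfrac_z.
Qed.

(** With weights 1 - t and t, k < t < 1, the s-part is at most the fraction k / t of the left side
    and is absorbed there; t = (1 + k) / 2 yields the constant. *)
Lemma absorb_sum m n (N : nat) (w r s : 'I_N -> 'M[C]_(m, n)) :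
  (forall i, w i = r i + s i) -> \sum_i nn (s i) <= k * \sum_i nn (w i) ->
  \sum_i nn (w i) <= 2 * (1 + k) / (1 - k) ^+ 2 * \sum_i nn (r i).
Proof.
move=> e hs; pose t := (1 + k) / 2.
have [kp kl] : 0 < k /\ k < 1 by [].
have k1' : 0 < 1 - k by rewrite subr_gt0.
have t0 : 0 < t by rewrite /t; lra.
have t1 : 0 < 1 - t by rewrite /t; lra.
have h : \sum_i nn (w i) <= (\sum_i nn (r i)) / (1 - t) + (\sum_i nn (s i)) / t.
  rewrite !mulr_suml -big_split; apply: ler_sum => i _ /=.
  have ht : 0 < 1 - t < 1 by rewrite t1 /=; lra.
  by have := nnD_le (r i) (s i) ht; rewrite subKr e.
move: hs h; move: (\sum_i nn (w i)) (\sum_i nn (r i)) (\sum_i nn (s i)) => a b c hs h.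
have h2 : a <= b / (1 - t) + k * a / t.
  by apply: le_trans h _; rewrite lerD2l ler_pM2r ?invr_gt0.
have e1 : b / (1 - t) = 2 * b / (1 - k) by rewrite /t; field; rewrite !gt_eqF //; lra.
have e2 : k * a / t = 2 * k * a / (1 + k) by rewrite /t; field; rewrite gt_eqF //; lra.
have kp' : 0 < 1 + k by lra.
have h3 : a * (1 - k) / (1 + k) <= 2 * b / (1 - k).
  have -> : a * (1 - k) / (1 + k) = a - 2 * k * a / (1 + k) by field; rewrite gt_eqF.
  by rewrite lerBlDr -e1 -e2.
rewrite -(ler_pM2r k1') -(ler_pM2r (x := (1 + k)^-1)) ?invr_gt0 //.
apply: le_trans h3 _; rewrite le_eqVlt; apply/orP; left; apply/eqP.
by field; rewrite !gt_eqF.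
Qed.

(** The difference w = U HU - Y HY satisfies w = (U - Y) HU + Y V^* w, so [absorb_sum] applies with
    a single term, and HU is uniformly bounded. *)
Lemma linfrac_lipschitz : exists2 c : R, 0 <= c & forall U Y : 'M[C]_(p, q),
  bnd 1 U -> bnd 1 Y -> nn (linfrac V U - linfrac V Y) <= c * nn (U - Y).
Proof.
have [c1 c10 hc1] := nn_mulmx_bounded (invmx D').
have [c2 c20 hc2] := nn_mulmx_bounded D.
pose K := 2 * (1 + k) / (1 - k) ^+ 2.
have [kp kl] : 0 < k /\ k < 1 by [].
have K0 : 0 <= K by apply: divr_ge0; rewrite ?sqr_ge0 //; lra.
pose hh := c1 * (4 * nn (1%:M : 'M[C]_q)).
have hh0 : 0 <= hh by rewrite !mulr_ge0 ?nn_ge0 // ltW.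
exists (c2 * (K * (q%:R * hh))) => [|U Y hU hY].
  by apply: mulr_ge0; [exact: ltW | apply: mulr_ge0 => //; exact: mulr_ge0].
have [HU eU zU] : exists2 H, D' *m H = 1%:M - V^t* *m linfrac V U
    & D *m (U *m H) = V - linfrac V U.
  by eexists; [exact: linfrac_h | exact: linfrac_z].
have [HY eY zY] : exists2 H, D' *m H = 1%:M - V^t* *m linfrac V Y
    & D *m (Y *m H) = V - linfrac V Y.
  by eexists; [exact: linfrac_h | exact: linfrac_z].
have bF := linfrac_bnd1 hU; have iD' := defect_intertwine'; have uD' := defect_unit'.
move: bF eU zU eY zY iD' uD' hc1 hc2.
move: (linfrac V U) (linfrac V Y) D D' => FU FY E E' bF eU zU eY zY iD' uD' hc1 hc2.
pose w := U *m HU - Y *m HY.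
have ew : FU - FY = - (E *m w).
  by rewrite mulmxBr zU zY opprB [RHS]addrC opprB addrA subrK.
have eH : HU - HY = V^t* *m w.
  apply: (can_inj (mulKmx uD')); rewrite mulmxBr eU eY mulmxA iD' -mulmxA.
  by rewrite -[E *m w]opprK -ew mulmxN mulmxBr !opprB [LHS]addrC addrA subrK.
have nH : nn HU <= hh.
  have -> : HU = invmx E' *m (1%:M - V^t* *m FU) by rewrite -eU mulKmx.
  apply: le_trans (hc1 _ _) _; rewrite ler_pM2l //.
  apply: le_trans (nnB_le2 _ _) _.
  have := hVa FU; have := bF _ 1%:M; have := nn_ge0 FU; rewrite mulmx1 mul1r.
  move: (nn FU) (nn (V^t* *m FU)) (nn 1%:M) => a b c a0 h1 h2.
  have : k * a <= a by apply: ler_piMl => //; exact: ltW.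
  by lra.
have : \sum_(i < 1) nn w <= K * \sum_(i < 1) nn ((U - Y) *m HU).
  apply: (absorb_sum (s := fun=> Y *m (V^t* *m w))) => [i|].
    by rewrite -eH mulmxBr mulmxBl addrA subrK.
  rewrite !big_ord1; apply: le_trans (hY _ _) _; rewrite mul1r; exact: hVa.
rewrite !big_ord1 => hw.
have h1 : nn ((U - Y) *m HU) <= q%:R * hh * nn (U - Y).
  apply: le_trans (nn_mulmx_le _ _) _; rewrite [leRHS]mulrAC; apply: ler_wpM2l => //.
  by apply: mulr_ge0 => //; exact: nn_ge0.
rewrite ew nnN; apply: le_trans (hc2 _ _) _; rewrite -(mulrA c2) ler_pM2l //.
by apply: le_trans hw _; rewrite -(mulrA K); exact: ler_wpM2l.
Qed.

End LinearFractional.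

(** * Contractive power series *)

Section BallEvaluation.
Variables (R : realType) (g : nat) (d' d : nat) (L : pencil R g d' d).
Local Notation C := (Cplx R).

Lemma pencil_ballP n (X : mxtuple R g n) :
  pencil_ball L X <-> exists k, [/\ 0 < k, k < 1 & bnd k (pencil_eval L X)].
Proof. exact: opnorm_lt1P. Qed.

Lemma bnd_shift n N (Xs : nat -> mxtuple R g n) k : 0 <= k ->
  (forall s, bnd k (pencil_eval L (Xs s))) ->
  bnd k (pencil_eval L (shift_tuple N Xs)).
Proof.
move=> k0 h; apply/bnd_lact => y; have [x ->] := packP y.
rewrite lact_shift !nn_pack; case: N x y => [|N] x y.
  by rewrite !big_ord0 mulr0.
rewrite big_ord_recl nn0 add0r big_ord_recr /= mulrDr mulr_sumr.
rewrite -[leLHS]addr0; apply: lerD; last by apply: mulr_ge0 => //; exact: nn_ge0.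
by apply: ler_sum => s _; have /bnd_lact := h s; exact.
Qed.

Lemma bnd_shift_inv n (X : mxtuple R g n) k :
  bnd k (pencil_eval L (shift_tuple 2 (fun=> X))) -> bnd k (pencil_eval L X).
Proof.
move=> /bnd_lact h; apply/bnd_lact => x.
have := h (pack 2 (fun s => if s is 0%N then x else 0)).
by rewrite lact_shift !nn_pack !big_ord_recr !big_ord0 /= !nn0 !add0r addr0.

Qed.

Lemma pencil_evalZ n (X : mxtuple R g n) (c : C) :
  pencil_eval L (fun j => c *: X j) = c *: pencil_eval L X.
Proof.
rewrite /pencil_eval scaler_sumr; apply: eq_bigr => j _.
by apply/matrixP => a b; rewrite !mxE mulrCA.
Qed.

Lemma bnd_pencilZ n (X : mxtuple R g n) (c : C) k : bnd k (pencil_eval L X) ->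
  bnd (Normc.normc c ^+ 2 * k) (pencil_eval L (fun j => c *: X j)).
Proof. by rewrite pencil_evalZ; exact: bndZ. Qed.

Lemma normc_rc (r : R) : Normc.normc (rc r) = `|r|.
Proof. by rewrite /Normc.normc /= expr0n /= addr0 sqrtr_sqr. Qed.

Lemma pencil_ball_scale n (X : mxtuple R g n) : pencil_ball L X ->
  exists2 r : R, 1 < r & pencil_ball L (fun j => rc r *: X j).
Proof.
move=> /pencil_ballP[k [k0 k1 hk]].
(* This r exceeds 1, and r^2 k = 2 k / (1 + k) is still below 1. *)
pose r := Num.sqrt (2 / (1 + k)).
have kp : 0 < 1 + k by lra.
have r2 : r ^+ 2 = 2 / (1 + k) by rewrite sqr_sqrtr // divr_ge0 // ltW.
exists r.
  by rewrite -sqrtr1 ltr_sqrt ?divr_gt0 // ltr_pdivlMr // mul1r; lra.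
apply/pencil_ballP; exists (r ^+ 2 * k); split.
- by rewrite r2; apply: mulr_gt0 => //; exact: divr_gt0.
- by rewrite r2 mulrAC ltr_pdivrMr // mul1r; lra.
- by have := bnd_pencilZ (rc r) hk; rewrite normc_rc real_normK ?num_real.
Qed.

Lemma pencil_ball0 n : pencil_ball L ((fun=> 0) : mxtuple R g n).
Proof.
apply/pencil_ballP; exists 2^-1; split; [by lra | by lra |].
apply/bnd_lact => x; rewrite /lact big1 => [|j _]; last by rewrite trmx0 mulmx0.
by rewrite nn0; apply: mulr_ge0; [lra | exact: nn_ge0].
Qed.

Lemma word_evalZ n (X : mxtuple R g n) (c : C) w :
  word_eval (fun j => c *: X j) w = c ^+ size w *: word_eval X w.
Proof.
elim: w => [|j w IH]; first by rewrite !word_eval_nil scale1r.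
by rewrite !word_eval_cons IH -scalemxAl -scalemxAr scalerA -exprS.
Qed.

Section Series.
Variables (p q : nat) (f : fps R g p q).

Lemma hactZ n (X : mxtuple R g n) (c : C) k x :
  hact f (fun j => c *: X j) k x = c ^+ k *: hact f X k x.
Proof.
rewrite /hact scaler_sumr; apply: eq_bigr => w _.
by rewrite word_evalZ size_tuple linearZ /= -scalemxAr.
Qed.

Lemma hactB n (X : mxtuple R g n) k x y :
  hact f X k (x - y) = hact f X k x - hact f X k y.
Proof.
by rewrite /hact -sumrB; apply: eq_bigr => w _; rewrite mulmxBr mulmxBl.
Qed.

Lemma hact0 n (X : mxtuple R g n) x : hact f X 0 x = f [::] *m x.
Proof.
rewrite /hact (sum_words0 (fun w => f w *m x *m (word_eval X w)^T)).
by rewrite word_eval_nil trmx1 mulmx1.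
Qed.

Lemma series_tvec n (X : mxtuple R g n) N x :
  series (fps_homog f X) N *m tvec x = tvec (\sum_(k < N) hact f X k x).
Proof.
rewrite /series /= big_mkord mulmx_suml tvec_sum; apply: eq_bigr => k _.
exact: fps_homog_tvec.
Qed.

Lemma fps_eval_shift n N (Xs : nat -> mxtuple R g n) x :
  fps_eval f (shift_tuple N Xs) *m tvec (pack N x) =
  tvec (pack N (fun m => \sum_(s < m.+1) hact_along f Xs s (m - s) (x s))).
Proof.
have -> : fps_eval f (shift_tuple N Xs) = series (fps_homog f (shift_tuple N Xs)) N.
  apply: limn_nn; apply/cvg_nnP => e e0; near=> M.
  have NM : (N <= M)%N by near: M; exact: nbhs_infty_ge.
  rewrite /series /= (big_cat_nat (leq0n N) NM) /= addrAC subrr add0r.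
  rewrite big_nat_cond big1 ?nn0 ?ltW // => k; rewrite andbT => /andP[Nk _].
  rewrite /fps_homog big1 // => w _.
  by rewrite word_eval_shift0 ?tensmx0 // size_tuple.
by rewrite series_tvec hact_shift.
Unshelve. all: by end_near.
Qed.

Definition ball_contractive := forall n (X : mxtuple R g n),
  pencil_ball L X -> bnd 1 (fps_eval f X).

Hypothesis hf : ball_contractive.

Lemma along_contraction n N (Xs : nat -> mxtuple R g n) k (x : nat -> 'M[C]_(q, n)) : k < 1 ->
  (forall s, bnd k (pencil_eval L (Xs s))) ->
  \sum_(m < N) nn (\sum_(s < m.+1) hact_along f Xs s (m - s) (x s)) <=
  \sum_(s < N) nn (x s).
Proof.
move=> k1 hX.
have /hf h : pencil_ball L (shift_tuple N Xs).
  (* The maximum supplies the positive constant that [pencil_ballP] asks for; k itself is only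
     bounded above. *)
  apply/pencil_ballP; exists (Num.max k 2^-1); split.
  - by rewrite lt_max; apply/orP; right; lra.
  - by rewrite gt_max k1; lra.
  - apply: bnd_shift => [|s]; first by rewrite le_max; apply/orP; right; lra.
    by apply: bnd_le (hX s); rewrite le_max lexx.
have := h _ (tvec (pack N x)).
by rewrite fps_eval_shift !nn_tvec !nn_pack mul1r.
Qed.

Lemma toeplitz_contraction n N (X : mxtuple R g n) (x : nat -> 'M[C]_(q, n)) : pencil_ball L X ->
  \sum_(m < N) nn (\sum_(s < m.+1) hact f X (m - s) (x s)) <= \sum_(s < N) nn (x s).
Proof.
move=> /pencil_ballP[k [k0 k1 hk]].
apply: le_trans (along_contraction N (Xs := fun=> X) x k1 (fun=> hk)).
rewrite le_eqVlt; apply/orP; left; apply/eqP; apply: eq_bigr => m _.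
by congr nn; apply: eq_bigr => s _; rewrite hact_along_cst.
Qed.

Lemma hact_contraction n (X : mxtuple R g n) k x : pencil_ball L X ->
  nn (hact f X k x) <= nn x.
Proof.
move=> hX; have := toeplitz_contraction k.+1 (fun s => if s is 0%N then x else 0) hX.
rewrite [X in _ <= X]big_ord_recl /= [X in _ <= _ + X]big1 ?addr0 => [|i _]; last exact: nn0.
apply: le_trans; rewrite big_ord_recr /= ler_wpDl //.
  by apply: sumr_ge0 => ? _; exact: nn_ge0.
rewrite big_ord_recl /= subn0 big1 ?addr0 // => i _.
by rewrite /hact big1 // => w _; rewrite mulmx0 mul0mx.
Qed.

(** Contractivity also holds at r X for some r > 1, where the part of degree k is multiplied by r^k;
    hence t = r^-2. *)
Lemma hact_geometric n (X : mxtuple R g n) : pencil_ball L X ->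
  exists t : R, [/\ 0 < t, t < 1 & forall k x, nn (hact f X k x) <= t ^+ k * nn x].
Proof.
move=> /pencil_ball_scale[r r1 hr].
have r0 : 0 < r by lra.
have r20 : 0 < r ^+ 2 by exact: exprn_gt0.
exists (r ^- 2); split.
- by rewrite invr_gt0.
- by rewrite invf_lt1 // exprn_egt1.
move=> k x; have := hact_contraction k x hr; rewrite hactZ.
have -> : rc r ^+ k = rc (r ^+ k) by elim: k => // k IH; rewrite !exprS IH rcM.
rewrite nnZr -exprM mulnC exprM => h.
by rewrite exprVn ler_pdivlMl ?exprn_gt0.
Qed.

End Series.
End BallEvaluation.

(** * Limits and tails in squared norms *)

Section NormLimits.
Variable R : realType.
Local Notation C := (Cplx R).

Lemma nn_lim_le m n (T : Type) (F : set_system T) (FF : ProperFilter F)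
    (u : T -> 'M[C]_(m, n)) l (B : R) :
  u @ F --> l -> (\forall t \near F, nn (u t) <= B) -> nn l <= B.
Proof.
move=> /cvg_nnP h hB; apply/ler_addgt0Pr => e e0.
have B0 : 0 <= B.
  by have [t ht] := filter_ex hB; apply: le_trans ht; exact: nn_ge0.
(* Young's inequality with weight s splits the cross term of |u - (u - l)|^2; this s keeps s |u|^2
   below e / 2. *)
pose s := e / (2 * (B + 1)).
have s0 : 0 < s by apply: divr_gt0 => //; apply: mulr_gt0 => //; lra.
pose c := 1 + s^-1.
have c0 : 0 < c by apply: addr_gt0 => //; rewrite invr_gt0.
have e2 : 0 < e / (2 * c) by apply: divr_gt0 => //; exact: mulr_gt0.
have [t [h1 h2]] := filter_ex (filterI (h _ e2) hB).
have -> : l = u t - (u t - l) by rewrite subKr.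
rewrite nnB; have := ip_le_nn_scaled (- (u t - l)) (u t) s0.
rewrite ipNl nnN [ip _ (u t)]ipC.
move: h1 h2 => /=.
move: (nn (u t - l)) (nn (u t)) (ip (u t) (u t - l)) => a b x h1 h2 h3.
have sB : s * b <= e / 2.
  apply: (@le_trans _ _ (s * (B + 1))); first by apply: ler_wpM2l; [exact: ltW | lra].
  have B1 : B + 1 != 0 by rewrite gt_eqF // ltr_wpDl.
  by rewrite /s invfM mulrA divfK.
have ca : c * a <= e / 2.
  apply: (@le_trans _ _ (c * (e / (2 * c)))); first by apply: ler_wpM2l => //; exact: ltW.
  by rewrite mulrC invfM mulrA divfK // gt_eqF.
have : c * a = a + a / s by rewrite /c mulrDl mul1r mulrC.
by lra.
Qed.

Lemma bnd_lim p q (T : Type) (F : set_system T) (FF : ProperFilter F)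
    (u : T -> 'M[C]_(p, q)) l (k : R) :
  u @ F --> l -> (\forall t \near F, bnd k (u t)) -> bnd k l.
Proof.
move=> /cvg_nnP h hk n x.
apply: (nn_lim_le (u := fun t => u t *m x) FF).
  apply/cvg_nnP => e e0.
  have c0 : 0 < q%:R * nn x + 1 by rewrite ltr_wpDl // mulr_ge0 // nn_ge0.
  have := h _ (divr_gt0 e0 c0); apply: filterS => t ht.
  rewrite -mulmxBl; apply: le_trans (nn_mulmx_le _ _) _.
  rewrite mulrAC; apply: le_trans (ler_wpM2l _ ht) _.
    by rewrite mulr_ge0 // nn_ge0.
  rewrite mulrCA; apply: ler_piMr; first exact: ltW.
  by rewrite ler_pdivrMr // mul1r lerDl.
by apply: filterS hk => t ht; exact: ht.
Qed.

Lemma cvg_mx_cols p q n (T : Type) (F : set_system T) (FF : Filter F)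
    (u : T -> 'M[C]_(p, q * n)) l :
  (forall x : 'M[C]_(q, n), (fun t => u t *m tvec x) @ F --> l *m tvec x) ->
  u @ F --> l.
Proof.
move=> h; apply/cvg_nnP => e e0.
have c0 : 0 < (q * n)%:R + 1 :> R by rewrite ltr_wpDl.
have hj (j : 'I_(q * n)) : \forall t \near F, nn (col j (u t - l)) <= e / ((q * n)%:R + 1).
  have /cvg_nnP/(_ _ (divr_gt0 e0 c0)) := h (untvec (delta_mx j 0)).
  by apply: filterS => t; rewrite untvecK -mulmxBl -colE.
apply: filterS (filter_forall _ hj) => t ht.
rewrite nn_cols; apply: le_trans (ler_sum _ (fun j _ => ht j)) _.
rewrite sumr_const card_ord -[leLHS]mulr_natr mulrAC ler_pdivrMr //.
by apply: ler_wpM2l; [exact: ltW | rewrite lerDl].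
Qed.

Lemma bounded_sum_cvg0 (t : nat -> R) (B e : R) : 0 < e -> (forall i, 0 <= t i) ->
  (forall N, \sum_(i < N) t i <= B) -> \forall N \near \oo, t N <= e.
Proof.
move=> e0 t0 hB.
have cs : cvgn (series t).
  apply: nondecreasing_is_cvgn.
    apply/nondecreasing_seqP => n; rewrite /series /= big_nat_recr //= lerDl //.
  by exists B => _ [N _ <-]; rewrite /series /= big_mkord.
have /cvgrPdist_le/(_ e e0) := cvg_series_cvg_0 cs.
by apply: filterS => N; rewrite sub0r normrN ger0_norm.
Qed.

(** Splitting off the first term with weights s and 1 - s gives the recursion K -> c / s + q K,
    whose fixed point is the K chosen. The choice s = (1 - t) / 2 ensures q < 1. *)
Lemma geometric_tail m n (a : nat -> 'M[C]_(m, n)) (c t : R) : 0 <= c -> 0 < t -> t < 1 ->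
  (forall i, nn (a i) <= t ^+ i * c) ->
  exists2 K : R, 0 <= K & forall j i, nn (\sum_(s < j) a (i + s)%N) <= t ^+ i * K.
Proof.
move=> c0 t0 t1 ha; pose s := (1 - t) / 2.
have s0 : 0 < s by rewrite /s; lra.
have s1 : 0 < 1 - s by rewrite /s; lra.
pose q := t / (1 - s).
have q1 : q < 1 by rewrite ltr_pdivrMr // /s; lra.
have q1' : 0 < 1 - q by rewrite subr_gt0.
pose K := c / s / (1 - q).
have K0 : 0 <= K by apply: divr_ge0; [apply: divr_ge0 => //; exact: ltW | exact: ltW].
exists K => //; elim=> [|j IH] i.
  by rewrite big_ord0 nn0; apply: mulr_ge0 => //; rewrite exprn_ge0 // ltW.
rewrite big_ord_recl addn0.
have hs : 0 < s < 1 by rewrite s0 /s; lra.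
apply: le_trans (nnD_le _ _ hs) _.
have h1 : nn (a i) / s <= t ^+ i * c / s by rewrite ler_pM2r ?invr_gt0.
have h2 : nn (\sum_(k < j) a (i + lift ord0 k)%N) / (1 - s) <= t ^+ i * (q * K).
  have := IH i.+1; under eq_bigr do rewrite addSnnS.
  rewrite -(ler_pM2r (x := (1 - s)^-1)) ?invr_gt0 //.
  move/le_trans; apply.
  have -> : t ^+ i.+1 * K / (1 - s) = t ^+ i * (q * K) by rewrite exprSr /q; ring.
  exact: lexx.
apply: le_trans (lerD h1 h2) _.
rewrite -mulrA -mulrDr; apply: ler_wpM2l; first by rewrite exprn_ge0 // ltW.
have -> : c / s = (1 - q) * K by rewrite [RHS]mulrC /K divfK // gt_eqF.
by rewrite -mulrDl subrK mul1r.
Qed.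

End NormLimits.

Section Convolution.
Variables (R : realType) (g : nat).
Local Notation C := (Cplx R).

Lemma hact_conv p q r (a : fps R g p q) (b : fps R g q r) n (X : mxtuple R g n) k i
    (x : 'M[C]_(r, n)) : (i <= k)%N ->
  \sum_(w : k.-tuple 'I_g) (a (take i w) *m b (drop i w)) *m x *m (word_eval X w)^T =
  hact a X i (hact b X (k - i) x).
Proof.
move=> ik.
pose F (w : word g) := (a (take i w) *m b (drop i w)) *m x *m (word_eval X w)^T.
transitivity (\sum_(w : (i + (k - i)).-tuple 'I_g) F w); first by rewrite subnKC.
rewrite sum_words_cat /hact; apply: eq_bigr => u _.
rewrite mulmx_sumr mulmx_suml; apply: eq_bigr => w _.
rewrite /F take_size_cat ?size_tuple // drop_size_cat ?size_tuple //.
by rewrite word_eval_cat trmx_mul !mulmxA.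
Qed.

Lemma hact_mul p' p q q' (a : fps R g p q) (A : 'M[C]_(p', p)) (B : 'M[C]_(q, q'))
    n (X : mxtuple R g n) k x :
  hact (fun w => A *m a w *m B) X k x = A *m hact a X k (B *m x).
Proof.
by rewrite /hact mulmx_sumr; apply: eq_bigr => w _; rewrite !mulmxA.
Qed.

End Convolution.

(** Adding the recursion over all degrees up to m turns the coefficients inside the convolution into
    partial sums. *)
Lemma convolution_sum (V W : zmodType) (tw : nat -> V -> W) (va : W -> V)
    (ph P : nat -> W) (x : V) (c : W) :
  (forall i, {morph tw i : y z / y - z}) -> {morph va : y z / y + z} ->
  P 0%N = ph 0%N -> (forall j, P j.+1 = P j + ph j.+1) ->
  (forall j, ph j = (if j is 0%N then c else 0) - tw j x +
     \sum_(i < j.+1) tw i (va (ph (j - i)%N))) ->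
  forall m, P m = c - \sum_(i < m.+1) tw i (x - va (P (m - i)%N)).
Proof.
move=> twB vaD ph0 phS rec; elim=> [|m IH].
  have := rec 0%N; rewrite ph0 !big_ord1 subnn twB opprB => r0.
  by rewrite {}[LHS]r0 -addrA; congr (_ + _); rewrite addrC.
have := rec m.+1; rewrite big_ord_recr /= subnn sub0r => rS.
rewrite phS IH rS [in RHS]big_ord_recr /= subnn ph0 twB.
have -> : \sum_(i < m.+1) tw i (x - va (P (m.+1 - i)%N)) =
    \sum_(i < m.+1) tw i (x - va (P (m - i)%N)) - \sum_(i < m.+1) tw i (va (ph (m.+1 - i)%N)).
  rewrite -sumrB; apply: eq_bigr => i _.
  by rewrite subSn ?leq_ord // phS -twB vaD opprD addrA.
by rewrite !opprD !opprK -!addrA; congr (_ + (_ + _)); rewrite addrCA.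
Qed.

(** * Power series of linear fractional images *)

Section FractionalSeries.
Variables (R : realType) (g : nat) (p q : nat) (u : fps R g p q).
Local Notation C := (Cplx R).
Local Notation v := (u [::]).
Local Notation D := (psd_sqrtmx (1%:M - v *m v^t*)).
Local Notation D' := (psd_sqrtmx (1%:M - v^t* *m v)).

(** Eliminating h from D' h = 1 - v^* phi and D u h = v - phi leaves phi = v - (D u D'^-1) (1 - v^*
    phi); the twist is the factor D u D'^-1. *)
Definition twist : fps R g p q := fun w => D *m u w *m invmx D'.

(* Coefficients of the solution phi of (1 - twist v^* ) phi = v - twist, by
   recursion on a bound n for the length of the word. *)
Fixpoint linfrac_fps_fuel (n : nat) (w : word g) : 'M[C]_(p, q) :=
  if n is n'.+1 then
    invmx (1%:M - v *m v^t*) *m ((if w is [::] then v else 0) - twist w +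
      \sum_(i < size w) twist (take i.+1 w) *m v^t* *m linfrac_fps_fuel n' (drop i.+1 w))
  else 0.

Definition linfrac_fps : fps R g p q := fun w => linfrac_fps_fuel (size w).+1 w.

Lemma linfrac_fps_fuelE n w : (size w < n)%N -> linfrac_fps_fuel n w = linfrac_fps w.
Proof.
rewrite /linfrac_fps; move: (leqnn (size w).+1); move: {2 4}(size w).+1 => m.
elim: m n w => [n w|m IH [|n] w] wm wn; [by rewrite ltn0 in wm | by rewrite ltn0 in wn |].
rewrite [LHS]/= [RHS]/=.
congr (_ *m (_ + _)); apply: eq_bigr => i _; congr (_ *m _).
have lt : (size (drop i.+1 w) < size w)%N.
  by rewrite size_drop ltn_subrL (leq_ltn_trans _ (ltn_ord i)).
by apply: (IH n (drop i.+1 w)); apply: leq_trans lt _.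
Qed.

Variable k : R.
Hypotheses (k0 : 0 < k) (k1 : k < 1) (hv : bnd k v).

Lemma twist_nil : twist [::] = v.
Proof.
by rewrite /twist (defect_intertwine k0 k1 hv) -mulmxA mulmxV ?mulmx1 ?(defect_unit' k1 hv).
Qed.

Lemma linfrac_fps_nil : linfrac_fps [::] = 0.
Proof. by rewrite /linfrac_fps /= twist_nil subrr big_ord0 addr0 mulmx0. Qed.

(** The term i = 0 is v v^* times the unknown coefficient itself; the definition has it moved to the
    left and 1 - v v^* inverted. *)
Lemma linfrac_fps_rec w : linfrac_fps w = (if w is [::] then v else 0) - twist w +
  \sum_(i < (size w).+1) twist (take i w) *m v^t* *m linfrac_fps (drop i w).
Proof.
have unit : 1%:M - v *m v^t* \in unitmx.
  by have [_] := bnd_defect_psd k1 (bnd_adj k0 hv); rewrite adjK.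
have e : (1%:M - v *m v^t*) *m linfrac_fps w = (if w is [::] then v else 0) - twist w +
    \sum_(i < size w) twist (take i.+1 w) *m v^t* *m linfrac_fps (drop i.+1 w).
  rewrite {1}/linfrac_fps /= mulKVmx //; congr (_ + _); apply: eq_bigr => i _.
  congr (_ *m _); apply: linfrac_fps_fuelE.
  by rewrite size_drop ltn_subrL (leq_ltn_trans _ (ltn_ord i)).
rewrite big_ord_recl /= take0 drop0 twist_nil [RHS]addrCA.
under [X in _ = _ + (_ + X)]eq_bigr do rewrite /bump leq0n add1n.
by rewrite -e mulmxBl mul1mx addrC subrK.
Qed.

Section Evaluation.
Variables (n : nat) (X : mxtuple R g n) (x : 'M[C]_(q, n)).

Let Phi m := \sum_(k < m.+1) hact linfrac_fps X k x.

Lemma hact_linfrac_fps m : hact linfrac_fps X m x =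
  (if m is 0%N then v *m x else 0) - hact twist X m x +
  \sum_(i < m.+1) hact twist X i (v^t* *m hact linfrac_fps X (m - i) x).
Proof.
rewrite {1}/hact; under eq_bigr => w _ do rewrite linfrac_fps_rec size_tuple !mulmxDl.
rewrite big_split /= big_split /=; congr (_ + _ + _).
- case: m => [|m]; last first.
    by rewrite big1 // => w _; case: w => -[|j w] //= _; rewrite !mul0mx.
  rewrite (sum_words0 (fun w => (if w is [::] then v else 0) *m x *m (word_eval X w)^T)).
  by rewrite word_eval_nil trmx1 mulmx1.
- by rewrite /hact -sumrN; apply: eq_bigr => w _; rewrite !mulNmx.
under eq_bigr => w _ do rewrite !mulmx_suml.
rewrite exchange_big; apply: eq_bigr => i _ /=.
have -> : v^t* *m hact linfrac_fps X (m - i) x =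
    hact (fun w => v^t* *m linfrac_fps w *m 1%:M) X (m - i) x by rewrite hact_mul mul1mx.
refine (etrans _ (hact_conv twist (fun w => v^t* *m linfrac_fps w *m 1%:M) X x (leq_ord i))).
by apply: eq_bigr => w _; rewrite mulmx1 !mulmxA.
Qed.

Lemma hact_linfrac_fps_sum m : Phi m =
  v *m x - \sum_(i < m.+1) hact twist X i (x - v^t* *m Phi (m - i)).
Proof.
have ph0 : Phi 0 = hact linfrac_fps X 0 x by rewrite /Phi big_ord1.
have phS j : Phi j.+1 = Phi j + hact linfrac_fps X j.+1 x by rewrite /Phi big_ord_recr.
apply: (convolution_sum (tw := hact twist X) (va := mulmx (v^t*)) _ _ ph0 phS).
- by move=> ? ? ?; exact: hactB.
- by move=> ? ?; exact: mulmxDr.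
- by move=> j; exact: hact_linfrac_fps.
Qed.

End Evaluation.
End FractionalSeries.

(** * Amplified square roots and convergence of the transformed series *)

Section Amplification.
Variable R : realType.
Local Notation C := (Cplx R).

Lemma ampl_mul n p q r (A : 'M[C]_(p, q)) (B : 'M[C]_(q, r)) :
  ampl n (A *m B) = ampl n A *m ampl n B.
Proof. by apply: eq_mx_tvec => x; rewrite -mulmxA !ampl_tvec mulmxA. Qed.

Lemma amplB n p q (A B : 'M[C]_(p, q)) : ampl n (A - B) = ampl n A - ampl n B.
Proof. by apply: eq_mx_tvec => x; rewrite mulmxBl !ampl_tvec mulmxBl tvecB. Qed.

Lemma ampl1 n p : ampl n (1%:M : 'M[C]_p) = 1%:M.
Proof. by apply: eq_mx_tvec => x; rewrite ampl_tvec !mul1mx. Qed.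

Lemma ampl_adj n p q (A : 'M[C]_(p, q)) : (ampl n A)^t* = ampl n (A^t*).
Proof.
apply/matrixP => a b; case: (mxtens_indexP a) => i s; case: (mxtens_indexP b) => j t.
by rewrite /ampl mxE [in LHS]mxE !tensmxE rmorphM !mxE rmorph_nat eq_sym.
Qed.

Lemma bnd_ampl n p q (A : 'M[C]_(p, q)) k : bnd k A -> bnd k (ampl n A).
Proof. by move=> h; apply: bnd_tvec => x; rewrite ampl_tvec nn_tvec. Qed.

(** The diagonalizations that [spectralmx] picks for S and [ampl n S] need not be related. But the
    embedding E b onto the b-th copy intertwines the two matrices, hence also their roots. *)
Lemma psd_sqrtmx_ampl n p (S : 'M[C]_p) : S^t* = S ->
  psd_sqrtmx (ampl n S) = ampl n (psd_sqrtmx S).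
Proof.
move=> hS; apply: eq_mx_tvec => x; rewrite ampl_tvec.
pose E b : 'M[C]_(p * n, p) := \matrix_(a, i)
  (((mxtens_unindex a).1 == i) && ((mxtens_unindex a).2 == b))%:R.
have EE b (y : 'cV[C]_p) : E b *m y = tvec (y *m delta_mx 0 b).
  apply/colP => a; case: (mxtens_indexP a) => i s.
  rewrite !mxE mxtens_indexK /= big_ord1 (bigD1 i) //= big1 ?addr0.
    by rewrite !mxE mxtens_indexK /= !eqxx /= mulrC.
  by move=> j hj; rewrite !mxE mxtens_indexK /= eq_sym (negbTE hj) mul0r.
have hE b : ampl n S *m E b = E b *m S.
  have h (y : 'cV[C]_p) : (ampl n S *m E b) *m y = (E b *m S) *m y.
    by rewrite -!mulmxA !EE ampl_tvec mulmxA.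
  apply/matrixP => a j; have /colP/(_ a) := h (delta_mx j 0).
  by rewrite -!colE [col j _ a 0]mxE [RHS]mxE.
have aS : (ampl n S)^t* = ampl n S by rewrite ampl_adj hS.
have xE (y : 'M[C]_(p, n)) : tvec y = \sum_b E b *m col b y.
  under eq_bigr do rewrite EE.
  rewrite -tvec_sum; congr tvec; apply/matrixP => i j.
  rewrite summxE (bigD1 j) //= big1 ?addr0.
    by rewrite !mxE big_ord1 !mxE !eqxx mulr1.
  by move=> b hb; rewrite !mxE big_ord1 !mxE [j == b]eq_sym (negbTE hb) andbF mulr0.
rewrite !xE mulmx_sumr; apply: eq_bigr => b _.
rewrite mulmxA (psd_sqrtmx_intertwine aS hS (hE b)) -mulmxA; congr (_ *m _).
by rewrite !colE mulmxA.
Qed.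

Lemma defect_ampl n p q (V : 'M[C]_(p, q)) :
  psd_sqrtmx (1%:M - ampl n V *m (ampl n V)^t*) = ampl n (psd_sqrtmx (1%:M - V *m V^t*)).
Proof.
rewrite ampl_adj -ampl_mul -ampl1 -amplB psd_sqrtmx_ampl //.
by rewrite adjB adj1 adjM adjK.
Qed.

Lemma defect_ampl' n p q (V : 'M[C]_(p, q)) :
  psd_sqrtmx (1%:M - (ampl n V)^t* *m ampl n V) = ampl n (psd_sqrtmx (1%:M - V^t* *m V)).
Proof.
rewrite ampl_adj -ampl_mul -ampl1 -amplB psd_sqrtmx_ampl //.
by rewrite adjB adj1 adjM adjK.
Qed.

End Amplification.

Section Convergence.
Variables (R : realType) (g d' d : nat) (L : pencil R g d' d).
Local Notation C := (Cplx R).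
Variables (p q : nat) (u : fps R g p q) (k : R).
Local Notation v := (u [::]).
Hypotheses (k0 : 0 < k) (k1 : k < 1) (hv : bnd k v).
Hypothesis hu : ball_contractive L u.
Hypothesis cvu : forall n (X : mxtuple R g n), pencil_ball L X ->
  series (fps_homog u X) @ \oo --> fps_eval u X.

Local Notation D := (psd_sqrtmx (1%:M - v *m v^t*)).
Local Notation D' := (psd_sqrtmx (1%:M - v^t* *m v)).

Lemma toeplitz_rev n N (X : mxtuple R g n) (x : nat -> 'M[C]_(q, n)) :
  pencil_ball L X ->
  \sum_(m < N) nn (\sum_(i < m.+1) hact u X i (x (m - i)%N)) <= \sum_(s < N) nn (x s).
Proof.
move=> hX; have := toeplitz_contraction hu N x hX.
have -> // : \sum_(m < N) nn (\sum_(s < m.+1) hact u X (m - s) (x s)) =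
  \sum_(m < N) nn (\sum_(i < m.+1) hact u X i (x (m - i)%N)).
apply: eq_bigr => m _; congr nn; rewrite (reindex_inj rev_ord_inj) /=.
by apply: eq_bigr => i _; rewrite subSS subKn // leq_ord.
Qed.

Lemma cvg_linfrac_fps n (X : mxtuple R g n) : pencil_ball L X ->
  series (fps_homog (linfrac_fps u) X) @ \oo --> linfrac (ampl n v) (fps_eval u X).
Proof.
move=> hX; apply: cvg_mx_cols => x.
pose V := ampl n v; pose U := fps_eval u X; pose F := linfrac V U.
have bV : bnd k V := bnd_ampl hv.
have bU : bnd 1 U := hu hX.
pose H := invmx (1%:M - V^t* *m U) *m psd_sqrtmx (1%:M - V^t* *m V).
(* [hinf], [Fx] and [Uh] are the expected limits of [h], [Phi] and [z] below. *)
pose hinf : 'M[C]_(q, n) := untvec (H *m tvec x).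
pose Fx : 'M[C]_(p, n) := untvec (F *m tvec x).
pose Uh : 'M[C]_(p, n) := untvec (U *m tvec hinf).
have e1 : D' *m hinf = x - v^t* *m Fx.
  apply: (can_inj (@tvecK _ _ _)); rewrite -ampl_tvec tvecB -ampl_tvec !untvecK.
  rewrite -defect_ampl' -ampl_adj (mulmxA _ H) (linfrac_h k0 k1 bV bU) mulmxBl mul1mx.
  by rewrite -(mulmxA _ F).
have e2 : D *m Uh = v *m x - Fx.
  apply: (can_inj (@tvecK _ _ _)); rewrite -ampl_tvec tvecB -ampl_tvec !untvecK.
  by rewrite -defect_ampl (mulmxA U) mulmxA linfrac_z mulmxBl.
have uD' := defect_unit' k1 hv; have iD := defect_intertwine' k0 k1 hv.
pose Phi m := \sum_(i < m.+1) hact (linfrac_fps u) X i x.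
have hPhi m := hact_linfrac_fps_sum k0 k1 hv X x m.
have htw m y : hact (twist u) X m y = D *m hact u X m (invmx D' *m y).
  exact: hact_mul.
move: e1 e2 iD uD' hPhi htw; rewrite -/Phi.
move: D D' => E E' e1 e2 iD uD' hPhi htw.
pose h s := invmx E' *m (x - v^t* *m Phi s).
pose z m := \sum_(i < m.+1) hact u X i (h (m - i)%N).
have PhiE m : Phi m = v *m x - E *m z m.
  by rewrite [LHS]hPhi mulmx_sumr; congr (_ - _); apply: eq_bigr => i _; rewrite htw.
pose zeta m := z m - Uh.
have dPhi m : Phi m - Fx = - (E *m zeta m).
  by rewrite PhiE mulmxBr e2 opprB addrAC.
have dh s : h s - hinf = v^t* *m zeta s.
  apply: (can_inj (mulKmx uD')); rewrite mulmxBr e1 /h mulKVmx // mulmxA iD -mulmxA.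
  by rewrite -[E *m _]opprK -dPhi mulmxN mulmxBr !opprB [LHS]addrC addrA subrK.
pose r m := \sum_(i < m.+1) hact u X i hinf - Uh.
have ez m : zeta m = r m + \sum_(i < m.+1) hact u X i (v^t* *m zeta (m - i)%N).
  rewrite /r addrAC -big_split /zeta /z; congr (_ - _); apply: eq_bigr => i _ /=.
  by rewrite -dh hactB addrC subrK.
have bva := bnd_adj k0 hv.
pose K := 2 * (1 + k) / (1 - k) ^+ 2.
have zsum N : \sum_(m < N) nn (zeta m) <= K * \sum_(m < N) nn (r m).
  apply: (absorb_sum k0 k1 (r := fun m : 'I_N => r m) (w := fun m : 'I_N => zeta m)
    (s := fun m : 'I_N => \sum_(i < m.+1) hact u X i (v^t* *m zeta (m - i)%N))).
    by move=> m; exact: ez.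
  apply: le_trans (toeplitz_rev N (fun s => v^t* *m zeta s) hX) _.
  by rewrite mulr_sumr; apply: ler_sum => m _; exact: bva.
(* r_m is minus the tail of the series of u at [hinf] beyond degree m. The geometric decay of the
   homogeneous parts makes these tails square summable, and then [zsum] does the same for zeta. *)
have [t [t0 t1 ht]] := hact_geometric hu hX.
have [B B0 hB] := geometric_tail (nn_ge0 hinf) t0 t1 (fun i => ht i hinf).
have hr m : nn (r m) <= t ^+ m * B.
  have Bm : t ^+ m.+1 * B <= t ^+ m * B.
    by rewrite exprS -mulrA; apply: ler_piMl; [apply: mulr_ge0 => //; rewrite exprn_ge0 // ltW | exact: ltW].
  apply: le_trans Bm.
  have cvU : (fun N => \sum_(i < N) hact u X i hinf) @ \oo --> Uh.
    apply/cvg_nnP => e e0.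
    have := cvu hX => /cvg_nnP hc.
    have c0 : 0 < (q * n)%:R * nn (tvec hinf) + 1 by rewrite ltr_wpDl // mulr_ge0 // nn_ge0.
    have := hc _ (divr_gt0 e0 c0); apply: filterS => N hN.
    have -> : nn (\sum_(i < N) hact u X i hinf - Uh) =
        nn ((series (fps_homog u X) N - fps_eval u X) *m tvec hinf).
      by rewrite -nn_tvec tvecB mulmxBl series_tvec untvecK.
    apply: le_trans (nn_mulmx_le _ _) _; rewrite mulrAC.
    apply: le_trans (ler_wpM2l _ hN) _; first by rewrite mulr_ge0 // nn_ge0.
    rewrite mulrCA; apply: ler_piMr; first exact: ltW.
    by rewrite ler_pdivrMr // mul1r lerDl.
  pose S N := \sum_(i < N) hact u X i hinf.
  apply: (@nn_lim_le _ _ _ _ \oo _ (fun N => S m.+1 - S N)).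
    apply/cvg_nnP => e e0; move/cvg_nnP/(_ e e0): cvU; apply: filterS => N hN.
    have -> : S m.+1 - S N - r m = - (S N - Uh).
      by rewrite /r -/(S m.+1) !opprB addrC addrA subrK.
    by rewrite nnN.
  near=> N.
  have mN : (m.+1 <= N)%N by near: N; exact: nbhs_infty_ge.
  rewrite -nnN opprB -(subnKC mN) /S big_split_ord /= addrAC subrr add0r.
  exact: hB.
have t1' : 0 < 1 - t by rewrite subr_gt0.
have K0 : 0 <= K.
  apply: divr_ge0; last exact: sqr_ge0.
  by apply: mulr_ge0 => //; apply: addr_ge0 => //; exact: ltW.
have gs (a b : nat -> R) : (forall m, b m <= t ^+ m * B) -> forall N,
    \sum_(m < N) a m <= K * \sum_(m < N) b m -> \sum_(m < N) a m <= K * (B / (1 - t)).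
  clearbody K; clear - K0 B0 t0 t1 t1' => hb N /le_trans; apply.
  apply: (ler_wpM2l K0); apply: (le_trans (ler_sum _ (fun (m : 'I_N) _ => hb m))).
  rewrite ler_pdivlMr // -mulr_suml mulrC mulrA -opprB mulNr -subrX1 opprB.
  by apply: ler_piMl => //; rewrite lerBlDr lerDl exprn_ge0 // ltW.
have zB N : \sum_(m < N) nn (zeta m) <= K * (B / (1 - t)).
  exact: (gs (fun m => nn (zeta m)) (fun m => nn (r m)) hr N (zsum N)).
(* The index is shifted because [Phi m] is the partial sum of m + 1 terms. *)
rewrite -cvg_shiftS; apply/cvg_nnP => e e0.
have c0 : 0 < p%:R * nn E + 1 by rewrite ltr_wpDl // mulr_ge0 // nn_ge0.
have := bounded_sum_cvg0 (divr_gt0 e0 c0) (fun m => nn_ge0 (zeta m)) zB.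
apply: filterS => m hm.
have -> : nn (series (fps_homog (linfrac_fps u) X) m.+1 *m tvec x - F *m tvec x) =
    nn (- (E *m zeta m)).
  by rewrite -dPhi -[RHS]nn_tvec tvecB series_tvec untvecK.
rewrite nnN; apply: le_trans (nn_mulmx_le _ _) _.
apply: le_trans (ler_wpM2l _ hm) _; first by rewrite mulr_ge0 // nn_ge0.
rewrite mulrCA; apply: ler_piMr; first exact: ltW.
by rewrite ler_pdivrMr // mul1r lerDl.
Unshelve. all: by end_near.
Qed.

End Convergence.

(** * Maps between pencil balls *)

Section Composition.
Variables (R : realType) (g g' : nat).
Local Notation C := (Cplx R).

Lemma nn_tens m n p q (A : 'M[C]_(m, n)) (B : 'M[C]_(p, q)) : nn (A *t B) = nn A * nn B.
Proof.
rewrite !nnE sum_mxtens mulr_suml; apply: eq_bigr => i _.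
rewrite mulr_sumr; apply: eq_bigr => s _; rewrite sum_mxtens mulr_suml.
apply: eq_bigr => j _; rewrite mulr_sumr; apply: eq_bigr => t _.
by rewrite tensmxE Normc.normcM exprMn.
Qed.

Lemma pencil_evalB p q (L' : pencil R g' p q) n (X Y : mxtuple R g' n) :
  pencil_eval L' X - pencil_eval L' Y = pencil_eval L' (fun j => X j - Y j).
Proof.
rewrite /pencil_eval -sumrB; apply: eq_bigr => j _.
by apply/matrixP => a b; rewrite !mxE mulrBr.
Qed.

Lemma pencil_eval_cvg p q (L' : pencil R g' p q) n (X : nat -> mxtuple R g' n) Y :
  (forall j, (fun N => X N j) @ \oo --> Y j) ->
  (fun N => pencil_eval L' (X N)) @ \oo --> pencil_eval L' Y.
Proof.
move=> h; apply/cvg_nnP => e e0.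
pose c := g'%:R * \sum_j nn (L' j) + 1.
have S0 : 0 <= \sum_j nn (L' j) by apply: sumr_ge0 => j _; exact: nn_ge0.
have c0 : 0 < c by rewrite ltr_wpDl // mulr_ge0.
have hj j : \forall N \near \oo, nn (X N j - Y j) <= e / c.
  by have /cvg_nnP := h j; apply; exact: divr_gt0.
apply: filterS (filter_forall _ hj) => N hN.
rewrite pencil_evalB /pencil_eval; apply: le_trans (nn_sum_le _) _.
apply: (@le_trans _ _ ((g'%:R * \sum_j nn (L' j)) * (e / c))).
  rewrite card_ord -mulrA mulr_suml; apply: ler_wpM2l => //; apply: ler_sum => j _.
  by rewrite nn_tens; apply: ler_wpM2l; [exact: nn_ge0 | exact: hN].
rewrite mulrCA; apply: ler_piMr; first exact: ltW.
by rewrite ler_pdivrMr // mul1r lerDl.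
Qed.

Definition comp_fps p q (L' : pencil R g' p q) (f : sfps_tuple R g g') : fps R g p q :=
  fun w => \sum_j f j w *: L' j.

Lemma comp_fps_homog p q (L' : pencil R g' p q) f n (X : mxtuple R g n) k :
  fps_homog (comp_fps L' f) X k = pencil_eval L' (fun j => sfps_homog (f j) X k).
Proof.
apply/matrixP => a b; case: (mxtens_indexP a) => i s; case: (mxtens_indexP b) => j t.
rewrite /fps_homog /pencil_eval !summxE.
transitivity (\sum_(w : k.-tuple 'I_g) \sum_(m < g') L' m i j * (f m w * word_eval X w s t)).
  apply: eq_bigr => w _; rewrite tensmxE /comp_fps summxE mulr_suml.
  by apply: eq_bigr => m _; rewrite !mxE -mulrA mulrCA.
rewrite exchange_big; apply: eq_bigr => m _ /=.
rewrite tensmxE /sfps_homog summxE mulr_sumr; apply: eq_bigr => w _.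
by rewrite !mxE.
Qed.

Lemma fps_eval0 p q (u : fps R g p q) n :
  fps_eval u ((fun=> 0) : mxtuple R g n) = ampl n (u [::]).
Proof.
apply: limn_nn; apply/cvg_nnP => e e0; near=> M.
have M0 : (0 < M)%N by near: M; exact: nbhs_infty_gt.
rewrite /series /= big_ltn // /fps_homog.
rewrite (sum_words0 (fun w => u w *t word_eval ((fun=> 0) : mxtuple R g n) w)) word_eval_nil.
rewrite addrAC subrr add0r big_nat big1 ?nn0 ?ltW // => -[|k] // _.
rewrite (sum_wordsS k (fun w => u w *t word_eval ((fun=> 0) : mxtuple R g n) w)).
by rewrite big1 // => j _; rewrite big1 // => w _; rewrite word_eval_cons mul0mx tensmx0.
Unshelve. all: by end_near.
Qed.

Variables (d' d : nat) (L : pencil R g d' d) (p q : nat) (L' : pencil R g' p q).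
Variable f : sfps_tuple R g g'.
Hypothesis hf : analytic_ball_map L L' f.

Lemma comp_fps_cvg n (X : mxtuple R g n) : pencil_ball L X ->
  series (fps_homog (comp_fps L' f) X) @ \oo --> comp_eval L' f X.
Proof.
move=> hX.
have -> : series (fps_homog (comp_fps L' f) X) =
    (fun N => pencil_eval L' (fun j => series (sfps_homog (f j) X) N)).
  apply/funext => N; apply: eq_mx_tvec => x; rewrite pencil_eval_tvec /series /=.
  rewrite mulmx_suml -[RHS]/(tvec _).
  transitivity (tvec (\sum_(0 <= k < N) \sum_j L' j *m x *m (sfps_homog (f j) X k)^T)).
    by rewrite tvec_sum; apply: eq_bigr => k _; rewrite comp_fps_homog pencil_eval_tvec.
  congr tvec; rewrite exchange_big; apply: eq_bigr => j _ /=.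
  by rewrite [(\sum_(_ <= _ < _) _)^T]raddf_sum mulmx_sumr.
by apply: pencil_eval_cvg => j; exact: (hf.1 j n X hX).
Qed.

Lemma comp_fps_eval n (X : mxtuple R g n) : pencil_ball L X ->
  fps_eval (comp_fps L' f) X = comp_eval L' f X.
Proof. by move=> hX; apply: limn_nn; exact: comp_fps_cvg. Qed.

Lemma comp_fps_contractive : ball_contractive L (comp_fps L' f).
Proof.
move=> n X hX; rewrite comp_fps_eval //; apply/opnorm_le1P; apply: ltW.
exact: hf.2.
Qed.

(** At the origin of size n = 1 the value of L' o f is its constant term, and that value lies in the
    open ball. *)
Lemma comp_const_strict : exists k, [/\ 0 < k, k < 1 & bnd k (comp_const L' f)].
Proof.
have h0 := pencil_ball0 L 1; have := hf.2 _ _ h0.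
rewrite -/(comp_fps L' f [::]) => h.
have : opnorm (comp_eval L' f ((fun=> 0) : mxtuple R g 1)) < 1 by exact: h.
rewrite -comp_fps_eval // fps_eval0 => {h}.
move=> /opnorm_lt1P[k [k0 k1 h]]; exists k; split=> //.
by apply: bnd_col => x; have := h _ (tvec x); rewrite ampl_tvec !nn_tvec.
Qed.

End Composition.

(** * Boundary values *)

Section AlmostEverywhere.
Variables (R : realType) (P Q : R -> Prop).
Hypothesis aeP : {ae (@lebesgue_measure R), forall t, P t}.

Lemma ae_mono : (forall t, P t -> Q t) -> {ae (@lebesgue_measure R), forall t, Q t}.
Proof.
move=> hPQ.
exact: (@filterS _ _ (ae_filter_ringOfSetsType (@lebesgue_measure R)) _ _ hPQ aeP).
Qed.

Lemma ae_ex : exists t, P t.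
Proof.
have T0 : (0 < @lebesgue_measure R [set: R])%E.
  apply: (@lt_le_trans _ _ (@lebesgue_measure R `[0, 1]%classic)); last first.
    by apply: le_measure; rewrite ?inE //; exact: measurableT.
  by rewrite lebesgue_measure_itv /= lte_fin ltr01 oppr0 adde0 lte_fin.
exact: (@filter_ex _ _ (ae_properfilter_algebraOfSetsType T0) _ aeP).
Qed.

End AlmostEverywhere.

Section Boundary.
Variables (R : realType) (g d' d : nat) (L : pencil R g d' d).
Local Notation C := (Cplx R).

Lemma normc_polar (r t : R) : Normc.normc (polar r t) = `|r|.
Proof.
by rewrite /Normc.normc /polar !exprMn -mulrDr cos2Dsin2 mulr1 sqrtr_sqr.
Qed.

Lemma pencil_ball_polar n (X : mxtuple R g n) (r t : R) : bnd 1 (pencil_eval L X) ->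
  0 < r -> r < 1 -> pencil_ball L (fun j => polar r t *: X j).
Proof.
move=> hX r0 r1; apply/pencil_ballP; exists (r ^+ 2 * 1); split.
- by rewrite mulr1 exprn_gt0.
- by rewrite mulr1 expr_lt1 // ltW.
by have := bnd_pencilZ (polar r t) hX; rewrite normc_polar real_normK ?num_real.
Qed.

(** If F_V(Y) were a strict contraction, so would be F_V(F_V(Y)) = Y. *)
Lemma linfrac_opnorm1 p q (V Y : 'M[C]_(p, q)) k : 0 < k -> k < 1 -> bnd k V ->
  opnorm Y = 1 -> opnorm (linfrac V Y) = 1.
Proof.
move=> k0 k1 hV /opnorm_eq1_bnd[Y1 hY].
apply: opnorm_eq1; first exact: (linfrac_bnd1 k0 k1 hV Y1).
move=> k' /andP[k'0 k'1] h.
have [k'' [k''0 k''1]] := linfrac_strict k0 k1 hV (linfrac_bnd1 k0 k1 hV Y1) k'0 k'1 h.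
by rewrite (linfracK k0 k1 hV Y1) => h''; apply: (hY k'') => //; rewrite k''0.
Qed.

(** The Lipschitz bound holds up to norm one, so for each t a radial limit Y of F becomes the radial
    limit F_V(Y) of G. *)
Lemma linfrac_bdry n p q (V : 'M[C]_(p, q)) k (F G : mxtuple R g n -> 'M[C]_(p, q))
    (X : mxtuple R g n) : 0 < k -> k < 1 -> bnd k V ->
  (forall X, pencil_ball L X -> bnd 1 (F X)) ->
  (forall X, pencil_ball L X -> G X = linfrac V (F X)) ->
  pencil_bdry L X -> bdry_norm1 F X -> bdry_norm1 G X.
Proof.
move=> k0 k1 hV F1 GF hX /ae_mono; apply => t [Y hY Y1].
have bX : bnd 1 (pencil_eval L X) by have [] := opnorm_eq1_bnd hX.
exists (linfrac V Y); last exact: (linfrac_opnorm1 k0 k1 hV).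
have [c c0 hc] := linfrac_lipschitz k0 k1 hV.
apply/cvg_nnP => e e0.
have c1 : 0 < c + 1 by rewrite ltr_wpDl.
move/cvg_nnP/(_ _ (divr_gt0 e0 c1)): hY => hY; near=> r.
have hr : nn (F (fun j => polar r t *: X j) - Y) <= e / (c + 1) by near: r.
have hb : pencil_ball L (fun j => polar r t *: X j).
  have r0 : 0 < r by near: r; exact: nbhs_left_gt.
  have r1 : r < 1 by near: r; exact: nbhs_left_lt.
  exact: pencil_ball_polar.
rewrite GF //; have bY : bnd 1 Y by have [] := opnorm_eq1_bnd Y1.
apply: le_trans (hc _ _ (F1 _ hb) bY) _.
apply: le_trans (ler_wpM2l c0 hr) _.
rewrite mulrCA; apply: ler_piMr; first exact: ltW.
by rewrite ler_pdivrMr // mul1r lerDl.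
Unshelve. all: by end_near.
Qed.

End Boundary.

(** * Open balls, closed balls and minimality *)

Section ClosedBalls.
Variables (R : realType) (g : nat).
Local Notation C := (Cplx R).

Lemma dilation_le (a b : R) : 0 <= b -> (forall c, 0 < c < 1 -> c ^+ 2 * a <= b) -> a <= b.
Proof.
move=> b0 h; rewrite leNgt; apply/negP => ba.
have a0 : 0 < a by exact: le_lt_trans ba.
(* c^2 a is the midpoint of a and b, which still exceeds b. *)
pose c := Num.sqrt ((a + b) / (2 * a)).
have c2 : c ^+ 2 = (a + b) / (2 * a) by rewrite sqr_sqrtr // divr_ge0; lra.
have := h c; rewrite c2 invfM mulrA mulfVK ?gt_eqF //.
have -> : 0 < c < 1.
  rewrite sqrtr_gt0 divr_gt0 /=; [|lra|lra].
  by rewrite -sqrtr1 ltr_sqrt // ltr_pdivrMr; lra.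
by move=> /(_ isT); lra.
Qed.

Variables (p q : nat) (L : pencil R g p q).

Lemma pball_nn n (X : 'I_g -> 'M[C]_n) :
  pball L X <-> forall x, nn (\sum_j L j *m x *m X j) <= nn x.
Proof.
have -> : X = fun j => ((X j)^T)^T by apply/funext => j; rewrite trmxK.
rewrite -(pball_opnorm L (fun j => (X j)^T)) opnorm_le1P bnd_lact.
by split=> h x; have := h x; rewrite mul1r.
Qed.

Lemma pball_bnd n (X : 'I_g -> 'M[C]_n) :
  pball L X <-> bnd 1 (pencil_eval L (fun j => (X j)^T)).
Proof.
have e : (fun j => ((X j)^T)^T) = X by apply/funext => j; rewrite trmxK.
by rewrite -opnorm_le1P pball_opnorm e.
Qed.

Variables (n : nat) (X : mxtuple R g n).

Lemma lactZ (c : C) x : lact L (fun j => c *: X j) x = c *: lact L X x.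
Proof.
rewrite /lact scaler_sumr; apply: eq_bigr => j _.
by rewrite linearZ /= -scalemxAr.
Qed.

Lemma pencil_ball_bnd1 : pencil_ball L X -> bnd 1 (pencil_eval L X).
Proof. by move=> /pencil_ballP[k [_ /ltW k1]]; exact: bnd_le. Qed.

Lemma pencil_ball_dilate c : bnd 1 (pencil_eval L X) -> 0 < c < 1 ->
  pencil_ball L (fun j => rc c *: X j).
Proof.
move=> hX /andP[c0 c1]; apply/pencil_ballP; exists (c ^+ 2 * 1); split.
- by rewrite mulr1 exprn_gt0.
- by rewrite mulr1 expr_lt1 // ltW.
by have := bnd_pencilZ (rc c) hX; rewrite normc_rc real_normK ?num_real.
Qed.

Lemma bnd1_dilate : (forall c, 0 < c < 1 -> bnd 1 (pencil_eval L (fun j => rc c *: X j))) ->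
  bnd 1 (pencil_eval L X).
Proof.
move=> h; apply/bnd_lact => x; rewrite mul1r; apply: dilation_le => [|c hc].
  exact: nn_ge0.
by have /bnd_lact/(_ x) := h c hc; rewrite lactZ nnZr mul1r.
Qed.

Lemma pencil_ball_shrink r : 1 < r -> bnd 1 (pencil_eval L (fun j => rc r *: X j)) ->
  pencil_ball L X.
Proof.
move=> r1 /bnd_lact h; apply/pencil_ballP; exists (r ^- 2).
have r0 : 0 < r by lra.
have r20 : 0 < r ^+ 2 by exact: exprn_gt0.
split; first by rewrite invr_gt0.
  by rewrite invf_lt1 // exprn_egt1.
by apply/bnd_lact => x; have := h x; rewrite lactZ nnZr mul1r ler_pdivlMl.
Qed.

End ClosedBalls.

Section SameBall.
Variables (R : realType) (g : nat).
Local Notation C := (Cplx R).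
Variables (p' p : nat) (A : pencil R g p' p) (q' q : nat) (B : pencil R g q' q).

Lemma same_ball_bnd1 n (X : mxtuple R g n) : same_ball A B ->
  bnd 1 (pencil_eval A X) -> bnd 1 (pencil_eval B X).
Proof.
move=> AB hA; apply: bnd1_dilate => c hc; apply: pencil_ball_bnd1.
by rewrite -(AB n); exact: pencil_ball_dilate.
Qed.

Lemma pball_same_ball : (forall n (X : 'I_g -> 'M[C]_n), pball A X -> pball B X) ->
  forall n (X : mxtuple R g n), pencil_ball A X -> pencil_ball B X.
Proof.
move=> h n X /pencil_ball_scale[r r1 hr]; apply: (pencil_ball_shrink r1).
have := h n (fun j => (rc r *: X j)^T).
rewrite -!pball_opnorm !opnorm_le1P; apply; exact: pencil_ball_bnd1.
Qed.

(** A tuple killed by B stays in the ball of B under every dilation, hence in that of A, and this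
    forces A(X) = 0. *)
Lemma nondegenerate_pball : nondegenerate_pencil A ->
  (forall n (X : 'I_g -> 'M[C]_n), pball B X -> pball A X) -> nondegenerate_pencil B.
Proof.
move=> nA h n X eB; apply: nA; apply: eq_mx_tvec => x; rewrite mul0mx.
apply/nn_eq0/le_anti; rewrite nn_ge0 andbT leNgt; apply/negP => a0.
pose b := (nn x + 1) / nn (pencil_eval A X *m tvec x).
have b0 : 0 < b by rewrite divr_gt0 // ltr_wpDl // nn_ge0.
pose c := Num.sqrt b.
have hB : bnd 1 (pencil_eval B (fun j => rc c *: X j)).
  by move=> m y; rewrite pencil_evalZ eB scaler0 mul0mx nn0 mul1r nn_ge0.
have /h := (pball_opnorm B (fun j => rc c *: X j)).1 ((opnorm_le1P _).2 hB).
move=> /pball_opnorm/opnorm_le1P/(_ _ (tvec x)).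
have c2 : c ^+ 2 * nn (pencil_eval A X *m tvec x) = nn x + 1.
  by rewrite sqr_sqrtr ?(ltW b0) // divfK // gt_eqF.
by rewrite pencil_evalZ -scalemxAl nnZr c2 nn_tvec mul1r gerDl ler10.
Qed.

End SameBall.

Section Minimality.
Variables (R : realType) (g : nat).
Local Notation C := (Cplx R).

(** A pencil without rows or without columns kills the tuple of identities, which is nonzero as g >
    0. *)
Lemma nondegenerate_gt0 p' p (A : pencil R g p' p) : (0 < g)%N ->
  nondegenerate_pencil A -> (0 < p')%N /\ (0 < p)%N.
Proof.
case: g A => // g1 A _ nA.
suff nz : (p' * p)%N != 0%N by move: nz; rewrite muln_eq0 negb_or -!lt0n => /andP.
apply/eqP => z.
have A0 j : A j = 0.
  apply/matrixP => a b; have ha := leq_ltn_trans (leq0n a) (ltn_ord a).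
  have hb := leq_ltn_trans (leq0n b) (ltn_ord b).
  by move: (muln_gt0 p' p); rewrite z ha hb.
have /(_ 1%N (fun=> 1%:M)) := nA; rewrite /pencil_eval big1 => [|j _]; last first.
  by rewrite A0; apply/matrixP => a b; rewrite !mxE mul0r.
by move=> /(_ erefl ord0)/eqP; rewrite oner_eq0.
Qed.

Lemma minimal_ball_minimal p' p (A : pencil R g p' p) : minimal_pencil A -> ball_minimal A.
Proof.
move=> [nA minA] r' r B BA; apply: (minA _ _ B).
  by apply: (nondegenerate_pball nA) => n X /BA.
move=> n; apply/seteqP; split=> X.
  by apply: pball_same_ball => m Y /BA.
by apply: pball_same_ball => m Y /BA.
Qed.

End Minimality.

(** * Pencil ball maps fixing the origin *)

Section LinearPart.
Variables (R : realType) (g d' d : nat) (L : pencil R g d' d).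
Local Notation C := (Cplx R).
Variables (p q : nat) (phi : fps R g p q).
Hypothesis hphi : pencil_ball_map L phi.
Hypothesis phi0 : phi [::] = 0.

Definition linear_part : pencil R g p q := fun j => phi [:: j].

Lemma pencil_ball_map_contractive : ball_contractive L phi.
Proof. by move=> n X /hphi.1.2/opnorm_le1P. Qed.

Lemma hact1 n (X : mxtuple R g n) x : hact phi X 1 x = lact linear_part X x.
Proof.
rewrite /hact (sum_wordsS 0 (fun w => phi w *m x *m (word_eval X w)^T)).
apply: eq_bigr => j _.
rewrite (sum_words0 (fun w => phi (j :: w) *m x *m (word_eval X (j :: w))^T)).
by rewrite word_eval_cons word_eval_nil mulmx1.
Qed.

Lemma linear_part_bnd1 n (X : mxtuple R g n) :
  bnd 1 (pencil_eval L X) -> bnd 1 (pencil_eval linear_part X).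
Proof.
move=> hX; apply: bnd1_dilate => c hc; apply/bnd_lact => x; rewrite -hact1 mul1r.
apply: (hact_contraction pencil_ball_map_contractive).
exact: pencil_ball_dilate.
Qed.

Lemma shift_tupleZ n N (X : mxtuple R g n) (c : C) :
  (fun j => c *: shift_tuple N (fun=> X) j) = shift_tuple N (fun=> (fun j => c *: X j)).
Proof.
apply/funext => j; rewrite /shift_tuple scaler_sumr; apply: eq_bigr => s _.
by rewrite -scalemxAr -scalemxAl.
Qed.

Lemma fps_eval_shift2 n (X : mxtuple R g n) k :
  bnd k (pencil_eval linear_part X) -> 0 <= k ->
  bnd k (fps_eval phi (shift_tuple 2 (fun=> X))).
Proof.
move=> /bnd_lact hX k0; apply: bnd_tvec => y; have [x ->] := packP y.
rewrite fps_eval_shift nn_tvec !nn_pack !big_ord_recl !big_ord0 !addr0 /=.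
rewrite !hact_along_cst subnn !hact0 !phi0 !mul0mx nn0 add0r addr0 hact1.
apply: le_trans (hX _) _; apply: ler_wpM2l => //.
by rewrite lerDl nn_ge0.
Qed.

(** If L(X) had norm s > 1, the block shift of X / s would lie on the boundary of the ball of L. But
    phi has norm at most 1 / s at all its radial dilates, so no boundary value there has norm 1; a
    single t gives the contradiction. *)
Lemma linear_part_bnd1_inv n (X : mxtuple R g n) :
  bnd 1 (pencil_eval linear_part X) -> bnd 1 (pencil_eval L X).
Proof.
move=> hM; apply/opnorm_le1P; rewrite leNgt; apply/negP => gt1.
pose s := opnorm (pencil_eval L X).
have s0 : 0 < s by exact: lt_trans ltr01 gt1.
have hs : bnd (s ^+ 2) (pencil_eval L X) by apply/opnorm_leP; [exact: ltW | exact: lexx].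
pose X' : mxtuple R g n := fun j => rc s^-1 *: X j.
have s2 : s ^- 2 < 1 by rewrite invf_lt1 ?exprn_gt0 // exprn_egt1.
have s2' : 0 < s ^- 2 by rewrite invr_gt0 exprn_gt0.
have nsi : Normc.normc (rc s^-1) ^+ 2 = s ^- 2.
  by rewrite normc_rc real_normK ?num_real // exprVn.
have X1 : bnd 1 (pencil_eval L X').
  have := bnd_pencilZ (rc s^-1) hs; rewrite nsi mulVf //.
  by rewrite expf_neq0 // gt_eqF.
have X1' k : 0 < k < 1 -> ~ bnd k (pencil_eval L X').
  move=> /andP[k0 k1] h.
  have := bnd_pencilZ (rc s) h.
  have -> : (fun j => rc s *: X' j) = X.
    apply/funext => j; rewrite /X' scalerA -rcM divff ?gt_eqF //.
    by rewrite -[RHS]scale1r.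
  rewrite normc_rc real_normK ?num_real // => h'.
  have : s <= s * Num.sqrt k.
    apply/opnorm_leP; first by rewrite mulr_ge0 ?sqrtr_ge0 // ltW.
    by rewrite exprMn sqr_sqrtr // ltW.
  rewrite ler_pMr // => h1; move: k1.
  by rewrite -(sqr_sqrtr (ltW k0)) ltNge exprn_ege1.
pose Y := shift_tuple 2 (fun=> X').
have hY : pencil_bdry L Y.
  apply: opnorm_eq1; first by apply: bnd_shift.
  by move=> k hk /bnd_shift_inv; exact: X1'.
have [t [Z hZ Z1]] := ae_ex (hphi.2 _ _ hY).
have [_ /(_ (s ^- 2))] := opnorm_eq1_bnd Z1; apply; first by rewrite s2'.
apply: (bnd_lim _ hZ); near=> r.
have r0 : 0 < r by near: r; exact: nbhs_left_gt.
have r1 : r < 1 by near: r; exact: nbhs_left_lt.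
rewrite shift_tupleZ; apply: fps_eval_shift2; last exact: ltW.
have h1 : bnd (s ^- 2) (pencil_eval linear_part X').
  by have := bnd_pencilZ (rc s^-1) hM; rewrite nsi mulr1.
apply: (bnd_le _ (bnd_pencilZ (polar r t) h1)).
rewrite normc_polar real_normK ?num_real //; apply: ler_piMl; first exact: ltW.
by rewrite expr_le1 // ltW.
Unshelve. all: by end_near.
Qed.

Lemma linear_part_pball n (X : 'I_g -> 'M[C]_n) : pball linear_part X <-> pball L X.
Proof.
rewrite !pball_bnd; split; [exact: linear_part_bnd1_inv | exact: linear_part_bnd1].
Qed.

End LinearPart.

(** * Tuples that isolate one word *)

Section WordPaths.
Variables (R : realType) (g : nat).
Local Notation C := (Cplx R).

Lemma nn_col_mx m1 m2 n (a : 'M[C]_(m1, n)) (b : 'M[C]_(m2, n)) :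
  nn (col_mx a b) = nn a + nn b.
Proof.
rewrite !nnE big_split_ord; congr (_ + _); apply: eq_bigr => i _; apply: eq_bigr => j _.
  by rewrite col_mxEu.
by rewrite col_mxEd.
Qed.

(** Scalar tuples spelling w from its right end, the direction in which [word_eval_along] counts.
    Beyond the end of w the default of [nth] gives delta to every letter; [letter_at_bnd] covers
    those positions too. *)
Definition letter_at n (delta : R) (w : word g) (s : nat) : mxtuple R g n :=
  fun j => if nth j (rev w) s == j then (rc delta)%:M else 0.

Lemma word_eval_along_path n (Xs : nat -> mxtuple R g n) t delta w v :
  size v = size w -> (forall s, (s < size w)%N -> Xs (t + s)%N = letter_at n delta w s) ->
  word_eval_along Xs t v = if v == w then (rc (delta ^+ size w))%:M else 0.
Proof.
elim: w v => [|i w IH] [|j v] //= [sv] hX; have IHv := IH v sv.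
rewrite IHv => [|s sw]; last first.
  rewrite hX ?(ltn_trans sw) //; apply/funext => j'.
  by rewrite /letter_at rev_cons nth_rcons size_rev sw.
rewrite sv hX // /letter_at rev_cons nth_rcons size_rev ltnn eqxx.
rewrite eqseq_cons eq_sym; case: eqP => _ /=; last by rewrite mul0mx.
case: eqP => _; last by rewrite mulmx0.
by rewrite mul_scalar_mx scale_scalar_mx -rcM exprS.
Qed.

Lemma word_eval_along_cat n (Xs : nat -> mxtuple R g n) t u v :
  word_eval_along Xs t (u ++ v) = word_eval_along Xs (t + size v)%N u *m word_eval_along Xs t v.
Proof.
elim: u => [|j u IH] /=; first by rewrite mul1mx.
by rewrite IH size_cat -mulmxA addnA addnAC.
Qed.

Variables (p q : nat) (f : fps R g p q) (n : nat).
Implicit Types (Xs : nat -> mxtuple R g n) (x : 'M[C]_(q, n)).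

Lemma hact_along0 Xs t k : hact_along f Xs t k 0 = 0.
Proof. by rewrite /hact_along big1 // => w _; rewrite mulmx0 mul0mx. Qed.

Lemma hact_along1 Xs t x : hact_along f Xs t 1 x = \sum_j f [:: j] *m x *m (Xs t j)^T.
Proof.
rewrite /hact_along (sum_wordsS 0 (fun w => f w *m x *m (word_eval_along Xs t w)^T)).
apply: eq_bigr => j _.
rewrite (sum_words0 (fun w => f (j :: w) *m x *m (word_eval_along Xs t (j :: w))^T)) /=.
by rewrite addn0 mulmx1.
Qed.

(** The path begins one step after t, so only the rightmost letter, met at t, remains free. *)
Lemma hact_along_rcons Xs t delta (w : word g) x :
  (forall s, (s < size w)%N -> Xs (t + 1 + s)%N = letter_at n delta w s) ->
  hact_along f Xs t (size w).+1 x =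
  rc (delta ^+ size w) *: \sum_j f (w ++ [:: j]) *m x *m (Xs t j)^T.
Proof.
move=> hX; rewrite -addn1 /hact_along.
rewrite (sum_words_cat (size w) 1 (fun w => f w *m x *m (word_eval_along Xs t w)^T)).
rewrite (bigD1 (in_tuple w)) //= [X in _ + X]big1 ?addr0 => [|u uw]; last first.
  apply: big1 => v _; rewrite word_eval_along_cat size_tuple.
  rewrite (word_eval_along_path _ hX) ?size_tuple //.
  by rewrite -[_ == w]/(u == in_tuple w) (negbTE uw) mul0mx trmx0 mulmx0.
rewrite (sum_wordsS 0 (fun v => f (w ++ v) *m x *m (word_eval_along Xs t (w ++ v))^T)).
rewrite scaler_sumr; apply: eq_bigr => j _.
rewrite (sum_words0 (fun v => f (w ++ j :: v) *m x *m (word_eval_along Xs t (w ++ j :: v))^T)).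
rewrite word_eval_along_cat /= (word_eval_along_path _ hX) // eqxx mulmx1 addn0.
by rewrite mul_scalar_mx linearZ -scalemxAr.
Qed.

(** Here the path comes first, and the leftmost letter, met at t + |w|, remains free. *)
Lemma hact_along_cons Xs t delta (w : word g) x :
  (forall s, (s < size w)%N -> Xs (t + s)%N = letter_at n delta w s) ->
  hact_along f Xs t (size w).+1 x =
  rc (delta ^+ size w) *: \sum_j f (j :: w) *m x *m (Xs (t + size w)%N j)^T.
Proof.
move=> hX; rewrite /hact_along.
rewrite (sum_wordsS (size w) (fun w => f w *m x *m (word_eval_along Xs t w)^T)).
rewrite scaler_sumr; apply: eq_bigr => j _ /=.
rewrite (bigD1 (in_tuple w)) //= [X in _ + X]big1 ?addr0 => [|u uw]; last first.
  rewrite (word_eval_along_path _ hX) ?size_tuple //.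
  by rewrite -[_ == w]/(u == in_tuple w) (negbTE uw) mulmx0 trmx0 mulmx0.
rewrite (word_eval_along_path _ hX) // eqxx.
by rewrite mul_mx_scalar linearZ -scalemxAr.
Qed.

End WordPaths.

Lemma letter_at_bnd (R : realType) (g p q : nat) (L : pencil R g p q) :
  exists2 delta : R, 0 < delta &
    forall n w s, bnd 2^-1 (pencil_eval L (letter_at n delta w s)).
Proof.
pose K := g%:R * \sum_j q%:R * nn (L j).
have S0 : 0 <= \sum_j q%:R * nn (L j).
  by apply: sumr_ge0 => j _; apply: mulr_ge0 => //; exact: nn_ge0.
have K0 : 0 <= K by apply: mulr_ge0.
pose c := (2 * (K + 1))^-1.
have c0 : 0 < c by rewrite invr_gt0; lra.
have cK : c * K <= 2^-1 by rewrite ler_pdivrMl; lra.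
clearbody c; exists (Num.sqrt c); first by rewrite sqrtr_gt0.
move=> n w s; apply/bnd_lact => x; rewrite /lact.
apply: le_trans (nn_sum_le _) _; rewrite card_ord.
apply: (@le_trans _ _ (c * K * nn x)); last first.
  by apply: ler_wpM2r => //; exact: nn_ge0.
rewrite /K mulrCA -mulrA; apply: ler_wpM2l => //.
rewrite mulr_sumr mulr_suml; apply: ler_sum => j _.
have h0 : 0 <= c * (q%:R * nn (L j)) * nn x.
  by rewrite !mulr_ge0 ?nn_ge0 // ltW.
rewrite /letter_at; case: eqP => _; last by rewrite trmx0 mulmx0 nn0.
rewrite tr_scalar_mx mul_mx_scalar nnZr sqr_sqrtr; last exact: ltW.
rewrite -mulrA; apply: ler_wpM2l; first exact: ltW.
exact: nn_mulmx_le.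
Qed.

Section HigherCoefficients.
Variables (R : realType) (g d' d : nat) (L : pencil R g d' d).
Local Notation C := (Cplx R).
Variables (q' q : nat) (phi : fps R g q' q).
Hypothesis hphi : ball_contractive L phi.
Hypothesis phi0 : phi [::] = 0.
Variables (p' p : nat) (A : 'I_g -> 'M[C]_(p', p)).
Hypotheses (p'0 : (0 < p')%N) (p0 : (0 < p)%N) (minA : ball_minimal A).
Hypothesis AL : forall n (X : 'I_g -> 'M[C]_n), pball A X -> pball L X.
Variables (W' : 'M[C]_(q', p')) (W : 'M[C]_(q, p)).
Hypothesis hW : intertwines (linear_part phi) A W' W.
Hypotheses (isoW' : W'^t* *m W' = 1%:M) (isoW : W^t* *m W = 1%:M).

Let sum_ge2 N (a : nat -> R) : (forall m, 0 <= a m) -> (1 < N)%N ->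
  a 1%N + a N <= \sum_(m < N.+1) a m.
Proof.
move=> a0 N1; rewrite big_ord_recr /= lerD2r.
by rewrite (bigD1 (Ordinal N1)) //= lerDl; apply: sumr_ge0 => m _; exact: a0.
Qed.

Let sum_col_mx m1 m2 n (F : 'I_g -> 'M[C]_(m1, n)) (G : 'I_g -> 'M[C]_(m2, n)) :
  \sum_j col_mx (F j) (G j) = col_mx (\sum_j F j) (\sum_j G j).
Proof. by elim/big_rec3: _ => [|j x y z _ ->]; rewrite ?col_mx0 ?add_col_mx. Qed.

Let rcc_tr n c (Y : 'M[C]_n) : (rc c *: Y^T)^T = rc c *: Y.
Proof. by rewrite linearZ /= trmxK. Qed.

Lemma bnd_scaled_tr n c (X : 'I_g -> 'M[C]_n) : pball A X ->
  bnd (Num.max (c ^+ 2) 2^-1) (pencil_eval L (fun j => rc c *: (X j)^T)).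
Proof.
move=> /AL/pball_bnd hX.
have := bnd_pencilZ (rc c) hX; rewrite normc_rc real_normK ?num_real // mulr1.
by apply: bnd_le; rewrite le_max lexx.
Qed.

Lemma max_lt1 (c : R) : 0 < c < 1 -> Num.max (c ^+ 2) 2^-1 < 1.
Proof.
move=> /andP[c0 c1]; rewrite gt_max expr_lt1 ?ltW //= c1 /=.
by rewrite invf_lt1 ?ltr1n.
Qed.

(** W x enters at block 0, meets X first and then the path w. Block 1 of the output is W' sum_j A_j
    x X_j and block |w| + 1 is sum_j T_j x X_j, up to the factor c < 1 that puts X into the open
    ball; |w| > 0 keeps these blocks distinct. *)
Lemma higher_coef_mulr w j : (0 < size w)%N -> phi (w ++ [:: j]) *m W = 0.
Proof.
move=> w0; have [delta dl0 hdl] := letter_at_bnd L.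
pose T i := rc (delta ^+ size w) *: (phi (w ++ [:: i]) *m W).
suff : T j = 0.
  move/(congr1 (fun M => rc (delta ^- size w) *: M)).
  rewrite scaler0 scalerA -rcM mulVf; last by rewrite expf_neq0 // gt_eqF.
  by rewrite [rc 1 *: _]scale1r.
move: j; apply: (column_vanishes p'0 p0 minA) => n X hX; apply/pball_nn => x.
apply: dilation_le => [|c hc]; first exact: nn_ge0.
pose Xs s : mxtuple R g n :=
  if s is s'.+1 then letter_at n delta w s' else fun i => rc c *: (X i)^T.
pose xs s := if s is 0%N then W *m x else 0.
have hXs s : bnd (Num.max (c ^+ 2) 2^-1) (pencil_eval L (Xs s)).
  case: s => [|s]; first exact: bnd_scaled_tr.
  by apply: bnd_le (hdl n w s); rewrite le_max lexx orbT.
have := along_contraction hphi (size w).+2 xs (max_lt1 hc) hXs.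
have -> : \sum_(s < (size w).+2) nn (xs s) = nn x.
  rewrite big_ord_recl big1 ?addr0 => [|s _]; last exact: nn0.
  by rewrite /xs /= nn_isom.
apply: le_trans.
pose a m := nn (hact_along phi Xs 0 m (W *m x)).
have -> : \sum_(m < (size w).+2) nn (\sum_(s < m.+1) hact_along phi Xs s (m - s)%N (xs s)) =
    \sum_(m < (size w).+2) a m.
  apply: eq_bigr => m _; rewrite /a big_ord_recl subn0 big1 ?addr0 // => s _.
  by rewrite /xs /= hact_along0.
apply: le_trans (@sum_ge2 (size w).+1 a (fun m => nn_ge0 _) w0).
rewrite /a hact_along1 (hact_along_rcons phi (delta := delta)) //=.
have -> : \sum_j col_mx (A j) (T j) *m x *m X j =
    col_mx (\sum_j A j *m x *m X j) (\sum_j T j *m x *m X j).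
  under eq_bigr do rewrite !mul_col_mx.
  exact: sum_col_mx.
rewrite nn_col_mx mulrDr; apply: lerD; rewrite -nnZr le_eqVlt; apply/orP; left; apply/eqP.
  rewrite -(nn_isom _ isoW'); congr nn; rewrite -scalemxAr mulmx_sumr scaler_sumr.
  apply: eq_bigr => j _; rewrite rcc_tr -scalemxAr; congr (_ *: _).
  by have [e _] := hW j; rewrite [phi _ *m (W *m x)]mulmxA [phi _ *m W]e !mulmxA.
congr nn; rewrite !scaler_sumr; apply: eq_bigr => j _.
rewrite rcc_tr -scalemxAr scalerA mulrC -scalerA; congr (_ *: _).
by rewrite /T -!scalemxAl mulmxA.
Qed.

(** The dual arrangement: y enters at block 0 and runs through w, W x enters at block |w|, and both
    meet X in the last step. As |w| > 0, the inputs sit in different blocks and their squared norms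
    add up. *)
Lemma higher_coef_mull w j : (0 < size w)%N -> W'^t* *m phi (j :: w) = 0.
Proof.
move=> w0; have [delta dl0 hdl] := letter_at_bnd L.
pose k := size w.
pose T i := rc (delta ^+ k) *: (W'^t* *m phi (i :: w)).
suff : T j = 0.
  move/(congr1 (fun M => rc (delta ^- k) *: M)).
  rewrite scaler0 scalerA -rcM mulVf; last by rewrite expf_neq0 // gt_eqF.
  by rewrite [rc 1 *: _]scale1r.
move: j; apply: (row_vanishes p'0 p0 minA) => n X hX; apply/pball_nn => x0.
rewrite -[x0]vsubmxK; move: (usubmx x0) (dsubmx x0) => x y {x0}.
apply: dilation_le => [|c hc]; first exact: nn_ge0.
pose Xs s : mxtuple R g n :=
  if s == k then fun i => rc c *: (X i)^T else letter_at n delta w s.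
pose xs s := if s == 0%N then y else if s == k then W *m x else 0.
have hXs s : bnd (Num.max (c ^+ 2) 2^-1) (pencil_eval L (Xs s)).
  rewrite /Xs; case: eqP => _; first exact: bnd_scaled_tr.
  by apply: bnd_le (hdl n w s); rewrite le_max lexx orbT.
have := along_contraction hphi k.+2 xs (max_lt1 hc) hXs.
have k0 : k != 0%N by rewrite -lt0n.
have k2 : (k < k.+2)%N by rewrite ltnS.
have -> : \sum_(s < k.+2) nn (xs s) = nn (col_mx x y).
  rewrite (bigD1 ord0) //= (bigD1 (Ordinal k2)) //= big1 ?addr0 => [|s /andP[s0 sk]].
    by rewrite /xs /= (negbTE k0) eqxx nn_isom // nn_col_mx addrC.
  by rewrite /xs (negbTE (s0 : (s != 0 :> nat))) (negbTE (sk : (s != k :> nat))) nn0.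
apply: le_trans.
rewrite big_ord_recr /=; apply: ler_wpDl; first by apply: sumr_ge0 => m _; exact: nn_ge0.
have -> : \sum_(s < k.+2) hact_along phi Xs s (k.+1 - s)%N (xs s) =
    hact_along phi Xs 0 k.+1 y + hact_along phi Xs k 1 (W *m x).
  rewrite (bigD1 ord0) //= (bigD1 (Ordinal k2)) //= big1 ?addr0 => [|s /andP[s0 sk]].
    by rewrite /xs /= (negbTE k0) eqxx subSnn.
  rewrite /xs (negbTE (s0 : (s != 0 :> nat))) (negbTE (sk : (s != k :> nat))).
  exact: hact_along0.
have hpath s : (s < size w)%N -> Xs (0 + s)%N = letter_at n delta w s.
  by rewrite add0n /Xs => sw; rewrite ltn_eqF.
rewrite hact_along1 (hact_along_cons phi _ hpath) -/k /=.
have bW m (z : 'M[C]_(q', m)) : nn (W'^t* *m z) <= nn z.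
  by rewrite -[leRHS]mul1r; apply: bnd_adj => // r t; rewrite mul1r nn_isom.
apply: le_trans (bW _ _); rewrite -nnZr le_eqVlt; apply/orP; left; apply/eqP.
congr nn.
have -> : W'^t* *m (rc (delta ^+ k) *: \sum_j phi (j :: w) *m y *m (Xs k j)^T +
    \sum_j phi [:: j] *m (W *m x) *m (Xs k j)^T) =
  \sum_j (W'^t* *m (rc (delta ^+ k) *: (phi (j :: w) *m y *m (Xs k j)^T) +
    phi [:: j] *m (W *m x) *m (Xs k j)^T)).
  by rewrite scaler_sumr -big_split mulmx_sumr.
rewrite scaler_sumr; apply: eq_bigr => j _.
rewrite /Xs eqxx rcc_tr mul_row_col mulmxDl scalerDr mulmxDr addrC; congr (_ + _).
  rewrite /T -!scalemxAr -!scalemxAl !scalerA mulrC; congr (_ *: _).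
  by rewrite !mulmxA.
have [e _] := hW j; rewrite -[in RHS]scalemxAr -[in RHS]scalemxAr; congr (_ *: _).
rewrite [phi _ *m (W *m x)]mulmxA [phi _ *m W]e.
by rewrite !mulmxA isoW' mul1mx.
Qed.

End HigherCoefficients.

(** * Block form and conclusion *)

Section IsometryCompletion.
Variable R : realType.
Local Notation C := (Cplx R).

Lemma isometry_complete q p (W : 'M[C]_(q, p)) : W^t* *m W = 1%:M ->
  exists (m : nat) (e : (p + m)%N = q) (N : 'M[C]_(q, m)),
    N^t* *m N = 1%:M /\ W^t* *m N = 0.
Proof.
move=> isoW; pose V := W^t*.
have uV : V \is unitarymx by apply/unitarymxP; rewrite adjK.
have e : (p + \rank (orthomx Num.Def.conjC (hermitian1mx q) V))%N = q.
  by have := add_rank_ortho V; rewrite (mxrank_unitary uV).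
pose N' := schmidt (row_base (orthomx Num.Def.conjC (hermitian1mx q) V)).
exists _, e, (N'^t*); rewrite adjK; split.
  by apply/unitarymxP; apply: schmidt_unitarymx; rewrite rank_leq_col.
apply/orthomx1P; rewrite orthomx_sym.
by rewrite eqmx_schmidt_free ?eq_row_base ?row_base_free.
Qed.

End IsometryCompletion.

Section Compression.
Variables (R : realType) (g d' d : nat) (L : pencil R g d' d).
Local Notation C := (Cplx R).

Lemma contraction_valued_compress q' q m' m (phi : fps R g q' q)
    (N' : 'M[C]_(q', m')) (N : 'M[C]_(q, m)) :
  contraction_valued L phi -> N'^t* *m N' = 1%:M -> N^t* *m N = 1%:M ->
  contraction_valued L (fun w => N'^t* *m phi w *m N).
Proof.
move=> [an hphi] isoN' isoN; set ft := fun w => _.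
have bN' : bnd 1 (N'^t*) by apply: bnd_adj => // r t; rewrite mul1r nn_isom.
have bN : bnd 1 N by move=> r t; rewrite mul1r nn_isom.
have cv n (X : mxtuple R g n) : pencil_ball L X ->
    series (fps_homog ft X) @ \oo --> ampl n (N'^t*) *m fps_eval phi X *m ampl n N.
  move=> hX; have /cvg_nnP h := an n X hX; apply/cvg_nnP => e e0.
  pose A := ampl n (N'^t*); pose B := ampl n N.
  have Se M : series (fps_homog ft X) M = A *m series (fps_homog phi X) M *m B.
    rewrite /series /= mulmx_sumr mulmx_suml; apply: eq_bigr => k _.
    apply: eq_mx_tvec => x; rewrite fps_homog_tvec hact_mul.
    by rewrite -!mulmxA ampl_tvec fps_homog_tvec ampl_tvec.
  have [c c0 hc] : exists2 c, 0 < c & forall D, nn (A *m D *m B) <= c * nn D.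
    have [a a0 ha] := nn_mulmx_bounded A.
    exists (a * ((q * n)%:R * nn B + 1)) => [|D].
      by rewrite mulr_gt0 // ltr_wpDl // mulr_ge0 // nn_ge0.
    rewrite -mulmxA; apply: le_trans (ha _ _) _; rewrite -mulrA.
    apply: ler_wpM2l; first exact: ltW.
    apply: le_trans (nn_mulmx_le _ _) _; rewrite mulrAC; apply: ler_wpM2r; first exact: nn_ge0.
    by rewrite lerDl.
  have := h _ (divr_gt0 e0 c0); apply: filterS => M hM.
  rewrite Se -mulmxBl -mulmxBr; apply: le_trans (hc _) _.
  by rewrite mulrC -ler_pdivlMr.
split=> n X hX.
  by apply/cvg_ex; exists (ampl n (N'^t*) *m fps_eval phi X *m ampl n N); exact: cv.
have -> : fps_eval ft X = ampl n (N'^t*) *m fps_eval phi X *m ampl n N.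
  by apply: limn_nn; exact: cv.
apply/opnorm_le1P => r t; rewrite -!mulmxA.
apply: le_trans (bnd_ampl bN' _) _; rewrite mul1r.
have /opnorm_le1P hp := hphi n X hX.
apply: le_trans (hp _ _) _; rewrite mul1r.
exact: (bnd_ampl bN).
Qed.

(** The two conditions on P make its off-diagonal blocks vanish for the decompositions given by (W',
    N') and (W, N). U and V depend on these isometries alone, so they serve all coefficients at
    once. *)
Lemma block_form p' p m' m q' q (e' : (p' + m')%N = q') (e : (p + m)%N = q)
    (W' : 'M[C]_(q', p')) (W : 'M[C]_(q, p)) (N' : 'M[C]_(q', m')) (N : 'M[C]_(q, m)) :
  W'^t* *m W' = 1%:M -> W^t* *m W = 1%:M -> N'^t* *m N' = 1%:M -> N^t* *m N = 1%:M ->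
  W'^t* *m N' = 0 -> W^t* *m N = 0 ->
  exists (U : 'M[C]_q') (V : 'M[C]_q),
    [/\ U \is unitarymx, V \is unitarymx & forall (P : 'M[C]_(q', q)) B,
      P *m W = W' *m B -> W'^t* *m P = B *m W^t* ->
      P = U *m castmx (e', e) (block_mx B 0 0 (N'^t* *m P *m N)) *m V^t*].
Proof.
case: q' / e' W' N' => W' N'; case: q / e W N => W N isoW' isoW isoN' isoN o' o.
have unit k r (Y : 'M[C]_(k + r, k)) (Z : 'M[C]_(k + r, r)) : Y^t* *m Y = 1%:M ->
    Z^t* *m Z = 1%:M -> Y^t* *m Z = 0 -> (row_mx Y Z)^t* *m row_mx Y Z = 1%:M.
  move=> hY hZ hYZ; rewrite tr_row_mx map_col_mx mul_col_row hY hZ hYZ.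
  have -> : Z^t* *m Y = 0 by rewrite -[LHS]adjK adjM adjK hYZ adj0.
  by rewrite -scalar_mx_block.
have uU := unit _ _ _ _ isoW' isoN' o'; have uV := unit _ _ _ _ isoW isoN o.
exists (row_mx W' N'), (row_mx W N); split.
- by apply/unitarymxP; apply: mulmx1C.
- by apply/unitarymxP; apply: mulmx1C.
move=> P B hPW hPW'; rewrite castmx_id.
have <- : (row_mx W' N')^t* *m P *m row_mx W N = block_mx B 0 0 (N'^t* *m P *m N).
  rewrite tr_row_mx map_col_mx mul_col_mx mul_col_row hPW' -!mulmxA isoW o mulmx1 mulmx0.
  congr block_mx; rewrite hPW mulmxA.
  by have -> : N'^t* *m W' = 0; rewrite ?mul0mx // -[LHS]adjK adjM adjK o' adj0.
by rewrite !mulmxA (mulmx1C uU) mul1mx -mulmxA (mulmx1C uV) mulmx1.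
Qed.

End Compression.

Lemma pencil_ball_map_structure (R : realType) (g d' d : nat) (L : pencil R g d' d)
    (q' q : nat) (phi : fps R g q' q) (p' p : nat) (Lt : pencil R g p' p) :
  (0 < g)%N -> pencil_ball_map L phi -> phi [::] = 0 -> minimal_pencil_for Lt L ->
  exists (m' m : nat) (el' : (p' + m')%N = q') (el : (p + m)%N = q)
         (U : 'M[Cplx R]_q') (V : 'M[Cplx R]_q) (ft : fps R g m' m),
    [/\ U \is unitarymx, V \is unitarymx, contraction_valued L ft
      & forall w : word g,
          phi w = U *m castmx (el', el)
                         (block_mx (pencil_fps Lt w) 0 0 (ft w))
                    *m V^t*].
Proof.
move=> g0 hphi phi0 [minL LtL].
have [p'0 p0] := nondegenerate_gt0 g0 minL.1.
have bmin := minimal_ball_minimal minL.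
have LtLb n (X : 'I_g -> 'M[Cplx R]_n) : pball Lt X <-> pball L X.
  rewrite !pball_bnd; split; first exact: same_ball_bnd1.
  by apply: same_ball_bnd1 => k; rewrite LtL.
have MLt n (X : 'I_g -> 'M[Cplx R]_n) : pball (linear_part phi) X <-> pball Lt X.
  by rewrite (linear_part_pball hphi phi0) LtLb.
have [W' [W [hW isoW' isoW]]] := isometric_embedding p'0 p0 bmin MLt.
have [m' [e' [N' [isoN' o']]]] := isometry_complete isoW'.
have [m [e [N [isoN o]]]] := isometry_complete isoW.
have [U [V [uU uV hUV]]] := block_form e' e isoW' isoW isoN' isoN o' o.
exists m', m, e', e, U, V, (fun w => N'^t* *m phi w *m N); split=> //.
  exact: (contraction_valued_compress hphi.1).
have hf := pencil_ball_map_contractive hphi.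
have AL n (X : 'I_g -> 'M[Cplx R]_n) : pball Lt X -> pball L X by move=> /LtLb.
have zr := higher_coef_mulr hf p'0 p0 bmin AL hW isoW' isoW.
have zl := higher_coef_mull hf p'0 p0 bmin AL hW isoW' isoW.
(* Length 0 uses phi(0) = 0 and length 1 the intertwining relations. For longer words the upper left
   block is zero: the last letter is split off for the right condition, the first letter for the
   left one. *)
case=> [|j [|i w]]; apply: hUV => /=.
- by rewrite phi0 mul0mx mulmx0.
- by rewrite phi0 mul0mx mulmx0.
- by have [h _] := hW j.
- by have [_ h] := hW j; rewrite -[LHS]adjK adjM adjK h adjM adjK.
- by rewrite mulmx0 lastI -cats1 zr // size_belast.
- by rewrite mul0mx zl.
Qed.

Theorem corollary6p4 (R : realType) (g g' : nat) (hg : (0 < g)%N)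
  (hg' : (0 < g')%N) (d' d l' l : nat)
  (L : pencil R g d' d) (L' : pencil R g' l' l)
  (hL : nondegenerate_pencil L) (hL' : nondegenerate_pencil L')
  (f : sfps_tuple R g g') (hf : ball_to_ball_map L L' f) :
  exists phi : fps R g l' l,
    [/\ forall n (X : mxtuple R g n), pencil_ball L X ->
          fps_eval phi X = linfrac (ampl n (comp_const L' f)) (comp_eval L' f X),
        forall n (X : mxtuple R g n), pencil_ball L X ->
          comp_eval L' f X = linfrac (ampl n (comp_const L' f)) (fps_eval phi X),
        pencil_ball_map L phi,
        forall n, fps_eval phi ((fun=> 0) : mxtuple R g n) = 0
      & forall (p' p : nat) (Lt : pencil R g p' p),
          minimal_pencil_for Lt L ->
          exists (m' m : nat) (el' : (p' + m')%N = l') (el : (p + m)%N = l)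
                 (U : 'M[Cplx R]_l') (V : 'M[Cplx R]_l) (ft : fps R g m' m),
            [/\ U \is unitarymx, V \is unitarymx, contraction_valued L ft
              & forall w : word g,
                  phi w = U *m castmx (el', el)
                                 (block_mx (pencil_fps Lt w) 0 0 (ft w))
                            *m V^t*] ].
Proof.
pose v := comp_const L' f; pose u := comp_fps L' f; pose phi := linfrac_fps u.
have [k [k0 k1 hv]] := comp_const_strict hf.1.
have hu : ball_contractive L u := comp_fps_contractive hf.1.
have cvu n (X : mxtuple R g n) : pencil_ball L X ->
    series (fps_homog u X) @ \oo --> fps_eval u X.
  by move=> hX; rewrite (comp_fps_eval hf.1 hX); exact: (comp_fps_cvg hf.1).
have uE n (X : mxtuple R g n) : pencil_ball L X -> fps_eval u X = comp_eval L' f X.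
  by move=> hX; exact: (comp_fps_eval hf.1 hX).
have cvphi n (X : mxtuple R g n) : pencil_ball L X ->
    series (fps_homog phi X) @ \oo --> linfrac (ampl n v) (comp_eval L' f X).
  by move=> hX; rewrite -uE //; exact: (cvg_linfrac_fps k0 k1 hv hu cvu).
have phiE n (X : mxtuple R g n) : pencil_ball L X ->
    fps_eval phi X = linfrac (ampl n v) (comp_eval L' f X).
  by move=> hX; apply: limn_nn; exact: cvphi.
have bV n : bnd k (ampl n v) := bnd_ampl hv.
have b1 n (X : mxtuple R g n) : pencil_ball L X -> bnd 1 (comp_eval L' f X).
  by move=> hX; rewrite -uE //; exact: hu.
have phi0 : phi [::] = 0 := linfrac_fps_nil k0 k1 hv.
have hphi : pencil_ball_map L phi.
  split; first split=> n X hX.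
  - by apply/cvg_ex; exists (linfrac (ampl n v) (comp_eval L' f X)); exact: cvphi.
  - by rewrite phiE //; apply/opnorm_le1P; exact: (linfrac_bnd1 k0 k1 (bV n) (b1 n X hX)).
  move=> n X hX; apply: (linfrac_bdry k0 k1 (bV n) (b1 n) (phiE n) hX).
  exact: hf.2.
exists phi; split.
- exact: phiE.
- by move=> n X hX; rewrite phiE // (linfracK k0 k1 (bV n)) //; exact: b1.
- exact: hphi.
- by move=> n; rewrite fps_eval0 phi0 /ampl tens0mx.
by move=> p' p Lt; exact: pencil_ball_map_structure.
Qed.
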